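(* Let $A=\begin{pmatrix}2&-a\\-b&2\end{pmatrix}$ with positive integers $a,b$, $ab>4$, let $(\mathcal B^+,\mathcal B^-)$ be the twin tree of the rank $2$ hyperbolic Kac–Moody group $G$ over $\mathbb C$, and use the notation of the context. For every $k\in\mathbb Z$ and each choice of sign $\pm$ (the same throughout), the action of the real root groups $U_{\pm\Phi_i(k)}$ on the chambers $C_n^\pm$ of the fundamental apartment $A^\pm$ satisfies: 1. Every chamber of $L^\pm_{\rm ray}(k)=\{C_n^\pm: n\le k\}$ is fixed by $U_{\pm\Phi_2(k)}$, but $U_{\pm\Phi_2(k)}R^\pm_{\rm ray}(k+1)=\{g\,R^\pm_{\rm ray}(k+1):g\in U_{\pm\Phi_2(k)}\}$ is a family of distinct rays in $\mathcal B^\pm$ indexed by $\mathbb C$ (via $U_{\pm\Phi_2(k)}\cong\mathbb C$), each of whose intersection with $L^\pm_{\rm ray}(k)$ is a unique vertex. 2. Every chamber of $R^\pm_{\rm ray}(k)=\{C_n^\pm:n\ge k\}$ is fixed by $U_{\pm\Phi_1(k)}$, but $U_{\pm\Phi_1(k)}L^\pm_{\rm ray}(k-1)$ is a family of distinct rays in $\mathcal B^\pm$ indexed by $\mathbb C$, each of whose intersection with $R^\pm_{\rm ray}(k)$ is a unique vertex.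
   Context: $\mathfrak g$ is the complex Kac–Moody algebra of $A=(a_{ij})$ with Chevalley generators $e_i,f_i,h_i$ ($i=1,2$), Cartan subalgebra $\mathfrak h=\mathbb Ch_1\oplus\mathbb Ch_2$, simple roots with $\alpha_i(h_j)=a_{ij}$, real roots $\Phi^{\rm re}$. $W=\langle w_1,w_2\rangle$ is the infinite dihedral Weyl group, $w_i(\alpha_j)=\alpha_j-\alpha_j(h_i)\alpha_i$. $G=\langle\exp(\mathrm{ad}(te_i)),\exp(\mathrm{ad}(tf_i)):i=1,2,\,t\in\mathbb C\rangle\le\mathrm{Aut}(\mathfrak g)$; $T_{\mathbb C}=\{\exp(\mathrm{ad}\,h):h\in\mathfrak h\}$; for $\alpha\in\Phi^{\rm re}$, $U_\alpha=\{\exp(\mathrm{ad}(te_\alpha)):t\in\mathbb C\}$ where $\mathfrak g_\alpha=\mathbb Ce_\alpha$; $B^\pm=T_{\mathbb C}\langle U_\alpha:\alpha\in\Phi^{\rm re}\cap\Phi^\pm\rangle$; $N=N_G(T_{\mathbb C})$, $N/T_{\mathbb C}\cong W$; $P_i^\pm=B^\pm\sqcup B^\pm w_iB^\pm$. $\mathcal B^\pm$ is the tree with vertex set $G/P_1^\pm\sqcup G/P_2^\pm$ and edges (chambers) $gB^\pm\in G/B^\pm$ joining $gP_1^\pm$ and $gP_2^\pm$; $G$ acts by left multiplication. Elements of $W$ are indexed by integers: $w(2m)=(w_2w_1)^m$, $w(2m+1)=(w_2w_1)^mw_2$. $C_n^\pm=w(n)B^\pm$. The fundamental apartment $A^\pm$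 is the line in $\mathcal B^\pm$ with successive chambers $C_n^\pm$, $n\in\mathbb Z$, consecutive chambers $C^\pm_n$, $C^\pm_{n+1}$ sharing the vertex $v^\pm_{n+1/2}$. For $n\in\mathbb Z$, $L^\pm_{\rm ray}(n)=\{C_m^\pm:m\le n\}$ and $R^\pm_{\rm ray}(n)=\{C_m^\pm:m\ge n\}$, each including all boundary vertices of its chambers. Real roots are labelled, for $i=1,2$ with $\hat i=3-i$, by $\Phi_i(n)=w(n)\alpha_i$ for $n$ even and $\Phi_i(n)=w(n)\alpha_{\hat i}$ for $n$ odd. *)

(* Defs.v *)
From HB Require Import structures.
From mathcomp Require Import all_boot all_order all_algebra generic_quotient.
From mathcomp Require Import boolp classical_sets reals sequences exp trigo.
From mathcomp Require Import complex.

Set Implicit Arguments.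
Unset Strict Implicit.
Unset Printing Implicit Defensive.

Import Order.TTheory GRing.Theory Num.Theory.

Local Open Scope classical_set_scope.
Local Open Scope quotient_scope.
Local Open Scope ring_scope.
Local Open Scope complex_scope.

(* The indices 1, 2 are encoded as the two elements of 'I_2. *)
Definition i1 : 'I_2 := ord0.
Definition i2 : 'I_2 := ord_max.

(* i |-> 3 - i on {1, 2} *)
Definition ihat (i : 'I_2) : 'I_2 := rev_ord i.

Definition cartan (a b : nat) : 'M[int]_2 :=
  \matrix_(i, j) if i == j then 2 else if i == i1 then - a%:Z else - b%:Z.

(** * The Kac-Moody algebra g(A), presented by generators and relations *)

Inductive km_gen := KE of 'I_2 | KF of 'I_2 | KH of 'I_2.

Inductive km_term (K : Type) :=
| TGen of km_gen
| TZero
| TAdd of km_term K & km_term K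
| TOpp of km_term K
| TScale of K & km_term K
| TLie of km_term K & km_term K.
Arguments TGen {K}.
Arguments TZero {K}.

HB.instance Definition _ (K : Type) := gen_eqMixin (km_term K).
HB.instance Definition _ (K : Type) := gen_choiceMixin (km_term K).

Section KacMoodyAlgebra.
Variables (K : fieldType) (A : 'M[int]_2).

Notation e i := (TGen (KE i)).
Notation f i := (TGen (KF i)).
Notation h i := (TGen (KH i)).

(* The congruence on Lie expressions generated by the axioms of a Lie algebra
   over K and the Chevalley-Serre relations; since alpha_i(h_j) = a_ij, the
   Serre exponent of (ad e_i) on e_j is 1 - alpha_j(h_i) = 1 - a_ji. *)
Inductive km_eq : km_term K -> km_term K -> Prop :=
| km_refl x : km_eq x x
| km_sym x y : km_eq x y -> km_eq y x
| km_trans x y z : km_eq x y -> km_eq y z -> km_eq x z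
| km_congD x x' y y' : km_eq x x' -> km_eq y y' ->
    km_eq (TAdd x y) (TAdd x' y')
| km_congN x x' : km_eq x x' -> km_eq (TOpp x) (TOpp x')
| km_congZ c x x' : km_eq x x' -> km_eq (TScale c x) (TScale c x')
| km_congL x x' y y' : km_eq x x' -> km_eq y y' ->
    km_eq (TLie x y) (TLie x' y')
| km_addA x y z : km_eq (TAdd x (TAdd y z)) (TAdd (TAdd x y) z)
| km_addC x y : km_eq (TAdd x y) (TAdd y x)
| km_add0 x : km_eq (TAdd TZero x) x
| km_addN x : km_eq (TAdd (TOpp x) x) TZero
| km_scaleA c d x : km_eq (TScale c (TScale d x)) (TScale (c * d) x)
| km_scale1 x : km_eq (TScale 1 x) x
| km_scaleDr c x y :
    km_eq (TScale c (TAdd x y)) (TAdd (TScale c x) (TScale c y))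
| km_scaleDl c d x :
    km_eq (TScale (c + d) x) (TAdd (TScale c x) (TScale d x))
| km_lieDl x y z : km_eq (TLie (TAdd x y) z) (TAdd (TLie x z) (TLie y z))
| km_lieDr x y z : km_eq (TLie x (TAdd y z)) (TAdd (TLie x y) (TLie x z))
| km_lieZl c x y : km_eq (TLie (TScale c x) y) (TScale c (TLie x y))
| km_lieZr c x y : km_eq (TLie x (TScale c y)) (TScale c (TLie x y))
| km_liexx x : km_eq (TLie x x) TZero
| km_jacobi x y z :
    km_eq (TAdd (TLie x (TLie y z))
            (TAdd (TLie y (TLie z x)) (TLie z (TLie x y)))) TZero
| km_hh i j : km_eq (TLie (h i) (h j)) TZero
| km_he i j : km_eq (TLie (h j) (e i)) (TScale (A i j)%:~R (e i))
| km_hf i j : km_eq (TLie (h j) (f i)) (TScale (- (A i j)%:~R) (f i))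
| km_ef i : km_eq (TLie (e i) (f i)) (h i)
| km_ef0 i j : i != j -> km_eq (TLie (e i) (f j)) TZero
| km_serre_e i j : i != j ->
    km_eq (iter `|1 - A j i|%N (TLie (e i)) (e j)) TZero
| km_serre_f i j : i != j ->
    km_eq (iter `|1 - A j i|%N (TLie (f i)) (f j)) TZero.

Definition km_eqb : rel (km_term K) := fun x y => `[< km_eq x y >].

Lemma km_eqb_refl : reflexive km_eqb.
Proof. by move=> x; apply/asboolP; exact: km_refl. Qed.

Lemma km_eqb_sym : symmetric km_eqb.
Proof. by move=> x y; apply/asboolP/asboolP; exact: km_sym. Qed.

Lemma km_eqb_trans : transitive km_eqb.
Proof.
move=> y x z /asboolP xy /asboolP yz; apply/asboolP; exact: km_trans yz.
Qed.

Canonical km_equiv := EquivRel km_eqb km_eqb_refl km_eqb_sym km_eqb_trans.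

Definition kac_moody := {eq_quot km_equiv}.
HB.instance Definition _ := EqQuotient.on kac_moody.
HB.instance Definition _ := Choice.on kac_moody.

Lemma km_piP (x y : km_term K) :
  km_eq x y <-> \pi_kac_moody x = \pi_kac_moody y.
Proof. by split=> [xy|/eqmodP/asboolP//]; apply/eqmodP/asboolP. Qed.

Lemma km_reprK (x : km_term K) : km_eq (repr (\pi_kac_moody x)) x.
Proof. by apply/km_piP; rewrite reprK. Qed.

Local Notation cl x := (\pi_kac_moody x).

Definition kmzero : kac_moody := cl TZero.
Definition kmadd (x y : kac_moody) : kac_moody := cl (TAdd (repr x) (repr y)).
Definition kmopp (x : kac_moody) : kac_moody := cl (TOpp (repr x)).
Definition kmscale (c : K) (x : kac_moody) : kac_moody :=
  cl (TScale c (repr x)).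
Definition lie (x y : kac_moody) : kac_moody := cl (TLie (repr x) (repr y)).

Lemma pi_kmadd x y : kmadd (cl x) (cl y) = cl (TAdd x y).
Proof. by apply/km_piP; apply: km_congD; exact: km_reprK. Qed.
Lemma pi_kmopp x : kmopp (cl x) = cl (TOpp x).
Proof. by apply/km_piP; apply: km_congN; exact: km_reprK. Qed.
Lemma pi_kmscale c x : kmscale c (cl x) = cl (TScale c x).
Proof. by apply/km_piP; apply: km_congZ; exact: km_reprK. Qed.
Lemma pi_lie x y : lie (cl x) (cl y) = cl (TLie x y).
Proof. by apply/km_piP; apply: km_congL; exact: km_reprK. Qed.

Lemma kmaddA : associative kmadd.
Proof.
elim/quotW=> x; elim/quotW=> y; elim/quotW=> z.
rewrite (pi_kmadd y z) (pi_kmadd x y) (pi_kmadd x) (pi_kmadd _ z).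
by apply/km_piP; exact: km_addA.
Qed.
Lemma kmaddC : commutative kmadd.
Proof.
elim/quotW=> x; elim/quotW=> y.
rewrite (pi_kmadd x y) (pi_kmadd y x).
by apply/km_piP; exact: km_addC.
Qed.
Lemma kmadd0 : left_id kmzero kmadd.
Proof. by elim/quotW=> x; rewrite pi_kmadd; apply/km_piP; exact: km_add0. Qed.
Lemma kmaddN : left_inverse kmzero kmopp kmadd.
Proof.
by elim/quotW=> x; rewrite pi_kmopp pi_kmadd; apply/km_piP; exact: km_addN.
Qed.
HB.instance Definition _ :=
  GRing.isZmodule.Build kac_moody kmaddA kmaddC kmadd0 kmaddN.

Lemma kmscaleA c d x : kmscale c (kmscale d x) = kmscale (c * d) x.
Proof.
elim/quotW: x => x; rewrite (pi_kmscale d x) !(pi_kmscale c) pi_kmscale.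
by apply/km_piP; exact: km_scaleA.
Qed.
Lemma kmscale1 : left_id 1 kmscale.
Proof.
by elim/quotW=> x; rewrite pi_kmscale; apply/km_piP; exact: km_scale1.
Qed.
Lemma kmscaleDr : right_distributive kmscale +%R.
Proof.
move=> c; elim/quotW=> x; elim/quotW=> y.
rewrite [_ + _](pi_kmadd x y) !(pi_kmscale c).
rewrite [RHS](pi_kmadd (TScale c x) (TScale c y)).
by apply/km_piP; exact: km_scaleDr.
Qed.
Lemma kmscaleDl x : {morph kmscale^~ x : c d / c + d}.
Proof.
elim/quotW: x => x c d; rewrite (pi_kmscale c) (pi_kmscale d) pi_kmscale.
rewrite [RHS](pi_kmadd (TScale c x) (TScale d x)).
by apply/km_piP; exact: km_scaleDl.
Qed.
HB.instance Definition _ := GRing.Zmodule_isLmodule.Build K kac_moody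
  kmscaleA kmscale1 kmscaleDr kmscaleDl.

Definition ke (i : 'I_2) : kac_moody := cl (e i).
Definition kf (i : 'I_2) : kac_moody := cl (f i).
Definition kh (i : 'I_2) : kac_moody := cl (h i).

End KacMoodyAlgebra.

(** * Roots and the Weyl group *)

(* Elements of the root lattice, by their coordinates on alpha_1, alpha_2. *)
Notation lattice := ('rV[int]_2).

Definition simple_root (i : 'I_2) : lattice := delta_mx 0 i.

Section Weyl.
Variable A : 'M[int]_2.

(* mu(h_j) *)
Definition pairing (mu : lattice) (j : 'I_2) : int := \sum_i mu 0 i * A i j.

Definition simple_refl (i : 'I_2) (mu : lattice) : lattice :=
  mu - pairing mu i *: simple_root i.

(* w(n), using the floor quotient and the remainder of n by 2 *)
Definition weyl_pow (m : int) : lattice -> lattice :=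
  match m with
  | Posz p => iter p (simple_refl i2 \o simple_refl i1)
  | Negz p => iter p.+1 (simple_refl i1 \o simple_refl i2)
  end.

Definition weyl (n : int) : lattice -> lattice :=
  if (n %% 2)%Z == 0 then weyl_pow (n %/ 2)%Z
  else weyl_pow (n %/ 2)%Z \o simple_refl i2.

Definition Phi (i : 'I_2) (n : int) : lattice :=
  weyl n (simple_root (if (n %% 2)%Z == 0 then i else ihat i)).

End Weyl.

(** * Groups of bijections, products and cosets *)

Inductive generated (T : Type) (S : set (T -> T)) : set (T -> T) :=
| gen_in g : S g -> generated S g
| gen_id : generated S id
| gen_comp g g' : generated S g -> generated S g' -> generated S (g \o g')
| gen_inv g g' : generated S g -> cancel g g' -> cancel g' g ->
    generated S g'.

Definition prodset (T : Type) (X Y : set (T -> T)) : set (T -> T) :=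
  [set x \o y | x in X & y in Y].

Definition lcoset (T : Type) (g : T -> T) (X : set (T -> T)) : set (T -> T) :=
  [set g \o x | x in X].

Definition rcoset (T : Type) (X : set (T -> T)) (g : T -> T) : set (T -> T) :=
  [set x \o g | x in X].

Definition real_roots (A : 'M[int]_2) : set lattice :=
  [set w (simple_root i) | w in generated (range (simple_refl A)) & i in setT].

(* The sign + is false, the sign - is true, as in (-1) ^+ s. *)
Definition signed_roots (s : bool) : set lattice :=
  [set mu | forall i, 0 <= (-1) ^+ s * mu 0 i].

(** * Exponentials of endomorphisms *)

Definition expC (R : realType) (z : R[i]) : R[i] :=
  (expR (complex.Re z) * cos (complex.Im z)) +i*
  (expR (complex.Re z) * sin (complex.Im z)).

Section Exponential.
Variables (R : realType) (V : lmodType R[i]).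

(* For a locally finite endomorphism D, the series exp D is the linear map given
   on each generalized eigenspace by the finite sum
   exp(c) * sum_n (D - c)^n / n!. For D locally nilpotent only c = 0 occurs. *)
Definition is_exp (D phi : V -> V) : Prop :=
  linear phi /\
  forall (c : R[i]) (N : nat) (x : V), iter N (fun y => D y - c *: y) x = 0 ->
    phi x = expC c *:
      \sum_(n < N) (n`!%:R)^-1 *: iter n (fun y => D y - c *: y) x.

Definition Exp (D : V -> V) : V -> V := xget (id : V -> V) (is_exp D).

End Exponential.

(** * The group G and its twin tree *)

Section KacMoodyGroup.
Variables (R : realType) (A : 'M[int]_2).
Local Notation C := R[i].
Local Notation g := (kac_moody C A).
Local Notation End := (g -> g).

Definition Exp_ad (x : g) : End := Exp (lie x).

Definition cartan_elt (c : 'rV[C]_2) : g := \sum_i c 0 i *: kh C A i.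

(* mu(h) for h = c_1 h_1 + c_2 h_2 *)
Definition weight_at (mu : lattice) (c : 'rV[C]_2) : C :=
  \sum_i c 0 i * (pairing A mu i)%:~R.

Definition root_space (mu : lattice) : set g :=
  [set x | forall c, lie (cartan_elt c) x = weight_at mu c *: x].

(* e_alpha, for alpha a real root *)
Definition root_vector (alpha : lattice) : g :=
  xget 0 [set x | root_space alpha = range (fun t : C => t *: x)].

Definition root_elt (alpha : lattice) (t : C) : End :=
  Exp_ad (t *: root_vector alpha).

Definition root_group (alpha : lattice) : set End := range (root_elt alpha).

Definition kac_moody_group : set End :=
  generated [set phi | exists i (t : C),
    phi = Exp_ad (t *: ke C A i) \/ phi = Exp_ad (t *: kf C A i)].

Definition torus : set End := range (fun c => Exp_ad (cartan_elt c)).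

Definition torus_normalizer : set End :=
  [set phi | kac_moody_group phi /\ lcoset phi torus = rcoset torus phi].

(* The coset of T corresponding to w under the isomorphism N / T = W, which is
   the action of N on the weights. *)
Definition weyl_coset (w : lattice -> lattice) : set End :=
  [set phi | torus_normalizer phi /\ forall mu, phi @` root_space mu = root_space (w mu)].

Section HalfTwin.
Variable s : bool.

Definition borel : set End :=
  prodset torus
    (generated (\bigcup_(alpha in real_roots A `&` signed_roots s) root_group alpha)).

Definition parabolic (i : 'I_2) : set End :=
  borel `|` prodset borel (prodset (weyl_coset (simple_refl A i)) borel).

(* Edges are elements of G/B, vertices elements of G/P_1 and G/P_2; the index
   makes the union of the latter two disjoint. *)
Inductive simplex := Chamber of set End | Vertex of 'I_2 & set End.

Definition act (phi : End) (x : simplex) : simplex :=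
  match x with
  | Chamber X => Chamber (lcoset phi X)
  | Vertex i X => Vertex i (lcoset phi X)
  end.

Definition tree_chamber (c : simplex) : Prop :=
  exists2 phi, kac_moody_group phi & c = Chamber (lcoset phi borel).

Definition tree_vertex (v : simplex) : Prop :=
  exists i, exists2 phi, kac_moody_group phi & v = Vertex i (lcoset phi (parabolic i)).

(* The vertices phi P_1 and phi P_2 of the chamber c = phi B. *)
Definition boundary (c : simplex) : set simplex :=
  [set v | exists2 phi, kac_moody_group phi & c = Chamber (lcoset phi borel) /\
             exists i, v = Vertex i (lcoset phi (parabolic i))].

Definition closed_chamber (c : simplex) : set simplex := c |` boundary c.

Definition is_ray (S : set simplex) : Prop :=
  exists (x c : nat -> simplex),
    [/\ forall n, tree_vertex (x n),
        injective x,
        forall n, tree_chamber (c n),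
        forall n, boundary (c n) = [set x n; x n.+1] &
        S = range x `|` range c].

Definition apt_chamber (n : int) : simplex :=
  Chamber (prodset (weyl_coset (weyl A n)) borel).

Definition Lray (n : int) : set simplex :=
  \bigcup_(m in [set m : int | m <= n]) closed_chamber (apt_chamber m).

Definition Rray (n : int) : set simplex :=
  \bigcup_(m in [set m : int | n <= m]) closed_chamber (apt_chamber m).

(* With alpha a real root: U_alpha S is a family of pairwise distinct rays
   indexed by C, each meeting S' in exactly one vertex. *)
Definition ray_family_meeting_at_vertex
    (alpha : lattice) (S S' : set simplex) : Prop :=
  injective (fun t : C => act (root_elt alpha t) @` S) /\
  forall phi, root_group alpha phi ->
    is_ray (act phi @` S) /\
    exists2 v, tree_vertex v & (act phi @` S) `&` S' = [set v].

End HalfTwin.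
End KacMoodyGroup.

Arguments root_group R A alpha _ : clear implicits.
Arguments apt_chamber R A s n : clear implicits.
Arguments Lray R A s n _ : clear implicits.
Arguments Rray R A s n _ : clear implicits.

(* Main.v *)
(* The Borel subgroup B of sign s preserves the sum of the weight spaces of weights
   of sign s, while the lift of w(n) moves these weights by w(n), so the position
   of w(n) B is read off from the root spaces it meets; similarly for P_i, which
   adds only the weight -alpha_i. A root group U_alpha fixes w(n) B as soon as
   w(n)^-1 alpha has sign s, and for Phi_2(k) this means n <= k. On the other side,
   a nontrivial u in U_alpha sends a root vector of weight -alpha to a vector with
   nonzero components of weights -alpha and alpha, so u moves the ray off the
   apartment, and it only keeps the vertex where the ray starts.
   That w(n) B and w(n+1) B share a vertex, that is n_i P_i = P_i for a lift n_i
   of w_i, follows from B = U_(alpha_i) (B /\ n_i B n_i^-1). This holds because the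
   real roots of one sign form two sequences such that the bracket of alpha_i with
   a root of its own sequence vanishes or is a real root vector; the invariant
   quadratic form excludes other roots. The argument needs e_i, f_i to be nonzero,
   which is seen on a Verma-type module. *)

Require Import Defs.
From mathcomp Require Import all_boot all_order all_algebra generic_quotient.
From mathcomp Require Import boolp classical_sets reals sequences exp trigo.
From mathcomp Require Import complex.
From mathcomp Require Import zify ring lra.

Set Implicit Arguments.
Unset Strict Implicit.
Unset Printing Implicit Defensive.

Import Order.TTheory GRing.Theory Num.Theory.

Local Open Scope classical_set_scope.
Local Open Scope quotient_scope.
Local Open Scope ring_scope.
Local Open Scope complex_scope.

(** The algebra is known through its presentation only, so each notion defined by [xget] ([Exp],
    [root_vector]) has its default value until existence is proved: local nilpotency of ad e_i and
    ad f_i gives the unipotent exponentials, rescalings of the generators give the torus, and lifts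
    of W carry the lines of the simple root spaces to all real roots. The inequality ab > 4 enters
    in two ways. The determinant 4 - ab of A is nonzero, so h_1, h_2 separate weights and T realizes
    every character of the root lattice; and ab - 2 >= 3 makes the real roots grow along their two
    sequences. The exceptional bracket of alpha_i with a root of its own sequence can be nonzero
    only if an off-diagonal entry of A is -1, and then for a single root of the sequence. Both
    halves of the statement are one computation, because Phi_1(k) = - Phi_2(k - 1). *)

(** * Linear maps between modules *)

Section LinearProp.
Variables (K : pzRingType) (V W : lmodType K) (f : V -> W).
Hypothesis lf : linear f.

Lemma lin0 : f 0 = 0.
Proof. by have := lf (-1) 0 0; rewrite scaler0 add0r scaleN1r addNr. Qed.
Lemma linD x y : f (x + y) = f x + f y.
Proof. by have := lf 1 x y; rewrite !scale1r. Qed.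
Lemma linZ a x : f (a *: x) = a *: f x.
Proof. by have := lf a x 0; rewrite lin0 !addr0. Qed.
Lemma linN x : f (- x) = - f x.
Proof. by rewrite -scaleN1r linZ scaleN1r. Qed.
Lemma lin_sum I (r : seq I) (P : pred I) (F : I -> V) :
  f (\sum_(i <- r | P i) F i) = \sum_(i <- r | P i) f (F i).
Proof. exact: (big_morph f linD lin0). Qed.
Lemma linMn x n : f (x *+ n) = f x *+ n.
Proof. by elim: n => [|n IH]; rewrite ?mulr0n ?lin0 // !mulrS linD IH. Qed.
End LinearProp.

Lemma linear_comp (K : pzRingType) (V : lmodType K) (f g : V -> V) :
  linear f -> linear g -> linear (f \o g).
Proof. by move=> lf lg a x y /=; rewrite lg lf. Qed.

Lemma linear_iter (K : pzRingType) (V : lmodType K) (f : V -> V) n :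
  linear f -> linear (iter n f).
Proof. by move=> lf; elim: n => [|n IH] a x y //=; rewrite IH lf. Qed.

Lemma linear_inv (K : pzRingType) (V : lmodType K) (f g : V -> V) :
  linear f -> cancel f g -> cancel g f -> linear g.
Proof.
by move=> lf fg gf a x y; rewrite -[in LHS](gf x) -[in LHS](gf y) -lf fg.
Qed.

(** * Truncated exponential series *)

Section ExpSums.
Variables (K : numFieldType) (V : lmodType K).

(** The cut-off is an argument because for a locally nilpotent D it depends on x; any N with D^N x =
    0 gives the same value. *)
Definition exp_sum (D : V -> V) (N : nat) (x : V) : V :=
  \sum_(n < N) (n`!%:R)^-1 *: iter n D x.

Lemma iter_lin0 (D : V -> V) n : linear D -> iter n D 0 = 0.
Proof. by move=> lD; elim: n => //= n ->; rewrite lin0. Qed.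

Lemma iter_ge0 (D : V -> V) N M x :
  linear D -> (N <= M)%N -> iter N D x = 0 -> iter M D x = 0.
Proof.
by move=> lD le0 DN; rewrite -(subnK le0) iterD DN iter_lin0.
Qed.

Lemma exp_sum_ge (D : V -> V) N M x : linear D -> (N <= M)%N ->
  iter N D x = 0 -> exp_sum D M x = exp_sum D N x.
Proof.
move=> lD NM DN; rewrite /exp_sum -!(big_mkord xpredT (fun n => (n`!%:R)^-1 *: iter n D x)).
rewrite (big_cat_nat (leq0n _) NM) //= [X in _ + X]big_nat_cond [X in _ + X]big1 ?addr0 // => n.
by case/andP=> /andP[Nn _] _; rewrite (iter_ge0 lD Nn DN) scaler0.
Qed.

Lemma exp_sum_indep (D : V -> V) N M x : linear D ->
  iter N D x = 0 -> iter M D x = 0 -> exp_sum D N x = exp_sum D M x.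
Proof.
move=> lD DN DM; case: (leqP N M) => [NM|/ltnW MN]; first by rewrite -(exp_sum_ge lD NM).
by rewrite -(exp_sum_ge lD MN).
Qed.

Lemma linear_exp_sum (D : V -> V) N : linear D -> linear (exp_sum D N).
Proof.
move=> lD a x y; rewrite /exp_sum scaler_sumr -big_split /=; apply: eq_bigr => n _.
by rewrite (linear_iter n lD) scalerDr !scalerA mulrC.
Qed.

(** The triangle on the left contains the rectangle k < N, l < M, and F vanishes on the rest of it:
    this is the reindexing behind a Cauchy product. *)
Lemma sum_antidiagonal (N M : nat) (F : nat -> nat -> V) :
  (forall k l, ((N <= k) || (M <= l))%N -> F k l = 0) ->
  \sum_(n < N + M) \sum_(k < n.+1) F k (n - k)%N =
  \sum_(k < N) \sum_(l < M) F k l.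
Proof.
move=> F0; set S := (N + M)%N.
transitivity (\sum_(k < S) \sum_(n < S | (k <= n)%N) F k (n - k)%N).
  rewrite (exchange_big_dep xpredT) //=; apply: eq_bigr => n _.
  rewrite -(big_mkord (fun k => (k <= n)%N) (fun k => F k (n - k)%N)).
  rewrite -(big_mkord xpredT (fun k => F k (n - k)%N)).
  rewrite [RHS](big_cat_nat (n := n.+1)) //=.
  rewrite [X in _ = _ + X]big_nat_cond [X in _ = _ + X]big1 ?addr0; last first.
    by move=> k; case: leqP => //; rewrite andbF.
  rewrite [RHS]big_nat_cond [LHS]big_nat_cond; apply: eq_bigl => k.
  by rewrite andbT; case: (ltnP k n.+1) => //; rewrite ltnS => ->.
transitivity (\sum_(k < S) \sum_(l < M) F k l).
  apply: eq_bigr => k _.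
  rewrite -(big_mkord (fun n => (k <= n)%N) (fun n => F k (n - k)%N)).
  rewrite -(big_mkord xpredT (fun l => F k l)).
  have kS : (k <= S)%N by exact: ltnW.
  rewrite (big_cat_nat (n := k)) //= [X in X + _]big_nat_cond [X in X + _]big1 ?add0r; last first.
    by move=> n /andP[/andP[_ nk] kn]; move: nk; rewrite ltnNge kn.
  rewrite -{1}(add0n (k : nat)) big_addn.
  under eq_bigl => l do rewrite leq_addl.
  under eq_bigr => l _ do rewrite addnK.
  case: (leqP M (S - k)) => h.
    rewrite (big_cat_nat (n := M)) //= [X in _ + X]big_nat_cond [X in _ + X]big1 ?addr0 //.
    by move=> l /andP[/andP[Ml _] _]; rewrite F0 // Ml orbT.
  (* A column that stops before l = M has k >= N, so all its terms vanish. *)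
  have Nk : (N <= k)%N by move: h; rewrite /S; lia.
  by rewrite !big1 // => l _; rewrite F0 // Nk.
rewrite -(big_mkord xpredT (fun k => \sum_(l < M) F k l)).
rewrite -(big_mkord xpredT (fun k => \sum_(l < M) F k l)).
rewrite (big_cat_nat (n := N)) //= ?leq_addr //.
rewrite [X in _ + X]big_nat_cond [X in _ + X]big1 ?addr0 // => k /andP[/andP[Nk _] _].
by rewrite big1 // => l _; rewrite F0 // Nk.
Qed.

(* The common part of Leibniz' rule and of exp (D + D') = exp D exp D': in the
   first case P k l = [D^k x, D^l y], in the second P k l = D^k D'^l x. *)
Section Binomial.
Variables (T : V -> V) (P : nat -> nat -> V) (N M : nat).
Hypothesis lT : linear T.
Hypothesis TP : forall k l, T (P k l) = P k.+1 l + P k l.+1.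
Hypothesis P0 : forall k l, ((N <= k) || (M <= l))%N -> P k l = 0.

Lemma iter_binomial n :
  iter n T (P 0 0) = \sum_(k < n.+1) P k (n - k)%N *+ 'C(n, k).
Proof.
elim: n => [|n IH]; first by rewrite big_ord_recl big_ord0 addr0 bin0.
rewrite iterS IH (lin_sum lT).
under eq_bigr => k _ do rewrite (linMn lT) TP mulrnDl.
rewrite big_split /= [in RHS]big_ord_recl /= bin0.
under [in RHS]eq_bigr => k _ do rewrite /bump /= add1n binS mulrnDr subSS.
rewrite big_split /= [LHS]addrC addrA; congr (_ + _).
rewrite [X in _ = _ + X]big_ord_recr /= bin_small // mulr0n addr0.
rewrite -(big_mkord xpredT (fun k => P k (n - k).+1 *+ 'C(n, k))).
rewrite -(big_mkord xpredT (fun k => P k.+1 (n - k)%N *+ 'C(n, k.+1))).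
rewrite big_nat_recl // bin0 subn0; congr (_ + _).
rewrite [LHS]big_nat_cond [RHS]big_nat_cond; apply: eq_bigr => k /andP[/andP[_ kn] _].
by rewrite subnSK.
Qed.

Lemma iter_binomial0 : iter (N + M) T (P 0 0) = 0.
Proof.
rewrite iter_binomial big1 // => k _; rewrite P0 ?mul0rn //.
by case: (leqP N k) => //= kN; lia.
Qed.

(** The identity C(n, k) / n! = 1 / (k! (n - k)!) separates the two indices. *)
Lemma exp_sum_binomial : exp_sum T (N + M) (P 0 0) =
  \sum_(k < N) (k`!%:R)^-1 *: \sum_(l < M) (l`!%:R)^-1 *: P k l.
Proof.
under [RHS]eq_bigr => k _ do
  (rewrite scaler_sumr; under eq_bigr => l _ do rewrite scalerA).
rewrite -(@sum_antidiagonal N M (fun k l => ((k`!%:R)^-1 * (l`!%:R)^-1) *: P k l)); last first.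
  by move=> k l h; rewrite P0 ?scaler0.
apply: eq_bigr => n _; rewrite iter_binomial scaler_sumr; apply: eq_bigr => k _.
rewrite -scaler_nat scalerA; congr (_ *: _).
have kn : (k <= n)%N by rewrite -ltnS.
have fN0 m : (m`!%:R : K) != 0 by rewrite pnatr_eq0 -lt0n fact_gt0.
have := congr1 (fun m => m%:R : K) (bin_fact kn); rewrite !natrM => <-.
have bN0 : ('C(n, k)%:R : K) != 0 by rewrite pnatr_eq0 -lt0n bin_gt0.
by field; rewrite bN0 !fN0.
Qed.
End Binomial.
End ExpSums.

(** * The complex exponential *)

Section ExpTheory.
Variables (R : realType).
Local Notation C := R[i].

Lemma expC0 : expC 0 = 1 :> C.
Proof. by rewrite /expC /= expR0 cos0 sin0 mulr1 mulr0. Qed.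

Lemma expCD (z w : C) : expC (z + w) = expC z * expC w.
Proof.
case: z w => [x y] [x' y']; rewrite /expC /= expRD cosD sinD.
by apply/eqP; rewrite eq_complex /=; apply/andP; split; apply/eqP; ring.
Qed.

Lemma expC_neq0 (z : C) : expC z != 0.
Proof.
apply: contraTneq (oner_neq0 C) => z0.
by have := expCD z (- z); rewrite z0 mul0r subrr expC0 => ->; rewrite eqxx.
Qed.

(** Polar coordinates. Surjectivity is what lets the torus realize arbitrary nonzero scalars. *)
Lemma expC_surj (z : C) : z != 0 -> exists w, expC w = z.
Proof.
case: z => x y; rewrite eq_complex /= => xy0.
set r := Num.sqrt (x ^+ 2 + y ^+ 2).
have r20 : 0 < x ^+ 2 + y ^+ 2.
  rewrite lt0r addr_ge0 ?sqr_ge0 // andbT paddr_eq0 ?sqr_ge0 //.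
  by rewrite !sqrf_eq0.
have r0 : 0 < r by rewrite sqrtr_gt0.
have r2 : r ^+ 2 = x ^+ 2 + y ^+ 2 by rewrite sqr_sqrtr // ltW.
have xr : x = r * (x / r) by rewrite mulrCA mulfV ?mulr1 // gt_eqF.
have yr : y = r * (y / r) by rewrite mulrCA mulfV ?mulr1 // gt_eqF.
have n1 : (x / r) ^+ 2 + (y / r) ^+ 2 = 1.
  by rewrite !expr_div_n -mulrDl -r2 mulfV // gt_eqF // exprn_gt0.
have x1 : -1 <= x / r <= 1.
  by have y2 := sqr_ge0 (y / r); apply/andP; split; nra.
have cx : cos (acos (x / r)) = x / r by apply: acosK; rewrite in_itv.
have sy : sin (acos (x / r)) ^+ 2 = (y / r) ^+ 2.
  by apply: (addrI ((x / r) ^+ 2)); rewrite n1 -{1}cx cos2Dsin2.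
(* [acos] returns an angle in [0, pi], so the sine is known only up to sign; the opposite angle
   repairs the other case. *)
have [s0|s0] : sin (acos (x / r)) = y / r \/ sin (acos (x / r)) = - (y / r).
  by move/eqP: sy; rewrite eqf_sqr => /orP[] /eqP; [left|right].
- exists (ln r +i* acos (x / r)).
  by rewrite /expC /= lnK ?posrE // cx s0 -xr -yr.
- exists (ln r +i* - acos (x / r)).
  by rewrite /expC /= lnK ?posrE // cosN sinN cx s0 opprK -xr -yr.
Qed.
End ExpTheory.

Lemma comp_eq (T : Type) (f g h k : T -> T) : f \o g = h \o k -> forall z, f (g z) = h (k z).
Proof. by move=> H z; rewrite -[LHS]/((f \o g) z) H. Qed.

(** The relation phi p = p' phi, which avoids writing phi^-1, passes to products and inverses, so
    generators suffice. *)
Lemma generated_conj (T : Type) (S S' : set (T -> T)) (phi psi : T -> T) :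
  cancel phi psi -> cancel psi phi ->
  (forall p, S p -> exists2 p', generated S' p' & phi \o p = p' \o phi) ->
  forall p, generated S p -> exists2 p', generated S' p' & phi \o p = p' \o phi.
Proof.
move=> K K' H p; elim=> [q /H //||p1 q _ [p' Hp Ep] _ [q' Hq Eq]|p1 q _ [p' Hp Ep] pq qp].
- by exists id => //; exact: gen_id.
- exists (p' \o q'); first exact: gen_comp.
  by rewrite -[LHS]/((phi \o p1) \o q) Ep -[LHS]/(p' \o (phi \o q)) Eq.
- exists (phi \o q \o psi); last by apply: funext => x /=; rewrite K.
  have p'E : p' = phi \o p1 \o psi.
    by apply: funext => x; have := comp_eq Ep (psi x); rewrite /= K' => <-.
  apply: (gen_inv Hp); rewrite p'E => x /=; first by rewrite K pq.
  by rewrite K qp.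
Qed.

(** * Exponentials of locally nilpotent endomorphisms *)

Section LocallyNilpotent.
Variables (R : realType) (V : lmodType R[i]).
Implicit Types (D : V -> V).

Definition locnilp D := forall x, exists N, iter N D x = 0.

Lemma iter_sub0 D n : iter n (fun y => D y - 0 *: y) =1 iter n D.
Proof.
by move=> x; apply: eq_iter => y; rewrite scale0r subr0.
Qed.

Lemma is_exp_sum D phi N x : is_exp D phi -> iter N D x = 0 -> phi x = exp_sum D N x.
Proof.
case=> _ /(_ 0 N x) Dphi DN; rewrite Dphi ?iter_sub0 // expC0 scale1r.
by apply: eq_bigr => n _; rewrite iter_sub0.
Qed.

Lemma locnilp_eigen0 D c x : linear D -> locnilp D -> D x = c *: x -> c != 0 -> x = 0.
Proof.
move=> lD nD Dx c0; have [N] := nD x.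
have -> : iter N D x = c ^+ N *: x.
  by elim: N => [|N IH]; rewrite ?scale1r //= IH linZ // Dx scalerA exprSr.
by move=> /eqP; rewrite scaler_eq0 expf_eq0 (negPf c0) andbF => /eqP.
Qed.

(** The only eigenvalue of a locally nilpotent map is 0; for c nonzero the clause of [is_exp]
    therefore concerns x = 0. *)
Lemma locnilp_geneigen0 D c N x : linear D -> locnilp D -> c != 0 ->
  iter N (fun y => D y - c *: y) x = 0 -> x = 0.
Proof.
move=> lD nD c0; elim: N => // N IH /= /eqP; rewrite subr_eq0 => /eqP Dx.
exact/IH/(locnilp_eigen0 lD nD Dx).
Qed.

Lemma linear_sub_scale D c : linear D -> linear (fun y => D y - c *: y).
Proof.
move=> lD a x y /=; rewrite lD scalerDr opprD scalerBr addrACA; congr (_ - _ + _).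
by rewrite !scalerA mulrC.
Qed.

(** [Exp] is a choice with default [id], so existence must be shown. The witness cuts the series at
    an order depending on x; independence of that order gives linearity. *)
Lemma is_exp_Exp D : linear D -> locnilp D -> is_exp D (Exp D).
Proof.
move=> lD nD; rewrite /Exp; apply: xgetPex.
have phiP x : {N | iter N D x = 0} by apply: cid; exact: nD.
pose phi x := exp_sum D (projT1 (phiP x)) x.
have phiE N x : iter N D x = 0 -> phi x = exp_sum D N x.
  by move=> DN; apply: exp_sum_indep => //; exact: (projT2 (phiP x)).
exists phi; split.
- move=> a x y; have [Nx Hx] := nD x; have [Ny Hy] := nD y.
  have Dx := iter_ge0 lD (leq_maxl Nx Ny) Hx.
  have Dy := iter_ge0 lD (leq_maxr Nx Ny) Hy.
  rewrite (phiE _ _ Dx) (phiE _ _ Dy) (phiE (maxn Nx Ny)); last first.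
    by rewrite (linear_iter _ lD) Dx Dy scaler0 addr0.
  by rewrite (linear_exp_sum _ lD).
- move=> c N x; have [->|c0] := eqVneq c 0.
    rewrite iter_sub0 expC0 scale1r => DN; rewrite (phiE _ _ DN).
    by apply: eq_bigr => n _; rewrite iter_sub0.
  move=> /(locnilp_geneigen0 lD nD c0) ->.
  rewrite (phiE 0%N) //= /exp_sum big_ord0 big1 ?scaler0 // => n _.
  by rewrite iter_lin0 ?scaler0 //; exact: linear_sub_scale.
Qed.

Lemma ExpE D N x : linear D -> locnilp D -> iter N D x = 0 -> Exp D x = exp_sum D N x.
Proof. by move=> lD nD; apply: is_exp_sum; exact: is_exp_Exp. Qed.

Lemma linear_Exp D : linear D -> locnilp D -> linear (Exp D).
Proof. by move=> lD nD; case: (is_exp_Exp lD nD). Qed.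

Lemma linear_scaled D a : linear D -> linear (fun x => a *: D x).
Proof. by move=> lD b x y; rewrite lD scalerDr !scalerA mulrC. Qed.

Lemma iter_scaled D a n x : linear D ->
  iter n (fun x => a *: D x) x = a ^+ n *: iter n D x.
Proof.
move=> lD; elim: n => [|n IH]; first by rewrite scale1r.
by rewrite /= IH linZ // scalerA -exprS.
Qed.

Lemma locnilp_scaled D a : linear D -> locnilp D -> locnilp (fun x => a *: D x).
Proof.
by move=> lD nD x; have [N DN] := nD x; exists N; rewrite iter_scaled // DN scaler0.
Qed.

Lemma linear_add D D' : linear D -> linear D' -> linear (fun x => D x + D' x).
Proof. by move=> lD lD' a x y; rewrite lD lD' scalerDr addrACA. Qed.

Section Commuting.
Variables (D D' : V -> V).
Hypotheses (lD : linear D) (lD' : linear D') (nD : locnilp D) (nD' : locnilp D').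
Hypothesis DD' : forall x, D (D' x) = D' (D x).

Lemma iter_comm k l x : iter k D (iter l D' x) = iter l D' (iter k D x).
Proof.
elim: k l x => // k IH l x /=; rewrite IH; elim: l (iter k D x) => //= l IHl y.
by rewrite DD' IHl.
Qed.

Let P x k l := iter k D (iter l D' x).
Let TP x k l : D (P x k l) + D' (P x k l) = P x k.+1 l + P x k l.+1.
Proof. by rewrite /P; congr (_ + _); rewrite !iter_comm. Qed.
Let P0 x N M : iter N D x = 0 -> iter M D' x = 0 ->
  forall k l, ((N <= k) || (M <= l))%N -> P x k l = 0.
Proof.
move=> HN HM k l /orP[Nk|Ml]; rewrite /P.
  by rewrite iter_comm (iter_ge0 lD Nk HN) iter_lin0.
by rewrite (iter_ge0 lD' Ml HM) iter_lin0.
Qed.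

Lemma locnilp_add : locnilp (fun x => D x + D' x).
Proof.
move=> x; have [N HN] := nD x; have [M HM] := nD' x; exists (N + M)%N.
exact: (iter_binomial0 (linear_add lD lD') (TP x) (P0 HN HM)).
Qed.

Lemma Exp_add x : Exp (fun x => D x + D' x) x = Exp D (Exp D' x).
Proof.
have [N HN] := nD x; have [M HM] := nD' x.
have lS := linear_add lD lD'.
rewrite (@ExpE _ (N + M)) //; last 2 first.
- exact: locnilp_add.
- exact: (iter_binomial0 lS (TP x) (P0 HN HM)).
rewrite (exp_sum_binomial lS (TP x) (P0 HN HM)).
rewrite (ExpE lD' nD' HM) (@ExpE D N) //; last first.
  rewrite (lin_sum (linear_iter N lD)) big1 // => l _.
  by rewrite (linZ (linear_iter N lD)) iter_comm HN iter_lin0 // scaler0.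
apply: eq_bigr => k _; congr (_ *: _).
rewrite (lin_sum (linear_iter k lD)); apply: eq_bigr => l _.
by rewrite (linZ (linear_iter k lD)).
Qed.
End Commuting.

Lemma Exp_addZ D a b x : linear D -> locnilp D ->
  Exp (fun x => (a + b) *: D x) x = Exp (fun x => a *: D x) (Exp (fun x => b *: D x) x).
Proof.
move=> lD nD; rewrite -Exp_add; try exact: linear_scaled; try exact: locnilp_scaled.
  by congr (Exp _ _); apply: funext => y; rewrite scalerDl.
by move=> y; rewrite !(linZ lD) !scalerA mulrC.
Qed.

Lemma Exp0 : Exp (fun _ : V => 0) = id.
Proof.
apply: funext => x; rewrite (@ExpE _ 1) //.
- by rewrite /exp_sum big_ord1 /= invr1 scale1r.
- by move=> a u v; rewrite scaler0 addr0.
- by move=> y; exists 1%N.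
Qed.

Lemma Exp_conj D D' phi : linear D -> locnilp D -> linear D' -> locnilp D' ->
  linear phi -> (forall x, phi (D x) = D' (phi x)) ->
  forall x, phi (Exp D x) = Exp D' (phi x).
Proof.
move=> lD nD lD' nD' lphi h x; have hN n y : phi (iter n D y) = iter n D' (phi y).
  by elim: n => //= n <-.
have [N DN] := nD x.
rewrite (ExpE lD nD DN) (@ExpE D' N) -?hN ?DN ?lin0 // (lin_sum lphi).
by apply: eq_bigr => n _; rewrite (linZ lphi) hN.
Qed.

Section Derivation.
Variables (br : V -> V -> V) (D : V -> V).
Hypotheses (brl : forall y, linear (br^~ y)) (brr : forall x, linear (br x)).
Hypotheses (lD : linear D) (nD : locnilp D).
Hypothesis Dbr : forall x y, D (br x y) = br (D x) y + br x (D y).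

Let P x y k l := br (iter k D x) (iter l D y).
Let P0 x y N M : iter N D x = 0 -> iter M D y = 0 ->
  forall k l, ((N <= k) || (M <= l))%N -> P x y k l = 0.
Proof.
move=> HN HM k l /orP[Nk|Ml]; rewrite /P.
  by rewrite (iter_ge0 lD Nk HN) (lin0 (brl _)).
by rewrite (iter_ge0 lD Ml HM) (lin0 (brr _)).
Qed.

Lemma derivation_nilp N M x y :
  iter N D x = 0 -> iter M D y = 0 -> iter (N + M) D (br x y) = 0.
Proof.
by move=> HN HM; apply: (@iter_binomial0 _ _ _ (P x y)) => //; [move=> k l; exact: Dbr|exact: P0].
Qed.

Lemma Exp_derivation x y : Exp D (br x y) = br (Exp D x) (Exp D y).
Proof.
have [N HN] := nD x; have [M HM] := nD y.
rewrite (ExpE lD nD (derivation_nilp HN HM)).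
rewrite (@exp_sum_binomial _ _ D (P x y)) //; [|by move=> k l; exact: Dbr|exact: P0].
rewrite (ExpE lD nD HN) (ExpE lD nD HM) (lin_sum (brl _)); apply: eq_bigr => k _.
rewrite (linZ (brl _)) (lin_sum (brr _)); congr (_ *: _); apply: eq_bigr => l _.
by rewrite (linZ (brr _)).
Qed.
End Derivation.
End LocallyNilpotent.

(** * Lie identities, induction principles and automorphisms of g *)

Section LieAlgebra.
Variables (R : realType) (A : 'M[int]_2).
Local Notation C := R[i].
Local Notation g := (kac_moody C A).
Local Notation cl x := (\pi_g x).
Implicit Types (x y z : g) (i j : 'I_2).

Lemma km_quotW (P : g -> Prop) : (forall t, P (cl t)) -> forall x, P x.
Proof. by move=> H; elim/quotW. Qed.

Lemma cl_add (x y : km_term C) : cl (TAdd x y) = cl x + cl y.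
Proof. by rewrite -[RHS]/(kmadd _ _) pi_kmadd. Qed.
Lemma cl_opp (x : km_term C) : cl (TOpp x) = - cl x.
Proof. by rewrite -[RHS]/(kmopp _) pi_kmopp. Qed.
Lemma cl_zero : cl TZero = 0.
Proof. by []. Qed.
Lemma cl_scale c (x : km_term C) : cl (TScale c x) = c *: cl x.
Proof. by rewrite -[RHS]/(kmscale _ _) pi_kmscale. Qed.
Lemma cl_lie (x y : km_term C) : cl (TLie x y) = lie (cl x) (cl y).
Proof. by rewrite pi_lie. Qed.

Lemma lieDl x y z : lie (x + y) z = lie x z + lie y z.
Proof.
elim/km_quotW: x => x; elim/km_quotW: y => y; elim/km_quotW: z => z.
by rewrite -!(cl_add, cl_opp, cl_scale, cl_lie); apply/km_piP; exact: km_lieDl.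
Qed.
Lemma lieDr x y z : lie x (y + z) = lie x y + lie x z.
Proof.
elim/km_quotW: x => x; elim/km_quotW: y => y; elim/km_quotW: z => z.
by rewrite -!(cl_add, cl_opp, cl_scale, cl_lie); apply/km_piP; exact: km_lieDr.
Qed.
Lemma lieZl c x y : lie (c *: x) y = c *: lie x y.
Proof.
elim/km_quotW: x => x; elim/km_quotW: y => y.
by rewrite -(cl_scale c x) -!cl_lie -cl_scale; apply/km_piP; exact: km_lieZl.
Qed.
Lemma lieZr c x y : lie x (c *: y) = c *: lie x y.
Proof.
elim/km_quotW: x => x; elim/km_quotW: y => y.
by rewrite -(cl_scale c y) -!cl_lie -cl_scale; apply/km_piP; exact: km_lieZr.
Qed.
Lemma liexx x : lie x x = 0.
Proof.
by elim/km_quotW: x => x; rewrite -!(cl_add, cl_opp, cl_scale, cl_lie) -cl_zero; apply/km_piP; exact: km_liexx.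
Qed.
Lemma linear_liel y : linear (fun x => lie x y).
Proof. by move=> c x z; rewrite lieDl lieZl. Qed.
Lemma linear_lie x : linear (lie x).
Proof. by move=> c y z; rewrite lieDr lieZr. Qed.
Lemma lie0l x : lie 0 x = 0. Proof. exact: lin0 (linear_liel x). Qed.
Lemma lie0r x : lie x 0 = 0. Proof. exact: lin0 (linear_lie x). Qed.
Lemma lieNl x y : lie (- x) y = - lie x y. Proof. exact: linN (linear_liel y) x. Qed.
Lemma lieNr x y : lie x (- y) = - lie x y. Proof. exact: linN (linear_lie x) y. Qed.
Lemma lieC x y : lie x y = - lie y x.
Proof.
apply/eqP; rewrite -addr_eq0; apply/eqP.
by have := liexx (x + y); rewrite lieDl !lieDr !liexx addr0 add0r.
Qed.
Lemma jacobi x y z : lie x (lie y z) = lie (lie x y) z + lie y (lie x z).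
Proof.
have J : lie x (lie y z) + (lie y (lie z x) + lie z (lie x y)) = 0.
  elim/km_quotW: x => x; elim/km_quotW: y => y; elim/km_quotW: z => z.
  by rewrite -!(cl_add, cl_opp, cl_scale, cl_lie) -cl_zero; apply/km_piP; exact: km_jacobi.
move/eqP: J; rewrite addr_eq0 => /eqP ->.
by rewrite opprD (lieC z x) lieNr opprK (lieC z) opprK addrC.
Qed.

Lemma lie_hh i j : lie (kh C A i) (kh C A j) = 0.
Proof. by rewrite -!(cl_add, cl_opp, cl_scale, cl_lie) -cl_zero; apply/km_piP; exact: km_hh. Qed.
Lemma lie_he i j : lie (kh C A j) (ke C A i) = (A i j)%:~R *: ke C A i.
Proof. by rewrite -!(cl_add, cl_opp, cl_scale, cl_lie); apply/km_piP; exact: km_he. Qed.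
Lemma lie_hf i j : lie (kh C A j) (kf C A i) = - (A i j)%:~R *: kf C A i.
Proof. by rewrite -!(cl_add, cl_opp, cl_scale, cl_lie); apply/km_piP; exact: km_hf. Qed.
Lemma lie_ef i : lie (ke C A i) (kf C A i) = kh C A i.
Proof. by rewrite -!(cl_add, cl_opp, cl_scale, cl_lie); apply/km_piP; exact: km_ef. Qed.
Lemma lie_ef0 i j : i != j -> lie (ke C A i) (kf C A j) = 0.
Proof. by move=> ij; rewrite -!(cl_add, cl_opp, cl_scale, cl_lie) -cl_zero; apply/km_piP; exact: km_ef0. Qed.

Lemma cl_iter_lie n (x y : km_term C) :
  cl (iter n (TLie x) y) = iter n (lie (cl x)) (cl y).
Proof. by elim: n => // n IH; rewrite !iterS cl_lie IH. Qed.
Lemma serre_e i j : i != j -> iter `|1 - A j i|%N (lie (ke C A i)) (ke C A j) = 0.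
Proof. by move=> ij; rewrite -cl_iter_lie; apply/km_piP; exact: km_serre_e. Qed.
Lemma serre_f i j : i != j -> iter `|1 - A j i|%N (lie (kf C A i)) (kf C A j) = 0.
Proof. by move=> ij; rewrite -cl_iter_lie; apply/km_piP; exact: km_serre_f. Qed.

Lemma km_ind (P : g -> Prop) :
  (forall i, P (ke C A i)) -> (forall i, P (kf C A i)) -> (forall i, P (kh C A i)) ->
  P 0 -> (forall x y, P x -> P y -> P (x + y)) ->
  (forall c x, P x -> P (c *: x)) -> (forall x y, P x -> P y -> P (lie x y)) ->
  forall x, P x.
Proof.
move=> Pe Pf Ph P0 PD PZ PL; elim/km_quotW; elim=> [[]//||||c|].
- exact: P0.
- by move=> x Px y Py; rewrite cl_add; apply: PD.
- by move=> x Px; rewrite cl_opp -scaleN1r; apply: PZ.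
- by move=> x Px; rewrite cl_scale; apply: PZ.
- by move=> x Px y Py; rewrite cl_lie; apply: PL.
Qed.

(** By Jacobi the x with [x, P] inside P form a Lie subalgebra. It contains the generators, so it is
    everything, and P is then closed under all brackets. *)
Lemma km_ideal (P : g -> Prop) :
  (forall i, P (ke C A i)) -> (forall i, P (kf C A i)) -> (forall i, P (kh C A i)) ->
  P 0 -> (forall x y, P x -> P y -> P (x + y)) -> (forall c x, P x -> P (c *: x)) ->
  (forall i x, P x -> P (lie (ke C A i) x)) -> (forall i x, P x -> P (lie (kf C A i) x)) ->
  (forall i x, P x -> P (lie (kh C A i) x)) ->
  forall x, P x.
Proof.
move=> Pe Pf Ph P0 PD PZ Le Lf Lh.
have LP x : forall y, P y -> P (lie x y).
  elim/km_ind: x => //.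
  - by move=> y _; rewrite lie0l.
  - by move=> x y Px Py z Pz; rewrite lieDl; apply: PD; auto.
  - by move=> c x Px y Py; rewrite lieZl; apply: PZ; auto.
  - move=> x y Px Py z Pz.
    have -> : lie (lie x y) z = lie x (lie y z) + (-1) *: lie y (lie x z).
      by rewrite scaleN1r jacobi addrK.
    by apply: PD; [|apply: PZ]; auto.
by elim/km_ind; auto.
Qed.

Lemma iter_lie_nilp N M x y z : iter N (lie x) y = 0 -> iter M (lie x) z = 0 ->
  iter (N + M) (lie x) (lie y z) = 0.
Proof.
apply: (derivation_nilp linear_liel linear_lie (linear_lie x)) => u v.
by rewrite jacobi.
Qed.

Definition lie_automorphism (phi : g -> g) :=
  [/\ linear phi, bijective phi & forall x y, phi (lie x y) = lie (phi x) (phi y)].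

Lemma lie_automorphism_id : lie_automorphism id.
Proof. by split=> //; exists id. Qed.

Lemma lie_automorphism_comp phi psi : lie_automorphism phi -> lie_automorphism psi ->
  lie_automorphism (phi \o psi).
Proof.
case=> l1 b1 h1 [l2 b2 h2]; split; [exact: linear_comp|exact: bij_comp|].
by move=> x y /=; rewrite h2 h1.
Qed.

Lemma lie_automorphism_inv phi psi : lie_automorphism phi ->
  cancel phi psi -> cancel psi phi -> lie_automorphism psi.
Proof.
case=> l1 b1 h1 K1 K2; split; [exact: linear_inv l1 K1 K2|by exists phi|].
by move=> x y; apply: (can_inj K1); rewrite h1 !K2.
Qed.

Lemma lie_automorphism_eq phi psi : lie_automorphism phi -> lie_automorphism psi ->
  (forall i, phi (ke C A i) = psi (ke C A i)) ->
  (forall i, phi (kf C A i) = psi (kf C A i)) -> phi = psi.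
Proof.
case=> l1 _ h1 [l2 _ h2] he hf; apply: funext; elim/km_ind => //.
- by move=> i; rewrite -lie_ef h1 h2 he hf.
- by rewrite (lin0 l1) (lin0 l2).
- by move=> x y hx hy; rewrite (linD l1) (linD l2) hx hy.
- by move=> c x hx; rewrite (linZ l1) (linZ l2) hx.
- by move=> x y hx hy; rewrite h1 h2 hx hy.
Qed.

(** * Exponentials of ad-nilpotent elements *)

Definition ad_nilp x := locnilp (lie x).

Lemma ad_nilpZ c x : ad_nilp x -> ad_nilp (c *: x).
Proof.
move=> nx; rewrite /ad_nilp.
have -> : lie (c *: x) = fun y => c *: lie x y by apply: funext => y; rewrite lieZl.
exact: locnilp_scaled (linear_lie x) nx.
Qed.

Lemma Exp_adE x N y : ad_nilp x -> iter N (lie x) y = 0 ->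
  Exp_ad x y = exp_sum (lie x) N y.
Proof. by move=> nx; apply: ExpE => //; exact: linear_lie. Qed.

Lemma Exp_adD s t x : ad_nilp x ->
  Exp_ad ((s + t) *: x) = Exp_ad (s *: x) \o Exp_ad (t *: x).
Proof.
move=> nx; apply: funext => y /=; have := Exp_addZ s t y (linear_lie x) nx.
have E c : Exp (fun y => c *: lie x y) = Exp_ad (c *: x).
  by rewrite /Exp_ad; congr Exp; apply: funext => z; rewrite lieZl.
by rewrite !E.
Qed.

Lemma Exp_ad0 : Exp_ad (0 : g) = id.
Proof.
by rewrite /Exp_ad -[RHS]Exp0; congr Exp; apply: funext => y; rewrite lie0l.
Qed.

Lemma Exp_adNK x : ad_nilp x -> cancel (Exp_ad x) (Exp_ad (- x)).
Proof.
move=> nx y; have := Exp_adD (-1) 1 nx; rewrite addNr scale0r Exp_ad0.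
by rewrite scale1r scaleN1r => /(congr1 (fun f => f y)) /= <-.
Qed.

Lemma Exp_adKN x : ad_nilp x -> cancel (Exp_ad (- x)) (Exp_ad x).
Proof.
move=> nx; have nx' : ad_nilp (- x) by rewrite -scaleN1r; exact: ad_nilpZ.
by have := Exp_adNK nx'; rewrite opprK.
Qed.

Lemma Exp_ad_aut x : ad_nilp x -> lie_automorphism (Exp_ad x).
Proof.
move=> nx; split; first exact: (linear_Exp (linear_lie x) nx).
  by exists (Exp_ad (- x)); [exact: Exp_adNK|exact: Exp_adKN].
move=> y z; apply: (Exp_derivation linear_liel linear_lie (linear_lie x) nx).
by move=> u v; rewrite jacobi.
Qed.

Lemma ad_nilp_aut phi x : lie_automorphism phi -> ad_nilp x -> ad_nilp (phi x).
Proof.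
case=> lphi [psi K1 K2] hphi nx y; have [N HN] := nx (psi y); exists N.
have -> : iter N (lie (phi x)) y = phi (iter N (lie x) (psi y)).
  by elim: N {HN} => [|N IH]; rewrite ?K2 //= hphi IH.
by rewrite HN (lin0 lphi).
Qed.

Lemma Exp_ad_conj phi x : lie_automorphism phi -> ad_nilp x ->
  phi \o Exp_ad x = Exp_ad (phi x) \o phi.
Proof.
move=> aphi nx; have [lphi _ hphi] := aphi.
have nx' := ad_nilp_aut aphi nx; apply: funext => y /=.
exact: (Exp_conj (linear_lie x) nx (linear_lie _) nx' lphi (hphi x)).
Qed.

Lemma Exp_ad_comm x y : ad_nilp x -> ad_nilp y -> lie x y = 0 ->
  Exp_ad (x + y) = Exp_ad x \o Exp_ad y.
Proof.
move=> nx ny xy; apply: funext => z /=.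
rewrite -[RHS](Exp_add (linear_lie x) (linear_lie y) nx ny); last first.
  by move=> u; rewrite jacobi xy lie0l add0r.
by rewrite /Exp_ad; congr (Exp _ _); apply: funext => u; rewrite lieDl.
Qed.

Lemma ad_nilp_eq0 x y : lie x y = 0 -> ad_nilp x -> Exp_ad x y = y.
Proof.
by move=> xy nx; rewrite (@Exp_adE _ 1) // /exp_sum big_ord1 /= invr1 scale1r.
Qed.
End LieAlgebra.

(** * Weights *)

Section Pairing.
Variable A : 'M[int]_2.
Implicit Types (mu nu : lattice) (i j : 'I_2).

Lemma pairingD mu nu j : pairing A (mu + nu) j = pairing A mu j + pairing A nu j.
Proof. by rewrite /pairing -big_split; apply: eq_bigr => i _; rewrite mxE mulrDl. Qed.

Lemma pairingZ c mu j : pairing A (c *: mu) j = c * pairing A mu j.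
Proof. by rewrite /pairing mulr_sumr; apply: eq_bigr => i _; rewrite mxE mulrA. Qed.

Lemma pairingN mu j : pairing A (- mu) j = - pairing A mu j.
Proof. by rewrite -scaleN1r pairingZ mulN1r. Qed.

Lemma pairingB mu nu j : pairing A (mu - nu) j = pairing A mu j - pairing A nu j.
Proof. by rewrite pairingD pairingN. Qed.

Lemma pairing0 j : pairing A 0 j = 0.
Proof. by rewrite -(scale0r 0) pairingZ mul0r. Qed.

Lemma pairing_simple i j : pairing A (simple_root i) j = A i j.
Proof.
rewrite /pairing (bigD1 i) //= big1 ?addr0; last first.
  by move=> k ki; rewrite mxE (negPf ki) andbF mul0r.
by rewrite mxE !eqxx mul1r.
Qed.
End Pairing.

Lemma ihatK : involutive ihat.
Proof. exact: rev_ordK. Qed.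
Lemma ihat_neq i : ihat i != i.
Proof. by case: i => [[|[|]]]. Qed.
Lemma neq_ihat i j : (j != i) = (j == ihat i).
Proof. by case: i j => [[|[|]] // ?] [[|[|]] // ?]. Qed.
Lemma sum_I2 (V : nmodType) (F : 'I_2 -> V) i : \sum_j F j = F i + F (ihat i).
Proof.
rewrite (bigD1 i) //= (bigD1 (ihat i)) ?ihat_neq //= big1 ?addr0 // => j.
by rewrite !neq_ihat ihatK => /andP[/eqP ->]; rewrite (negPf (ihat_neq i)).
Qed.
Lemma ihat_ind (P : 'I_2 -> Prop) i : P i -> P (ihat i) -> forall j, P j.
Proof. by move=> Pi Ph j; case: (eqVneq j i) => [->//|]; rewrite neq_ihat => /eqP ->. Qed.

Lemma lattice_eq (mu nu : lattice) i :
  mu 0 i = nu 0 i -> mu 0 (ihat i) = nu 0 (ihat i) -> mu = nu.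
Proof.
by move=> h h'; apply/rowP => j; move: j; apply: (@ihat_ind _ i).
Qed.

Section Weights.
Variables (R : realType) (A : 'M[int]_2).
(** Weights are separated by their values on h_1, h_2; for the matrices of the theorem this is the
    nonvanishing of det A. *)
Hypothesis pairing_inj : forall mu, (forall j, pairing A mu j = 0) -> mu = 0.
Local Notation C := R[i].
Local Notation g := (kac_moody C A).
Local Notation e := (ke C A).
Local Notation f := (kf C A).
Local Notation h := (kh C A).
Implicit Types (x y z : g) (mu nu : lattice) (i j : 'I_2).

Lemma cartan_elt_lie (c : 'rV[C]_2) x : lie (cartan_elt A c) x = \sum_i c 0 i *: lie (h i) x.
Proof.
rewrite /cartan_elt (lin_sum (linear_liel x)); apply: eq_bigr => i _.
by rewrite lieZl.
Qed.

Lemma cartan_elt_delta j : cartan_elt A (delta_mx 0 j) = h j :> g.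
Proof.
rewrite /cartan_elt (bigD1 j) //= big1 ?addr0; last first.
  by move=> i ij; rewrite mxE (negPf ij) andbF scale0r.
by rewrite mxE !eqxx scale1r.
Qed.

Lemma root_spaceP mu x : root_space mu x <-> forall j, lie (h j) x = (pairing A mu j)%:~R *: x.
Proof.
split=> [H j|H c].
  rewrite -cartan_elt_delta H /weight_at (bigD1 j) //= big1 ?addr0; last first.
    by move=> i ij; rewrite mxE (negPf ij) andbF mul0r.
  by rewrite mxE !eqxx mul1r.
rewrite cartan_elt_lie scaler_suml; apply: eq_bigr => i _.
by rewrite H scalerA.
Qed.

Lemma root_space0 mu : root_space mu (0 : g).
Proof. by move=> c; rewrite lie0r scaler0. Qed.
Lemma root_spaceD mu x y : root_space mu x -> root_space mu y -> root_space mu (x + y).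
Proof. by move=> Hx Hy c; rewrite lieDr Hx Hy scalerDr. Qed.
Lemma root_spaceZ mu (a : C) x : root_space mu x -> root_space mu (a *: x).
Proof. by move=> Hx c; rewrite lieZr Hx !scalerA mulrC. Qed.
Lemma root_spaceN mu x : root_space mu x -> root_space mu (- x).
Proof. by rewrite -scaleN1r; exact: root_spaceZ. Qed.

Lemma root_space_lie mu nu x y :
  root_space mu x -> root_space nu y -> root_space (mu + nu) (lie x y).
Proof.
move=> /root_spaceP Hx /root_spaceP Hy; apply/root_spaceP => j.
by rewrite jacobi Hx Hy lieZl lieZr -scalerDl pairingD rmorphD.
Qed.

Lemma root_space_e i : root_space (simple_root i) (e i).
Proof. by apply/root_spaceP => j; rewrite lie_he pairing_simple. Qed.
Lemma root_space_f i : root_space (- simple_root i) (f i).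
Proof. by apply/root_spaceP => j; rewrite lie_hf pairingN pairing_simple rmorphN. Qed.
Lemma root_space_h i : root_space 0 (h i).
Proof. by apply/root_spaceP => j; rewrite lie_hh pairing0 scale0r. Qed.

(* P is a polynomial in ad h_1, ad h_2. *)
Lemma weight_projector (l : seq lattice) mu : mu \notin l ->
  exists P : g -> g, [/\ linear P, forall x, root_space mu x -> P x = x,
    forall nu x, nu \in l -> root_space nu x -> P x = 0 &
    forall S : g -> Prop, (forall (c : C) x y, S x -> S y -> S (c *: x + y)) ->
      (forall j x, S x -> S (lie (h j) x)) -> forall x, S x -> S (P x)].
Proof.
elim: l => [_|nu l IH].
  by exists id; split.
rewrite inE negb_or => /andP[munu /IH[P [lP Pmu Pl PS]]].
have [j Hj] : exists j, pairing A mu j != pairing A nu j.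
  apply: contrapT => H; case/eqP: munu; apply/eqP; rewrite -subr_eq0; apply/eqP.
  apply: pairing_inj => j; rewrite pairingB; apply/eqP; rewrite subr_eq0; apply/negPn/negP => ?.
  by apply: H; exists j.
set m : C := (pairing A mu j)%:~R; set n : C := (pairing A nu j)%:~R.
have mn : m - n != 0 by rewrite /m /n -rmorphB intr_eq0 subr_eq0.
exists (fun x => (m - n)^-1 *: (lie (h j) (P x) - n *: P x)); split.
- have lh := linear_sub_scale n (linear_lie (h j)).
  exact: (linear_scaled _ (linear_comp lh lP)).
- move=> x Hx; rewrite Pmu //; have /root_spaceP -> := Hx.
  by rewrite -/m -scalerBl scalerA mulVf // scale1r.
- move=> nu' x; rewrite inE => /orP[/eqP ->|nl] Hx; last first.
    by rewrite (Pl _ _ nl Hx) lie0r scaler0 subr0 scaler0.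
  have : root_space nu (P x).
    apply: (PS (root_space nu)) => //.
      by move=> c y z Hy Hz; apply: root_spaceD => //; exact: root_spaceZ.
    move=> k y Hy; have /root_spaceP -> := Hy; exact: root_spaceZ.
  by move/root_spaceP => ->; rewrite subrr scaler0.
- move=> S SZ Sh x Sx; have SPx := PS S SZ Sh x Sx.
  have S0 : S 0 by have := SZ (-1) _ _ Sx Sx; rewrite scaleN1r addNr.
  rewrite -[X in S X]addr0; apply: (SZ) => //.
  by rewrite addrC -scaleNr; apply: SZ => //; exact: Sh.
Qed.

(** P may depend on the vector as well as on its weight, so that this also expresses conditions such
    as lying on a line or being scaled by a given map. *)
Inductive gspan (P : lattice -> g -> Prop) : g -> Prop :=
| gspan0 : gspan P 0
| gspanD x y : gspan P x -> gspan P y -> gspan P (x + y)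
| gspanI mu x : root_space mu x -> P mu x -> gspan P x.

Lemma gspan_sub (P Q : lattice -> g -> Prop) x :
  (forall mu y, root_space mu y -> P mu y -> Q mu y) -> gspan P x -> gspan Q x.
Proof.
move=> PQ; elim=> [|y z _ Hy _ Hz|mu y Hy Py]; [exact: gspan0|exact: gspanD|].
by apply: (@gspanI _ mu) => //; exact: PQ.
Qed.

Lemma gspanZ (P : lattice -> g -> Prop) (c : C) x :
  (forall mu (c : C) y, P mu y -> P mu (c *: y)) -> gspan P x -> gspan P (c *: x).
Proof.
move=> PZ; elim=> [|y z _ Hy _ Hz|mu y Hy Py]; first by rewrite scaler0; exact: gspan0.
  by rewrite scalerDr; exact: gspanD.
by apply: (@gspanI _ mu); [exact: root_spaceZ|exact: PZ].
Qed.

Lemma gspan_decomp (P : lattice -> g -> Prop) x :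
  (forall mu, P mu 0) -> (forall mu y z, P mu y -> P mu z -> P mu (y + z)) ->
  gspan P x -> exists (l : seq lattice) (F : lattice -> g),
    [/\ uniq l, forall mu, mu \notin l -> F mu = 0,
        forall mu, root_space mu (F mu) /\ P mu (F mu) & x = \sum_(mu <- l) F mu].
Proof.
move=> P0 PD; elim=> [|y z _ [l [F [ul Fl FP ->]]] _ [l' [F' [ul' Fl' FP' ->]]]|mu y Hy Py].
- exists [::], (fun=> 0); split=> //; last by rewrite big_nil.
  by move=> mu; split; [exact: root_space0|].
- have ext (s s' : seq lattice) (G : lattice -> g) : uniq s -> uniq s' -> {subset s <= s'} ->
      (forall mu, mu \notin s -> G mu = 0) -> \sum_(mu <- s) G mu = \sum_(mu <- s') G mu.
    move=> us us' ss' G0; rewrite [RHS](bigID (mem s)) /= [X in _ + X]big1 ?addr0 //.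
    rewrite -[RHS]big_filter; apply: perm_big; apply: uniq_perm => //; first exact: filter_uniq.
    by move=> mu; rewrite mem_filter; case: (boolP (mu \in s)) => //= /ss' ->.
  have uu : uniq (undup (l ++ l')) by exact: undup_uniq.
  exists (undup (l ++ l')), (fun mu => F mu + F' mu); split=> //.
  + by move=> mu; rewrite mem_undup mem_cat negb_or => /andP[/Fl -> /Fl' ->]; rewrite addr0.
  + move=> mu; have [r p] := FP mu; have [r' p'] := FP' mu.
    by split; [exact: root_spaceD|exact: PD].
  + rewrite big_split /=; congr (_ + _); apply: ext => // mu; rewrite mem_undup mem_cat => ->//.
    by rewrite orbT.
- exists [:: mu], (fun nu => if nu == mu then y else 0); split=> //.
  + by move=> nu; rewrite inE => /negPf ->.
  + by move=> nu; case: eqP => [->//|_]; split; [exact: root_space0|].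
  + by rewrite big_seq1 eqxx.
Qed.

(** Weight spaces are in direct sum: x - F mu has weight mu, hence is fixed by the projector onto
    mu, which kills every other component. *)
Lemma gspan_weight (P : lattice -> g -> Prop) mu x :
  (forall mu, P mu 0) -> (forall mu y z, P mu y -> P mu z -> P mu (y + z)) ->
  gspan P x -> root_space mu x -> P mu x.
Proof.
move=> P0 PD /gspan_decomp[//|//|l [F [ul Fl FP xE]]] Hx.
have Hl : mu \notin rem mu l by rewrite mem_rem_uniq // inE eqxx.
have [Q [lQ Qmu Ql _]] := weight_projector Hl.
have xF : x = F mu + \sum_(nu <- rem mu l) F nu.
  case: (boolP (mu \in l)) => ml; first by rewrite xE (big_rem mu).
  by rewrite rem_id // Fl // add0r.
have : x - F mu = 0; last by move/eqP; rewrite subr_eq0 => /eqP ->; case: (FP mu).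
rewrite -[LHS]Qmu; last by apply: root_spaceD => //; apply: root_spaceN; case: (FP mu).
rewrite xF addrC addKr (lin_sum lQ) big_seq big1 // => nu nul.
by apply: (Ql nu) => //; case: (FP nu).
Qed.

Lemma gspan_lie (P Q S : lattice -> g -> Prop) x y :
  (forall mu nu u v, root_space mu u -> root_space nu v -> P mu u -> Q nu v ->
     S (mu + nu) (lie u v)) -> gspan P x -> gspan Q y -> gspan S (lie x y).
Proof.
move=> H; elim=> [|x1 x2 _ H1 _ H2|mu u Hu Pu] Hy.
- by rewrite lie0l; exact: gspan0.
- by rewrite lieDl; apply: gspanD; auto.
- elim: Hy => [|y1 y2 _ H1 _ H2|nu v Hv Qv].
  + by rewrite lie0r; exact: gspan0.
  + by rewrite lieDr; apply: gspanD.
  + by apply: (gspanI (root_space_lie Hu Hv)); exact: H.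
Qed.

Lemma km_graded x : gspan (fun _ _ => True) x.
Proof.
elim/km_ind: x.
- by move=> i; apply: gspanI (root_space_e i) _.
- by move=> i; apply: gspanI (root_space_f i) _.
- by move=> i; apply: gspanI (root_space_h i) _.
- exact: gspan0.
- by move=> x y; exact: gspanD.
- by move=> c x; exact: gspanZ.
- by move=> x y Hx Hy; apply: gspan_lie Hx Hy.
Qed.

Definition wspan (Q : set lattice) : set g := gspan (fun mu _ => Q mu).

Lemma wspan_weight Q mu x : wspan Q x -> root_space mu x -> x != 0 -> Q mu.
Proof.
move=> Qx Hx x0.
(* The alternative x = 0 turns Q mu into a condition satisfied by 0, as [gspan_weight] requires. *)
have := @gspan_weight (fun mu x => x = 0 \/ Q mu) mu x; case=> //.
- by left.
- by move=> nu y z [->|?] [->|?]; rewrite ?addr0; auto; right.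
- by apply: gspan_sub Qx; right.
- by move=> x00; rewrite x00 eqxx in x0.
Qed.

Lemma wspanZ Q (c : C) x : wspan Q x -> wspan Q (c *: x).
Proof. exact: gspanZ. Qed.

Lemma wspan_lieh Q j x : wspan Q x -> wspan Q (lie (h j) x).
Proof.
elim=> [|y z _ Hy _ Hz|mu y Hy Py]; first by rewrite lie0r; exact: gspan0.
  by rewrite lieDr; exact: gspanD.
have /root_spaceP -> := Hy; apply: wspanZ; exact: gspanI Hy Py.
Qed.

(** [wspan Q] is stable under ad h_j, hence under the projectors, and so contains the components of
    its elements. *)
Lemma wspan_components Q (l : seq lattice) (F : lattice -> g) mu :
  uniq l -> (forall nu, root_space nu (F nu)) -> wspan Q (\sum_(nu <- l) F nu) ->
  mu \in l -> F mu != 0 -> Q mu.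
Proof.
move=> ul HF Qx ml Fm.
have Hl : mu \notin rem mu l by rewrite mem_rem_uniq // inE eqxx.
have [P [lP Pmu Pl PS]] := weight_projector Hl.
apply: (@wspan_weight _ _ (F mu)) => //.
have -> : F mu = P (\sum_(nu <- l) F nu).
  rewrite (big_rem mu) //= linD // Pmu // (lin_sum lP) big_seq big1 ?addr0 // => nu nl.
  exact: Pl nl _.
apply: PS Qx => [c x y Qx Qy|j x]; last exact: wspan_lieh.
by apply: gspanD => //; exact: wspanZ.
Qed.
End Weights.

(** * The generators e_i, f_i are nonzero *)

Lemma int_mulrn (z : int) n : z *+ n = z * n%:Z.
Proof. by rewrite -mulr_natr natz. Qed.

(** * Operators on functions and the ideal of the Serre elements *)

Section Operators.
Variable K : numFieldType.
Local Notation V := (seq 'I_2 -> K).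
Local Notation Op := (V -> V).
Implicit Types (T S X Y Z : Op).

Definition oplin T := forall c (p q : V) w,
  T (fun u => c * p u + q u) w = c * T p w + T q w.
Definition comm_op T S : Op := fun p w => T (S p) w - S (T p) w.

Lemma op_ext T S : (forall p w, T p w = S p w) -> T = S.
Proof. by move=> TS; apply: funext => p; apply: funext => w. Qed.

Lemma oplin0 T : oplin T -> forall w, T (fun=> 0) w = 0.
Proof.
move=> lT w; have := lT (-1) (fun=> 0) (fun=> 0) w.
by rewrite mulr0 addr0 mulN1r addNr.
Qed.
Lemma oplinB T (p q : V) w : oplin T -> T (fun u => p u - q u) w = T p w - T q w.
Proof.
move=> lT; have := lT (-1) q p w; rewrite mulN1r [RHS]addrC => <-.
by congr (T _ w); apply: funext => u; rewrite mulN1r addrC.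
Qed.

Lemma oplin_comm T S : oplin T -> oplin S -> oplin (comm_op T S).
Proof.
move=> lT lS c p q w; rewrite /comm_op.
have -> : S (fun u => c * p u + q u) = fun u => c * S p u + S q u by apply: funext => u.
have -> : T (fun u => c * p u + q u) = fun u => c * T p u + T q u by apply: funext => u.
by rewrite lS lT; ring.
Qed.

Lemma oplin_combo c T S : oplin T -> oplin S -> oplin (fun p w => c * T p w + S p w).
Proof. by move=> lT lS d p q w; rewrite lT lS; ring. Qed.

Lemma comm_op_combo X c T S : oplin X ->
  comm_op X (fun p w => c * T p w + S p w) =
  fun p w => c * comm_op X T p w + comm_op X S p w.
Proof. by move=> lX; apply: op_ext => p w; rewrite /comm_op lX; ring. Qed.

Lemma comm_op_jacobi X Y Z : oplin X -> oplin Y -> oplin Z -> forall p w,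
  comm_op (comm_op X Y) Z p w = comm_op X (comm_op Y Z) p w - comm_op Y (comm_op X Z) p w.
Proof. by move=> lX lY lZ p w; rewrite /comm_op !oplinB //; ring. Qed.

Section SerreIdeal.
Variables (A : 'M[int]_2) (E F H : 'I_2 -> Op).
Hypotheses (Aii : forall i, A i i = 2) (Aij : forall i j, i != j -> A i j < 0).
Hypotheses (lE : forall i, oplin (E i)) (lF : forall i, oplin (F i)) (lH : forall i, oplin (H i)).
Hypothesis HE : forall i j p w, comm_op (H j) (E i) p w = (A i j)%:~R * E i p w.
Hypothesis FE : forall i j p w, comm_op (F i) (E j) p w = if i == j then - H i p w else 0.

Definition serre_op i j := iter `|1 - A j i|%N (comm_op (E i)) (E j).

(** Only brackets with E_i are built in. Stability under H_k and F_k is proved below, and rests on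
    F_k commuting with the Serre elements. *)
Inductive serre_ideal : Op -> Prop :=
| serre_ideal_serre i j : i != j -> serre_ideal (serre_op i j)
| serre_ideal_ad i T : serre_ideal T -> serre_ideal (comm_op (E i) T)
| serre_ideal0 : serre_ideal (fun _ _ => 0)
| serre_ideal_combo c T S : serre_ideal T -> serre_ideal S ->
    serre_ideal (fun p w => c * T p w + S p w).

Lemma oplin_iter n i j : oplin (iter n (comm_op (E i)) (E j)).
Proof. by elim: n => //= n IH; exact: oplin_comm. Qed.

Lemma oplin_serre_ideal T : serre_ideal T -> oplin T.
Proof.
elim=> [i j _|i S _ lS||c S S' _ lS _ lS'].
- exact: oplin_iter.
- exact: oplin_comm.
- by move=> c p q w; rewrite mulr0 addr0.
- exact: oplin_combo.
Qed.

Lemma H_iter n i j k p w :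
  comm_op (H k) (iter n (comm_op (E i)) (E j)) p w =
  (A j k + A i k *+ n)%:~R * iter n (comm_op (E i)) (E j) p w.
Proof.
elim: n p w => [|n IH] p w; first by rewrite mulr0n addr0 HE.
set x := iter n (comm_op (E i)) (E j).
have lx : oplin x := oplin_iter n i j.
have J := comm_op_jacobi (lH k) (lE i) lx p w.
have -> : comm_op (H k) (iter n.+1 (comm_op (E i)) (E j)) p w =
    comm_op (comm_op (H k) (E i)) x p w + comm_op (E i) (comm_op (H k) x) p w.
  by rewrite J subrK.
have -> : comm_op (H k) (E i) = fun q v => (A i k)%:~R * E i q v + (fun _ _ => 0) q v.
  by apply: op_ext => q v; rewrite HE addr0.
have -> : comm_op (H k) x = fun q v => (A j k + A i k *+ n)%:~R * x q v + (fun _ _ => 0) q v.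
  by apply: op_ext => q v; rewrite IH addr0.
rewrite comm_op_combo // /= -/x {1}/comm_op lx.
rewrite (_ : comm_op (E i) (fun _ _ => 0) p w = 0); last first.
  by rewrite /comm_op oplin0 // subr0.
have x0 : x (fun=> 0) w = 0 by exact: oplin0.
rewrite x0 mulrS -[in RHS]/x [X in _ = _ * X]/comm_op.
by rewrite [X in _ + (_ * X + _)]/comm_op !rmorphD /=; ring.
Qed.

(** The sl_2 string computation. The coefficient is - n (a_ji + n - 1), which vanishes at the Serre
    exponent n = 1 - a_ji. *)
Lemma F_iter_neq n i j p w : i != j ->
  comm_op (F i) (iter n (comm_op (E i)) (E j)) p w =
  - (A j i *+ n + n%:Z * (n%:Z - 1))%:~R * iter n.-1 (comm_op (E i)) (E j) p w.
Proof.
move=> ij; elim: n p w => [|n IH] p w; first by rewrite FE (negPf ij) mulr0n oppr0 mul0r.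
set x := iter n (comm_op (E i)) (E j).
have lx : oplin x := oplin_iter n i j.
have J := comm_op_jacobi (lF i) (lE i) lx p w.
have -> : comm_op (F i) (iter n.+1 (comm_op (E i)) (E j)) p w =
    comm_op (comm_op (F i) (E i)) x p w + comm_op (E i) (comm_op (F i) x) p w.
  by rewrite J subrK.
have -> : comm_op (F i) (E i) = fun q v => (-1) * H i q v + (fun _ _ => 0) q v.
  by apply: op_ext => q v; rewrite FE eqxx addr0 mulN1r.
have -> : comm_op (F i) x = fun q v =>
    (- (A j i *+ n + n%:Z * (n%:Z - 1))%:~R) * iter n.-1 (comm_op (E i)) (E j) q v +
    (fun _ _ => 0) q v.
  by apply: op_ext => q v; rewrite IH addr0.
rewrite comm_op_combo // (_ : comm_op (E i) (fun _ _ => 0) p w = 0); last first.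
  by rewrite /comm_op oplin0 // subr0.
have -> : comm_op (fun q v => -1 * H i q v + (fun=> fun=> 0) q v) x p w =
    - comm_op (H i) x p w.
  by rewrite /comm_op lx (oplin0 lx); ring.
rewrite H_iter Aii -/x.
(* For n = 0 the predecessor is a default value, but the coefficient is 0. *)
have -> : (- (A j i *+ n + n%:Z * (n%:Z - 1))%:~R) *
   comm_op (E i) (iter n.-1 (comm_op (E i)) (E j)) p w =
   (- (A j i *+ n + n%:Z * (n%:Z - 1))%:~R) * x p w.
  by case: (n) @x {J lx} => [|m] /=; rewrite ?mul0r ?mulr0n ?addr0 ?oppr0 ?mul0r.
rewrite addr0 -mulNr -mulrDl; congr (_ * _); rewrite -opprD; congr (- _).
rewrite -rmorphD; congr (_%:~R).
by rewrite !int_mulrn intS; ring.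
Qed.

(** F_k commutes with E_i, so only [F_k, E_j] matters: it is 0 or - H_j, one bracket with E_i makes
    it a multiple of E_i, and a second one kills it. *)
Lemma F_iter_eq n i j k p w : i != j -> k != i -> (1 < n)%N ->
  comm_op (F k) (iter n (comm_op (E i)) (E j)) p w = 0.
Proof.
move=> ij ki; elim: n p w => // n IH p w n1.
(* The induction hypothesis covers exponents above 1 only, so the values at 0 and 1 are written
   out. *)
have z : comm_op (F k) (iter n (comm_op (E i)) (E j)) =
         (fun q v => if n is 0 then comm_op (F k) (E j) q v else
          if n is 1 then comm_op (E i) (comm_op (F k) (E j)) q v else 0).
  apply: op_ext => q v; case: n n1 IH => [|[|n]] // _ IH; last exact: IH.
  have J := comm_op_jacobi (lF k) (lE i) (lE j) q v.
  rewrite [LHS](_ : _ = comm_op (comm_op (F k) (E i)) (E j) q v +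
            comm_op (E i) (comm_op (F k) (E j)) q v); last by rewrite J subrK.
  have -> : comm_op (F k) (E i) = fun _ _ => 0.
    by apply: op_ext => ? ?; rewrite FE (negPf ki).
  by rewrite {1}/comm_op (oplin0 (lE j)) subrr add0r.
set x := iter n (comm_op (E i)) (E j) in z *.
have lx : oplin x := oplin_iter n i j.
have J := comm_op_jacobi (lF k) (lE i) lx p w.
have -> : comm_op (F k) (iter n.+1 (comm_op (E i)) (E j)) p w =
    comm_op (comm_op (F k) (E i)) x p w + comm_op (E i) (comm_op (F k) x) p w.
  by rewrite J subrK.
have -> : comm_op (F k) (E i) = fun _ _ => 0.
  by apply: op_ext => ? ?; rewrite FE (negPf ki).
rewrite {1}/comm_op (oplin0 lx) subrr add0r z.
case: n n1 {IH z x lx J} => [|[|n]] // _; last first.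
  by rewrite /comm_op oplin0 // subr0.
have -> : comm_op (F k) (E j) = fun q v => (-1) * (if k == j then H j q v else 0) + (fun _ _ => 0) q v.
  by apply: op_ext => q v; rewrite FE addr0 mulN1r; case: eqP => [->|_]; rewrite ?oppr0.
have z0 : comm_op (E i) (fun _ _ => 0) = fun _ _ => 0.
  by apply: op_ext => ? ?; rewrite /comm_op oplin0 // subr0.
rewrite comm_op_combo // z0.
set X := comm_op (E i) (fun _ _ => if _ then _ else _).
rewrite (comm_op_combo (-1) X (fun _ _ => 0) (lE i)) z0 /X {X}.
case: eqP => _; last by rewrite !z0; ring.
have -> : comm_op (E i) (fun q v => H j q v) = fun q v => - (A i j)%:~R * E i q v + (fun _ _ => 0) q v.
  by apply: op_ext => q v; rewrite addr0 mulNr -HE /comm_op opprB.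
rewrite (comm_op_combo _ (E i) (fun _ _ => 0) (lE i)) z0.
have -> : comm_op (E i) (E i) = fun _ _ => 0 by apply: op_ext => ? ?; rewrite /comm_op subrr.
by ring.
Qed.

Lemma serre_size i j : i != j -> (1 < `|1 - A j i|%N)%N /\ A j i = 1 - (`|1 - A j i|%N)%:Z.
Proof.
by move=> ij; have := @Aij j i; rewrite eq_sym ij => /(_ isT); lia.
Qed.

Lemma F_serre i j k p w : i != j -> comm_op (F k) (serre_op i j) p w = 0.
Proof.
move=> ij; have [n1 nA] := serre_size ij; rewrite /serre_op.
case: (eqVneq k i) => [->|ki]; last exact: F_iter_eq.
set n := `|1 - A j i|%N in nA *; rewrite F_iter_neq // nA [X in - X%:~R](_ : _ = 0) ?oppr0 ?mul0r //.
by rewrite int_mulrn; ring.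
Qed.

Lemma serre_ideal_H k T : serre_ideal T -> serre_ideal (comm_op (H k) T).
Proof.
elim=> [i j ij|i S JS JHS||c S S' _ JS _ JS'].
- rewrite (_ : comm_op _ _ = fun p w => (A j k + A i k *+ `|1 - A j i|%N)%:~R * serre_op i j p w
     + (fun _ _ => 0) p w); last by apply: op_ext => p w; rewrite H_iter addr0.
  by apply: serre_ideal_combo; [exact: serre_ideal_serre|exact: serre_ideal0].
- rewrite (_ : comm_op _ _ = fun p w => (A i k)%:~R * comm_op (E i) S p w +
      comm_op (E i) (comm_op (H k) S) p w).
    by apply: serre_ideal_combo; exact: serre_ideal_ad.
  have lS := oplin_serre_ideal JS.
  apply: op_ext => p w; have J := comm_op_jacobi (lH k) (lE i) lS p w.
  rewrite [LHS](_ : _ = comm_op (comm_op (H k) (E i)) S p w +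
            comm_op (E i) (comm_op (H k) S) p w); last by rewrite J subrK.
  congr (_ + _); have -> : comm_op (H k) (E i) = fun q v => (A i k)%:~R * E i q v + (fun _ _ => 0) q v.
    by apply: op_ext => q v; rewrite HE addr0.
  by rewrite /comm_op lS (oplin0 lS); ring.
- rewrite (_ : comm_op _ _ = fun _ _ => 0); first exact: serre_ideal0.
  by apply: op_ext => p w; rewrite /comm_op oplin0 // subr0.
- by rewrite comm_op_combo //; exact: serre_ideal_combo.
Qed.

Lemma serre_ideal_F k T : serre_ideal T -> serre_ideal (comm_op (F k) T).
Proof.
elim=> [i j ij|i S JS JFS||c S S' _ JS _ JS'].
- rewrite (_ : comm_op _ _ = fun _ _ => 0); first exact: serre_ideal0.
  by apply: op_ext => p w; exact: F_serre.
- have lS := oplin_serre_ideal JS.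
  rewrite (_ : comm_op _ _ = fun p w => (if k == i then -1 else 0) * comm_op (H k) S p w +
      comm_op (E i) (comm_op (F k) S) p w).
    by apply: serre_ideal_combo; [exact: serre_ideal_H|exact: serre_ideal_ad].
  apply: op_ext => p w; have J := comm_op_jacobi (lF k) (lE i) lS p w.
  rewrite [LHS](_ : _ = comm_op (comm_op (F k) (E i)) S p w +
            comm_op (E i) (comm_op (F k) S) p w); last by rewrite J subrK.
  congr (_ + _); have -> : comm_op (F k) (E i) = fun q v =>
     (if k == i then -1 else 0) * H k q v + (fun _ _ => 0) q v.
    by apply: op_ext => q v; rewrite FE addr0; case: eqP; rewrite ?mulN1r ?mul0r.
  by rewrite /comm_op lS (oplin0 lS); ring.
- rewrite (_ : comm_op _ _ = fun _ _ => 0); first exact: serre_ideal0.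
  by apply: op_ext => p w; rewrite /comm_op oplin0 // subr0.
- by rewrite comm_op_combo //; exact: serre_ideal_combo.
Qed.

(** Stated for an abstract filtration [deg], since it serves twice: for operators shortening the
    support and for operators lengthening it. Serre elements have at least three factors E, which is
    more than the bound 2. *)
Lemma serre_ideal_degree (deg : nat -> Op -> Prop) :
  (forall i, deg 1 (E i)) ->
  (forall m n T, (m <= n)%N -> deg n T -> deg m T) ->
  (forall m n T S, oplin T -> oplin S -> deg m T -> deg n S -> deg (m + n)%N (comm_op T S)) ->
  (forall n, deg n (fun _ _ => 0)) ->
  (forall n c T S, deg n T -> deg n S -> deg n (fun p w => c * T p w + S p w)) ->
  forall T, serre_ideal T -> deg 2 T.
Proof.
move=> dE dle dC d0 dZ T; elim=> [i j ij|i S JS dS||c S S' _ dS _ dS'] //; last exact: dZ.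
- have [n1 _] := serre_size ij; rewrite /serre_op.
  have dn n : deg n.+1 (iter n (comm_op (E i)) (E j)).
    by elim: n => //= n IH; apply: (dC 1%N n.+1) => //; exact: oplin_iter.
  by apply: dle (dn _); rewrite ltnS ltnW.
- by apply: dle (dC _ _ _ _ _ _ (dE i) dS) => //; exact: oplin_serre_ideal.
Qed.
End SerreIdeal.
End Operators.

(* The dual of a Verma module for the algebra without Serre relations: functions
   on words in f_1, f_2, where [lower] is the transpose of e_i and [shift] that of
   left multiplication by f_i. Transposition reverses brackets, so that [shift]
   stands for e_i and [lower] for f_i. The Serre elements then generate an ideal
   of operators which shift the length of words by at least 2. *)
Section Verma.
Variables (R : realType) (A : 'M[int]_2).
Local Notation C := R[i].
Local Notation V := (seq 'I_2 -> C).
Local Notation Op := (V -> V).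
Hypotheses (Aii : forall i, A i i = 2) (Aij : forall i j, i != j -> A i j < 0).
Implicit Types (T S : Op) (p q : V) (w : seq 'I_2).

(** The highest weight takes the value 1 on h_1 and h_2; any nonzero value would make e_i f_i act
    nontrivially on the highest weight vector. *)
Definition verma_wt i w : C := 1 - \sum_(k <- w) (A k i)%:~R.

Definition shift i : Op := fun p w => p (i :: w).
(** Transposes e_i f_k u = f_k e_i u + delta_ik h_i u, with e_i killing the empty word. *)
Fixpoint lower i p w : C :=
  if w is k :: w' then
    lower i (fun u => p (k :: u)) w' + (if i == k then verma_wt i w' * p w' else 0)
  else 0.
Definition diag i : Op := fun p w => verma_wt i w * p w.

Lemma verma_wt_cons i k w : verma_wt i (k :: w) = verma_wt i w - (A k i)%:~R.
Proof. by rewrite /verma_wt big_cons opprD addrA [_ - _ - _]addrAC. Qed.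

Lemma oplin_shift i : oplin (shift i).
Proof. by []. Qed.
Lemma oplin_diag i : oplin (diag i).
Proof. by move=> c p q w; rewrite /diag; ring. Qed.
Lemma oplin_lower i : oplin (lower i).
Proof.
move=> c p q w; elim: w p q => [|k w IH] p q /=; first by rewrite mulr0 addr0.
by rewrite IH; case: eqP => _; ring.
Qed.

Lemma verma_HE i j p w : comm_op (diag j) (shift i) p w = (A i j)%:~R * shift i p w.
Proof. by rewrite /comm_op /diag /shift verma_wt_cons; ring. Qed.

Lemma verma_FE i j p w : comm_op (lower i) (shift j) p w = if i == j then - diag i p w else 0.
Proof. by rewrite /comm_op /shift /= /diag; case: eqP => _; ring. Qed.

Lemma verma_EF i j p w : comm_op (shift i) (lower j) p w = if i == j then diag i p w else 0.
Proof.
rewrite (_ : _ p w = - comm_op (lower j) (shift i) p w); last by rewrite /comm_op; ring.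
by rewrite verma_FE eq_sym; case: eqP => [->|_]; rewrite ?opprK ?oppr0.
Qed.

Lemma verma_HF i j p w : comm_op (diag j) (lower i) p w = - (A i j)%:~R * lower i p w.
Proof.
rewrite /comm_op; elim: w p => [|k w IH] p; first by rewrite /diag /=; ring.
have : verma_wt j w * lower i (fun u => p (k :: u)) w -
       lower i (diag j (fun u => p (k :: u))) w = - (A i j)%:~R * lower i (fun u => p (k :: u)) w.
  exact: IH.
have -> : diag j (fun u => p (k :: u)) =
   fun u => (A k j)%:~R * p (k :: u) + diag j p (k :: u).
  by apply: funext => u; rewrite /diag verma_wt_cons; ring.
rewrite (oplin_lower i (A k j)%:~R (fun u => p (k :: u)) (fun u => diag j p (k :: u))) => E.
rewrite /= {1}/diag /= verma_wt_cons.
rewrite -[X in _ = _ * (X + _)](addrK 0) subr0 addr0.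
have -> : lower i (fun u => diag j p (k :: u)) w = verma_wt j w * lower i (fun u => p (k :: u)) w
   - (A k j)%:~R * lower i (fun u => p (k :: u)) w + (A i j)%:~R * lower i (fun u => p (k :: u)) w.
  by move/eqP: E; rewrite subr_eq => /eqP ->; ring.
by rewrite /diag; case: eqP => [->|_]; ring.
Qed.

Fixpoint verma_op (t : km_term C) : Op :=
  match t with
  | TGen (KE i) => shift i
  | TGen (KF i) => lower i
  | TGen (KH i) => diag i
  | TZero => fun _ _ => 0
  | TAdd x y => fun p w => verma_op x p w + verma_op y p w
  | TOpp x => fun p w => - verma_op x p w
  | TScale c x => fun p w => c * verma_op x p w
  | TLie x y => comm_op (verma_op x) (verma_op y)
  end.

Lemma oplin_verma t : oplin (verma_op t).
Proof.
elim: t => [[]|||||] /=; [exact: oplin_shift|exact: oplin_lower|exact: oplin_diag|..].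
- by move=> c p q w; rewrite mulr0 addr0.
- by move=> x lx y ly c p q w; rewrite lx ly; ring.
- by move=> x lx c p q w; rewrite lx; ring.
- by move=> d x lx c p q w; rewrite lx; ring.
- by move=> x lx y ly; exact: oplin_comm.
Qed.

(** Exchanging the roles of [shift] and [lower] changes the sign of H; with [ndiag] the results on
    the Serre ideal apply to [lower] as well. *)
Let ndiag i : Op := fun p w => - diag i p w.
Let oplin_ndiag i : oplin (ndiag i).
Proof. by move=> c p q w; rewrite /ndiag oplin_diag; ring. Qed.
Let ndiagE i T p w : oplin T -> comm_op (ndiag i) T p w = - comm_op (diag i) T p w.
Proof.
move=> lT; rewrite /comm_op /ndiag.
have -> : T (fun u => - diag i p u) w = - T (diag i p) w; last by ring.
have := lT (-1) (diag i p) (fun=> 0) w; rewrite (oplin0 lT) addr0 mulN1r => <-.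
by congr (T _ w); apply: funext => u; rewrite addr0 mulN1r.
Qed.
Let verma_HF' i j p w : comm_op (ndiag j) (lower i) p w = (A i j)%:~R * lower i p w.
Proof. by rewrite (ndiagE _ _ _ (oplin_lower i)) verma_HF mulNr opprK. Qed.
Let verma_EF' i j p w : comm_op (shift i) (lower j) p w = if i == j then - ndiag i p w else 0.
Proof. by rewrite verma_EF /ndiag; case: eqP; rewrite ?opprK. Qed.

Let Jplus := serre_ideal A shift.
Let Jminus := serre_ideal A lower.
(** The sum of the ideals generated by the Serre elements of either sign. *)
Definition verma_ideal T :=
  exists T1 T2, [/\ Jplus T1, Jminus T2 & forall p w, T p w = T1 p w + T2 p w].

Lemma verma_ideal_combo c T S : verma_ideal T -> verma_ideal S ->
  verma_ideal (fun p w => c * T p w + S p w).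
Proof.
case=> T1 [T2 [J1 J2 TE]] [S1 [S2 [K1 K2 SE]]].
exists (fun p w => c * T1 p w + S1 p w), (fun p w => c * T2 p w + S2 p w).
split; [exact: serre_ideal_combo|exact: serre_ideal_combo|].
by move=> p w; rewrite TE SE; ring.
Qed.

Lemma verma_ideal_ext T S : (forall p w, T p w = S p w) -> verma_ideal T -> verma_ideal S.
Proof. by move/op_ext => ->. Qed.

Lemma verma_ideal0 : verma_ideal (fun _ _ => 0).
Proof.
exists (fun _ _ => 0), (fun _ _ => 0).
by split; [exact: serre_ideal0|exact: serre_ideal0|move=> p w; rewrite addr0].
Qed.

Lemma verma_ideal_lin T : verma_ideal T -> oplin T.
Proof.
case=> T1 [T2 [J1 J2 TE]] c p q w; rewrite !TE.
rewrite (oplin_serre_ideal oplin_shift J1) (oplin_serre_ideal oplin_lower J2); ring.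
Qed.

Lemma verma_ideal_comm t T : verma_ideal T -> verma_ideal (comm_op (verma_op t) T).
Proof.
elim: t T => [k||x IHx y IHy|x IHx|c x IHx|x IHx y IHy] T JT; have lT := verma_ideal_lin JT.
- have [T1 [T2 [J1 J2 TE]]] := JT.
  have lg : oplin (verma_op (TGen k)) by exact: oplin_verma.
  have E p w : comm_op (verma_op (TGen k)) T p w = comm_op (verma_op (TGen k)) T1 p w
        + comm_op (verma_op (TGen k)) T2 p w.
    have -> : T = fun p w => 1 * T1 p w + T2 p w by apply: op_ext => ? ?; rewrite mul1r.
    by rewrite comm_op_combo // mul1r.
  exists (comm_op (verma_op (TGen k)) T1), (comm_op (verma_op (TGen k)) T2).
  split=> //; case: k {lg E} => k /=.
  + exact: serre_ideal_ad.
  + exact: (serre_ideal_F Aii Aij oplin_shift oplin_lower oplin_diag verma_HE verma_FE).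
  + exact: (serre_ideal_H oplin_shift oplin_diag verma_HE).
  + exact: (serre_ideal_F Aii Aij oplin_lower oplin_shift oplin_ndiag verma_HF' verma_EF').
  + exact: serre_ideal_ad.
  + rewrite (_ : comm_op _ _ = fun p w => -1 * comm_op (ndiag k) T2 p w + (fun _ _ => 0) p w).
      apply: serre_ideal_combo; last exact: serre_ideal0.
      exact: (serre_ideal_H oplin_lower oplin_ndiag verma_HF').
    apply: op_ext => p w; rewrite ndiagE ?addr0 ?mulN1r ?opprK //.
    exact: (oplin_serre_ideal oplin_lower J2).
- apply: verma_ideal_ext verma_ideal0 => p w.
  by rewrite /comm_op /= (oplin0 lT) subr0.
- apply: verma_ideal_ext (verma_ideal_combo 1 (IHx _ JT) (IHy _ JT)) => p w.
  rewrite /comm_op /= mul1r.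
  have := lT 1 (verma_op x p) (verma_op y p) w; rewrite mul1r.
  under eq_fun do rewrite mul1r.
  by move=> ->; ring.
- apply: verma_ideal_ext (verma_ideal_combo (-1) (IHx _ JT) verma_ideal0) => p w.
  rewrite /comm_op /= addr0.
  have := lT (-1) (verma_op x p) (fun=> 0) w; rewrite (oplin0 lT).
  under eq_fun do rewrite mulN1r addr0.
  by move=> ->; ring.
- apply: verma_ideal_ext (verma_ideal_combo c (IHx _ JT) verma_ideal0) => p w.
  rewrite /comm_op /= addr0.
  have := lT c (verma_op x p) (fun=> 0) w; rewrite (oplin0 lT).
  under eq_fun do rewrite addr0.
  by move=> ->; ring.
- apply: verma_ideal_ext (verma_ideal_combo (-1) (IHy _ (IHx _ JT)) (IHx _ (IHy _ JT))) => p w.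
  rewrite /= (comm_op_jacobi (oplin_verma x) (oplin_verma y) lT); ring.
Qed.

Lemma verma_op_iter n x y :
  verma_op (iter n (TLie x) y) = iter n (comm_op (verma_op x)) (verma_op y).
Proof. by elim: n => //= n ->. Qed.

(** The Serre relations need not hold for these operators, so congruent terms act equally only
    modulo the ideal; every other relation holds exactly. *)
Lemma verma_eq x y : km_eq A x y -> verma_ideal (fun p w => verma_op x p w - verma_op y p w).
Proof.
have eqz (T : Op) : (forall p w, T p w = 0) -> verma_ideal T.
  by move=> T0; apply: verma_ideal_ext verma_ideal0 => p w; rewrite T0.
have L := oplin_verma.
elim.
- by move=> u; apply: eqz => p w; rewrite subrr.
- move=> u v _ J; apply: verma_ideal_ext (verma_ideal_combo (-1) J verma_ideal0) => p w; ring.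
- move=> u v t _ J _ J'; apply: verma_ideal_ext (verma_ideal_combo 1 J J') => p w; ring.
- move=> u u' v v' _ J _ J'; apply: verma_ideal_ext (verma_ideal_combo 1 J J') => p w /=; ring.
- move=> u u' _ J; apply: verma_ideal_ext (verma_ideal_combo (-1) J verma_ideal0) => p w /=; ring.
- move=> c u u' _ J; apply: verma_ideal_ext (verma_ideal_combo c J verma_ideal0) => p w /=; ring.
- move=> u u' v v' _ J _ J'.
  apply: verma_ideal_ext (verma_ideal_combo (-1) (verma_ideal_comm v J)
    (verma_ideal_comm u' J')) => p w /=.
  by rewrite /comm_op !oplinB //; ring.
- by move=> *; apply: eqz => p w /=; ring.
- by move=> *; apply: eqz => p w /=; ring.
- by move=> *; apply: eqz => p w /=; ring.
- by move=> *; apply: eqz => p w /=; ring.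
- by move=> *; apply: eqz => p w /=; ring.
- by move=> *; apply: eqz => p w /=; ring.
- by move=> *; apply: eqz => p w /=; ring.
- by move=> *; apply: eqz => p w /=; ring.
- move=> u v t; apply: eqz => p w /=; rewrite /comm_op /=.
  have := L t 1 (verma_op u p) (verma_op v p) w; rewrite mul1r.
  under eq_fun do rewrite mul1r.
  by move=> ->; ring.
- move=> u v t; apply: eqz => p w /=; rewrite /comm_op /=.
  have := L u 1 (verma_op v p) (verma_op t p) w; rewrite mul1r.
  under eq_fun do rewrite mul1r.
  by move=> ->; ring.
- move=> c u v; apply: eqz => p w /=; rewrite /comm_op /=.
  have := L v c (verma_op u p) (fun=> 0) w; rewrite (oplin0 (L v)).
  under eq_fun do rewrite addr0.
  by move=> ->; ring.
- move=> c u v; apply: eqz => p w /=; rewrite /comm_op /=.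
  have := L u c (verma_op v p) (fun=> 0) w; rewrite (oplin0 (L u)).
  under eq_fun do rewrite addr0.
  by move=> ->; ring.
- by move=> u; apply: eqz => p w /=; rewrite /comm_op; ring.
- move=> u v t; apply: eqz => p w /=; rewrite /comm_op !oplinB //; ring.
- by move=> i j; apply: eqz => p w /=; rewrite /comm_op /diag; ring.
- by move=> i j; apply: eqz => p w /=; rewrite verma_HE subrr.
- by move=> i j; apply: eqz => p w /=; rewrite verma_HF subrr.
- by move=> i; apply: eqz => p w /=; rewrite verma_EF eqxx subrr.
- by move=> i j ij; apply: eqz => p w /=; rewrite verma_EF (negPf ij) subrr.
- move=> i j ij; rewrite verma_op_iter; exists (serre_op A shift i j), (fun _ _ => 0).
  split; [exact: serre_ideal_serre|exact: serre_ideal0|].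
  by move=> p w; rewrite subr0 addr0.
- move=> i j ij; rewrite verma_op_iter; exists (fun _ _ => 0), (serre_op A lower i j).
  split; [exact: serre_ideal0|exact: serre_ideal_serre|].
  by move=> p w; rewrite subr0 add0r.
Qed.

(** [lowers] bounds supports from above: length < d becomes length < d - m. [raises] bounds them
    from below: length >= d becomes length >= d + m. *)
Let lowers (m : nat) T := forall d p, (forall w, (d <= size w)%N -> p w = 0) ->
  forall w, (d <= size w + m)%N -> T p w = 0.
Let raises (m : nat) T := forall d p, (forall w, (size w < d)%N -> p w = 0) ->
  forall w, (size w < d + m)%N -> T p w = 0.

Let lowers2 T : Jplus T -> lowers 2 T.
Proof.
apply: (@serre_ideal_degree _ _ _ Aij oplin_shift lowers).
- by move=> i d p Hp w; rewrite addn1 => Hw; exact: Hp.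
- by move=> m n S mn HS d p Hp w Hw; apply: (HS d) => //; lia.
- move=> m n S S' _ _ HS HS' d p Hp w Hw; rewrite /comm_op.
  rewrite (HS (d - n)%N) ?(HS' (d - m)%N) ?subrr //; try lia.
    by move=> u Hu; apply: (HS d) => //; lia.
  by move=> u Hu; apply: (HS' d) => //; lia.
- by [].
- by move=> n c S S' HS HS' d p Hp w Hw; rewrite (HS d) // (HS' d) // mulr0 addr0.
Qed.

Let raises2 T : Jminus T -> raises 2 T.
Proof.
apply: (@serre_ideal_degree _ _ _ Aij oplin_lower raises).
- move=> i d p Hp w; elim: w d p Hp => [//|k w IH] d p Hp /= Hw.
  rewrite (IH d.-1) ?add0r; last 2 first.
  + by move=> u Hu; apply: Hp => /=; lia.
  + by lia.
  by case: eqP => // _; rewrite Hp ?mulr0 //; lia.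
- by move=> m n S mn HS d p Hp w Hw; apply: (HS d) => //; lia.
- move=> m n S S' _ _ HS HS' d p Hp w Hw; rewrite /comm_op.
  rewrite (HS (d + n)%N) ?(HS' (d + m)%N) ?subrr //; try lia.
    by move=> u Hu; apply: (HS d).
  by move=> u Hu; apply: (HS' d).
- by [].
- by move=> n c S S' HS HS' d p Hp w Hw; rewrite (HS d) // (HS' d) // mulr0 addr0.
Qed.

(** The indicator function of the word i, evaluated at the empty word, detects a change of length by
    exactly 1, which no operator of the ideal produces. *)
Lemma e_neq0 i : ke C A i != 0.
Proof.
apply/eqP => /km_piP/verma_eq[T1 [T2 [J1 J2]]].
move=> /(_ (fun w => (w == [:: i])%:R) [::]) /=; rewrite subr0 /shift eqxx.
rewrite (lowers2 J1 (d := 2)) ?(raises2 J2 (d := 1)) ?addr0 //.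
- by move/eqP; rewrite oner_eq0.
- by case.
- by case=> [|k [|l w]] //= _; rewrite eqseq_cons andbF.
Qed.

(** The same test in the other direction: the indicator of the empty word, evaluated at the word i,
    gives the highest weight value 1. *)
Lemma f_neq0 i : kf C A i != 0.
Proof.
apply/eqP => /km_piP/verma_eq[T1 [T2 [J1 J2]]].
move=> /(_ (fun w => (w == [::])%:R) [:: i]) /=; rewrite subr0 eqxx mulr1 /verma_wt big_nil.
rewrite (lowers2 J1 (d := 1)) ?(raises2 J2 (d := 0)) ?addr0 //; last by case.
by move/eqP; rewrite subr0 add0r oner_eq0.
Qed.
End Verma.

(** * Triangular decomposition *)

Lemma cartan_diag a b i : cartan a b i i = 2.
Proof. by rewrite mxE eqxx. Qed.

Lemma sign_sqr (K : pzRingType) (s : bool) : (-1) ^+ s * (-1) ^+ s = 1 :> K.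
Proof. by rewrite -expr2 sqrr_sign. Qed.

Lemma scale_sign (K : pzRingType) (V : lmodType K) (s : bool) (x : V) :
  (-1) ^+ s *: ((-1) ^+ s *: x) = x.
Proof. by rewrite scalerA sign_sqr scale1r. Qed.

Lemma signC (K : pzRingType) (s : bool) : (-1) ^+ (~~ s) = - (-1) ^+ s :> K.
Proof. by case: s; rewrite ?expr1 ?expr0 ?opprK. Qed.

Section Rank2.
Variables (R : realType) (a b : nat).
Hypotheses (ha : (0 < a)%N) (hb : (0 < b)%N) (hab : (4 < a * b)%N).
Local Notation C := R[i].
Local Notation A := (cartan a b).
Local Notation g := (kac_moody C A).
Implicit Types (x y z : g) (mu nu : lattice) (i j : 'I_2) (s : bool).

Lemma cartan_lt0 i j : i != j -> A i j < 0.
Proof.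
rewrite mxE => /negPf ->; case: ifP => _; rewrite oppr_lt0 ltz_nat //.
Qed.

Lemma cartan_prod i : A i (ihat i) * A (ihat i) i = (a * b)%:Z.
Proof.
have E : ihat i1 = i2 by exact: val_inj.
have -> : A i (ihat i) * A (ihat i) i = A i1 i2 * A i2 i1.
  by move: i; apply: (@ihat_ind _ i1); rewrite ?ihatK E // mulrC.
by rewrite !mxE /= mulrNN PoszM.
Qed.

Lemma pairing_inj mu : (forall j, pairing A mu j = 0) -> mu = 0.
Proof.
move=> H; have D i : mu 0 i = 0.
  have := H i; have := H (ihat i); rewrite /pairing !(sum_I2 _ i) cartan_diag.
  rewrite cartan_diag => E1 E2.
  (* Cramer's rule; 4 - ab is the determinant of A. *)
  have E3 : (4 - A i (ihat i) * A (ihat i) i) * mu 0 i = 0.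
    transitivity (2 * (mu 0 i * 2 + mu 0 (ihat i) * A (ihat i) i) -
      A (ihat i) i * (mu 0 i * A i (ihat i) + mu 0 (ihat i) * 2)); first by ring.
    by rewrite E1 E2; ring.
  move/eqP: E3; rewrite cartan_prod mulf_eq0 subr_eq0 => /orP[/eqP [E]|/eqP //].
  by move: hab; rewrite -E.
by apply/rowP => j; rewrite D mxE.
Qed.

(** One name for e_i and f_i lets each later statement treat both halves of the twin tree at once;
    [hs s i] is the bracket of [es s i] with [es (~~ s) i]. *)
Definition es s i : g := if s then kf C A i else ke C A i.
Definition hs s i : g := (-1) ^+ s *: kh C A i.
Definition sroot s i : lattice := (-1) ^+ s *: simple_root i.

Lemma es_neq0 s i : es s i != 0.
Proof.
by rewrite /es; case: s; [apply: f_neq0|apply: e_neq0]; move=> *;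
  rewrite ?cartan_diag ?cartan_lt0.
Qed.

Lemma sroot0 i : sroot false i = simple_root i.
Proof. by rewrite /sroot expr0 scale1r. Qed.

Lemma srootN s i : sroot (~~ s) i = - sroot s i.
Proof. by rewrite /sroot signC scaleNr. Qed.

Lemma sroot_coord s i j : sroot s i 0 j = (-1) ^+ s * (j == i)%:R.
Proof. by rewrite !mxE. Qed.

Lemma sroot_inj s s' i i' : sroot s i = sroot s' i' -> s = s' /\ i = i'.
Proof.
move=> E; have := congr1 (fun m : lattice => m 0 i) E; have := congr1 (fun m : lattice => m 0 i') E.
rewrite !sroot_coord !eqxx; case: (eqVneq i i') => [->|ii'].
  by case: s {E}; case: s'.
by case: s {E}; case: s'.
Qed.

Lemma root_space_es s i : root_space (sroot s i) (es s i).
Proof.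
rewrite /sroot /es; case: s; rewrite ?expr1 ?expr0 ?scaleN1r ?scale1r.
  exact: root_space_f.
exact: root_space_e.
Qed.

Lemma root_space_hs s i : root_space 0 (hs s i).
Proof. by apply: root_spaceZ; exact: root_space_h. Qed.

Lemma lie_h_es s i j : lie (kh C A j) (es s i) = ((-1) ^+ s * A i j)%:~R *: es s i.
Proof.
by have /root_spaceP -> := root_space_es s i; rewrite /sroot pairingZ pairing_simple.
Qed.

Lemma lie_es_h s i j : lie (es s i) (kh C A j) = - ((-1) ^+ s * A i j)%:~R *: es s i.
Proof. by rewrite lieC lie_h_es scaleNr. Qed.

Lemma lie_es s i : lie (es s i) (es (~~ s) i) = hs s i.
Proof.
rewrite /es /hs; case: s => /=; rewrite ?expr1 ?expr0 ?scale1r ?lie_ef //.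
by rewrite lieC lie_ef scaleN1r.
Qed.

Lemma lie_es0 s i j : i != j -> lie (es s i) (es (~~ s) j) = 0.
Proof.
rewrite /es; case: s => /= ij; last exact: lie_ef0.
by rewrite lieC lie_ef0 ?oppr0 // eq_sym.
Qed.

Lemma serre_es s i j : i != j -> iter `|1 - A j i|%N (lie (es s i)) (es s j) = 0.
Proof. by rewrite /es; case: s; [exact: serre_f|exact: serre_e]. Qed.

Lemma km_ind_es s (P : g -> Prop) :
  (forall i, P (es s i)) -> (forall i, P (es (~~ s) i)) -> (forall i, P (kh C A i)) ->
  P 0 -> (forall x y, P x -> P y -> P (x + y)) ->
  (forall c x, P x -> P (c *: x)) -> (forall x y, P x -> P y -> P (lie x y)) ->
  forall x, P x.
Proof. by case: s => P1 P2 *; exact: km_ind. Qed.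

(** By Leibniz the elements killed by a power of ad e_i form a Lie subalgebra. It contains the
    generators: e_j by Serre, and f_i, h_i, e_i through the string f, h, e. *)
Lemma ad_nilp_es s i : ad_nilp (es s i).
Proof.
have l := linear_lie (es s i).
apply: (@km_ind_es s).
- move=> j; case: (eqVneq i j) => [->|ij]; first by exists 1%N; exact: liexx.
  by exists `|1 - A j i|%N; exact: serre_es.
- move=> j; case: (eqVneq i j) => [->|ij]; last by exists 1%N; exact: lie_es0.
  exists 3; rewrite /= lie_es /hs lieZr lie_es_h.
  by rewrite !lieZr liexx !scaler0.
- move=> j; exists 2; rewrite /= lie_es_h.
  by rewrite lieZr liexx scaler0.
- by exists 0%N.
- move=> x y [N HN] [M HM]; exists (maxn N M); rewrite (linD (linear_iter _ l)).
  by rewrite (iter_ge0 l (leq_maxl N M) HN) (iter_ge0 l (leq_maxr N M) HM) addr0.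
- by move=> c x [N HN]; exists N; rewrite (linZ (linear_iter _ l)) HN scaler0.
- move=> x y [N HN] [M HM]; exists (N + M)%N.
  exact: iter_lie_nilp.
Qed.

Section Nilradical.
Variable s : bool.

(** The subalgebra n of sign s, as the span of right-nested brackets of the generators; [borel_part]
    adds the Cartan subalgebra. *)
Inductive nil_part : g -> Prop :=
| nil_part_es i : nil_part (es s i)
| nil_part_ad i x : nil_part x -> nil_part (lie (es s i) x)
| nil_part0 : nil_part 0
| nil_partD x y : nil_part x -> nil_part y -> nil_part (x + y)
| nil_partZ c x : nil_part x -> nil_part (c *: x).

Inductive borel_part : g -> Prop :=
| borel_part_h i : borel_part (kh C A i)
| borel_part_nil x : nil_part x -> borel_part x
| borel_part0 : borel_part 0
| borel_partD x y : borel_part x -> borel_part y -> borel_part (x + y)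
| borel_partZ c x : borel_part x -> borel_part (c *: x).

Lemma nil_part_h j x : nil_part x -> nil_part (lie (kh C A j) x).
Proof.
elim=> [i|i y Hy IH||y z _ Hy _ Hz|c y _ Hy].
- rewrite lie_h_es; exact/nil_partZ/nil_part_es.
- rewrite jacobi lie_h_es.
  by rewrite lieZl; apply: nil_partD; [apply: nil_partZ|]; apply: nil_part_ad.
- by rewrite lie0r; exact: nil_part0.
- by rewrite lieDr; exact: nil_partD.
- by rewrite lieZr; exact: nil_partZ.
Qed.

Lemma borel_part_es i x : borel_part x -> nil_part (lie (es s i) x).
Proof.
elim=> [j|y Hy||y z _ Hy _ Hz|c y _ Hy].
- by rewrite lie_es_h; apply: nil_partZ; exact: nil_part_es.
- exact: nil_part_ad.
- by rewrite lie0r; exact: nil_part0.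
- by rewrite lieDr; exact: nil_partD.
- by rewrite lieZr; exact: nil_partZ.
Qed.

Lemma nil_part_opp i x : nil_part x -> borel_part (lie (es (~~ s) i) x).
Proof.
elim=> [j|j y Hy IH||y z _ Hy _ Hz|c y _ Hy].
- case: (eqVneq i j) => [->|ij].
    rewrite lieC lie_es /hs -scaleN1r; do 2!apply: borel_partZ; exact: borel_part_h.
  by rewrite lieC lie_es0 1?eq_sym // oppr0; exact: borel_part0.
- rewrite jacobi; apply: borel_partD; last exact/borel_part_nil/borel_part_es.
  case: (eqVneq i j) => [->|ij].
    have -> : lie (es (~~ s) j) (es s j) = - hs s j by rewrite lieC lie_es.
    rewrite /hs lieNl lieZl -scaleN1r; do 2!apply: borel_partZ.
    exact/borel_part_nil/nil_part_h.
  have -> : lie (es (~~ s) i) (es s j) = 0 by rewrite lieC lie_es0 1?eq_sym // oppr0.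
  by rewrite lie0l; exact: borel_part0.
- by rewrite lie0r; exact: borel_part0.
- by rewrite lieDr; exact: borel_partD.
- by rewrite lieZr; exact: borel_partZ.
Qed.
End Nilradical.

(** The alternatives list what weight vectors can be. The third one fixes the line of x, and the
    fourth asks both coordinates to be nonzero of one sign, so multiples of a simple root other than
    0 and +-1 are excluded. The alternative x = 0 makes the condition linear in x. *)
Definition root_type mu x :=
  [\/ x = 0, mu = 0, exists s i (c : C), mu = sroot s i /\ x = c *: es s i |
   exists s, forall i, 1 <= (-1) ^+ s * mu 0 i].

Lemma root_typeD mu x y : root_type mu x -> root_type mu y -> root_type mu (x + y).
Proof.
case=> [->|mu0|[s [i [c [E ->]]]]|H]; last 1 first.
- by move=> _; constructor 4.
- by rewrite add0r.
- by move=> _; constructor 2.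
case=> [->|mu0|[s' [i' [c' [E' ->]]]]|H].
- by rewrite addr0; constructor 3; exists s, i, c.
- by constructor 2.
- move: E'; rewrite E => /sroot_inj[<- <-]; constructor 3; exists s, i, (c + c').
  by rewrite scalerDl.
- by constructor 4.
Qed.

Lemma root_typeZ mu (c : C) x : root_type mu x -> root_type mu (c *: x).
Proof.
case=> [->|mu0|[s [i [d [E ->]]]]|H].
- by rewrite scaler0; constructor 1.
- by constructor 2.
- by constructor 3; exists s, i, (c * d); rewrite scalerA.
- by constructor 4.
Qed.

(** Since [e_i, e_i] = 0, the first bracket that survives has both coordinates positive (up to the
    sign s), and further brackets keep them so. *)
Lemma nil_part_root_type s x : nil_part s x ->
  gspan (fun mu x => [\/ x = 0, exists i (c : C), mu = sroot s i /\ x = c *: es s i |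
   forall i, 1 <= (-1) ^+ s * mu 0 i]) x.
Proof.
elim=> [i|i y Hy IH||y z _ Hy _ Hz|c y _ Hy].
- apply: (gspanI (root_space_es s i)); constructor 2; exists i, 1; by rewrite scale1r.
- apply: (@gspan_lie _ _ (fun mu x => mu = sroot s i /\ x = es s i) _ _ _ _ _ _ IH); last first.
    by apply: (gspanI (root_space_es s i)).
  move=> mu nu u v _ _ [-> ->] [->|[j [c [-> ->]]]|H].
  + by constructor 1; rewrite lie0r.
  + case: (eqVneq i j) => [->|ij]; first by constructor 1; rewrite lieZr liexx scaler0.
    constructor 3 => k; rewrite mxE !sroot_coord -mulrDr mulrA sign_sqr mul1r.
    by move: ij; rewrite eq_sym neq_ihat => /eqP ->; case: (boolP (k == i)) => [_|];
      [rewrite lerDl ler0n|rewrite neq_ihat => ->].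
  + constructor 3 => k; rewrite mxE sroot_coord mulrDr mulrA sign_sqr mul1r.
    by rewrite (le_trans (H k)) // lerDr ler0n.
- exact: gspan0.
- exact: gspanD.
- apply: gspanZ => // mu d u [->|[j [e [-> ->]]]|H].
  + by constructor 1; rewrite scaler0.
  + by constructor 2; exists j, (d * e); rewrite scalerA.
  + by constructor 3.
Qed.

(** The sum of the two Borel subalgebras contains the generators and is stable under brackets with
    them, hence is all of g. *)
Lemma km_root_type x : gspan root_type x.
Proof.
pose P x := exists y z, [/\ borel_part false y, borel_part true z & x = y + z].
have PB s y : borel_part s y -> P y.
  by case: s => H; [exists 0, y|exists y, 0]; rewrite ?addr0 ?add0r; split=> //; exact: borel_part0.
have PD u v : P u -> P v -> P (u + v).
  case=> y [z [Hy Hz ->]] [y' [z' [Hy' Hz' ->]]]; exists (y + y'), (z + z').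
  by rewrite addrACA; split=> //; exact: borel_partD.
have PZ c u : P u -> P (c *: u).
  case=> y [z [Hy Hz ->]]; exists (c *: y), (c *: z).
  by rewrite scalerDr; split=> //; exact: borel_partZ.
have PL s s' i y : borel_part s' y -> P (lie (es s i) y).
  elim=> [j|u Hu||u v _ Hu _ Hv|c u _ Hu].
  - by rewrite lie_es_h; apply: PZ; apply: (PB s); exact/borel_part_nil/nil_part_es.
  - case: (eqVneq s s') => [ss|]; first by apply: (PB s); apply: borel_part_nil; rewrite ss; exact: nil_part_ad.
    move=> ss; have -> : s = ~~ s' by case: (s) ss; case: (s').
    exact: (PB s' _ (nil_part_opp i Hu)).
  - by rewrite lie0r; apply: (PB true); exact: borel_part0.
  - by rewrite lieDr; exact: PD.
  - by rewrite lieZr; exact: PZ.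
have Ph s j y : borel_part s y -> borel_part s (lie (kh C A j) y).
  elim=> [k|u Hu||u v _ Hu _ Hv|c u _ Hu].
  - by rewrite lie_hh; exact: borel_part0.
  - exact/borel_part_nil/nil_part_h.
  - by rewrite lie0r; exact: borel_part0.
  - by rewrite lieDr; exact: borel_partD.
  - by rewrite lieZr; exact: borel_partZ.
have Px : P x.
  apply: (@km_ideal _ _ P) => {x}.
  - by move=> i; apply: (PB false); exact/borel_part_nil/(nil_part_es false).
  - by move=> i; apply: (PB true); exact/borel_part_nil/(nil_part_es true).
  - by move=> i; apply: (PB false); exact/borel_part_h.
  - by apply: (PB false); exact: borel_part0.
  - exact: PD.
  - exact: PZ.
  - by move=> i x [y [z [Hy Hz ->]]]; rewrite lieDr; apply: PD; [exact: (PL false _ _ _ Hy)|exact: (PL false _ _ _ Hz)].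
  - by move=> i x [y [z [Hy Hz ->]]]; rewrite lieDr; apply: PD; [exact: (PL true _ _ _ Hy)|exact: (PL true _ _ _ Hz)].
  - move=> i x [y [z [Hy Hz ->]]]; rewrite lieDr; apply: PD;
      [exact: PB (Ph _ i _ Hy)|exact: PB (Ph _ i _ Hz)].
have B s y : borel_part s y -> gspan root_type y.
  elim=> [k|u Hu||u v _ Hu _ Hv|c u _ Hu].
  - by apply: (gspanI (root_space_h _ k)); constructor 2.
  - apply: gspan_sub (nil_part_root_type Hu) => mu v _ [->|[i [c [-> ->]]]|H].
    + by constructor 1.
    + by constructor 3; exists s, i, c.
    + by constructor 4; exists s.
  - exact: gspan0.
  - exact: gspanD.
  - by apply: gspanZ => // mu d v; exact: root_typeZ.
have [y [z [Hy Hz ->]]] := Px.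
by apply: gspanD; [exact: (B false)|exact: (B true)].
Qed.

Lemma root_spaceT mu x : root_space mu x -> root_type mu x.
Proof.
move=> Hx; apply: (gspan_weight pairing_inj _ _ (km_root_type x) Hx).
- by move=> nu; constructor 1.
- by move=> nu y z; exact: root_typeD.
Qed.

Lemma root_space_simple s i x : root_space (sroot s i) x -> exists c : C, x = c *: es s i.
Proof.
move=> /root_spaceT[->|E|[s' [i' [c [/sroot_inj[<- <-] ->]]]]|[s' H]].
- by exists 0; rewrite scale0r.
- have := congr1 (fun m : lattice => m 0 i) E; rewrite sroot_coord eqxx mulr1 mxE.
  by case: s {E}.
- by exists c.
- have := H (ihat i); rewrite sroot_coord (negPf (ihat_neq i)) mulr0.
  by rewrite mulr0.
Qed.

Lemma root_cases mu x : root_space mu x -> x != 0 ->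
  [\/ mu = 0, exists s i, mu = sroot s i | exists s, forall i, 1 <= (-1) ^+ s * mu 0 i].
Proof.
move=> /root_spaceT[->|E|[s [i [c [E _]]]]|H]; rewrite ?eqxx // => _.
- by constructor 1.
- by constructor 2; exists s, i.
- by constructor 3.
Qed.

(** * The torus *)

Section Lift.
Variables E F H : 'I_2 -> g.
Hypotheses (HHH : forall i j, lie (H i) (H j) = 0)
  (HHE : forall i j, lie (H j) (E i) = (A i j)%:~R *: E i)
  (HHF : forall i j, lie (H j) (F i) = - (A i j)%:~R *: F i)
  (HEF : forall i, lie (E i) (F i) = H i)
  (HEF0 : forall i j, i != j -> lie (E i) (F j) = 0)
  (HSE : forall i j, i != j -> iter `|1 - A j i|%N (lie (E i)) (E j) = 0)
  (HSF : forall i j, i != j -> iter `|1 - A j i|%N (lie (F i)) (F j) = 0).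

Fixpoint lift_term (t : km_term C) : g :=
  match t with
  | TGen (KE i) => E i
  | TGen (KF i) => F i
  | TGen (KH i) => H i
  | TZero => 0
  | TAdd x y => lift_term x + lift_term y
  | TOpp x => - lift_term x
  | TScale c x => c *: lift_term x
  | TLie x y => lie (lift_term x) (lift_term y)
  end.

Lemma lift_term_iter n t u :
  lift_term (iter n (TLie t) u) = iter n (lie (lift_term t)) (lift_term u).
Proof. by elim: n => //= n ->. Qed.

Lemma lift_termP t u : km_eq A t u -> lift_term t = lift_term u.
Proof.
elim=> {t u} //=.
- by move=> u v t _ -> _ ->.
- by move=> u u' v v' _ -> _ ->.
- by move=> u u' _ ->.
- by move=> c u u' _ ->.
- by move=> u u' v v' _ -> _ ->.
- by move=> u v t; rewrite addrA.
- by move=> u v; rewrite addrC.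
- by move=> u; rewrite add0r.
- by move=> u; rewrite addNr.
- by move=> c d u; rewrite scalerA.
- by move=> u; rewrite scale1r.
- by move=> c u v; rewrite scalerDr.
- by move=> c d u; rewrite scalerDl.
- by move=> u v t; rewrite lieDl.
- by move=> u v t; rewrite lieDr.
- by move=> c u v; rewrite lieZl.
- by move=> c u v; rewrite lieZr.
- by move=> u; rewrite liexx.
- move=> u v t; rewrite jacobi (lieC (lift_term t) (lie _ _)) (lieC (lift_term t)) lieNr.
  by rewrite [X in _ + X]addrC -opprD subrr.
- by move=> i j ij; rewrite lift_term_iter HSE.
- by move=> i j ij; rewrite lift_term_iter HSF.
Qed.

(** The universal property of the presentation, with g itself as target. *)
Lemma lift_exists : exists phi : g -> g,
  [/\ linear phi, forall x y, phi (lie x y) = lie (phi x) (phi y),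
      forall i, phi (ke C A i) = E i & forall i, phi (kf C A i) = F i].
Proof.
pose phi (x : g) := lift_term (repr x).
have phiE t : phi (\pi_g t) = lift_term t by apply: lift_termP; exact: km_reprK.
exists phi; split.
- move=> c; elim/km_quotW=> x; elim/km_quotW=> y.
  by rewrite -(cl_scale A c x) -cl_add !phiE.
- elim/km_quotW=> x; elim/km_quotW=> y.
  by rewrite -cl_lie !phiE.
- by move=> i; rewrite phiE.
- by move=> i; rewrite phiE.
Qed.
End Lift.

Lemma iter_lie_scale c d n x y :
  iter n (lie (c *: x)) (d *: y) = (c ^+ n * d) *: iter n (lie x) y :> g.
Proof.
elim: n => [|n IH]; first by rewrite mul1r.
by rewrite /= IH lieZl lieZr scalerA exprS mulrA.
Qed.

Lemma scaling_exists (chi : 'I_2 -> C) : (forall i, chi i != 0) ->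
  exists phi : g -> g,
  [/\ linear phi, forall x y, phi (lie x y) = lie (phi x) (phi y),
      forall i, phi (ke C A i) = chi i *: ke C A i &
      forall i, phi (kf C A i) = (chi i)^-1 *: kf C A i].
Proof.
move=> chi0; apply: (@lift_exists _ _ (kh C A)).
- exact: lie_hh.
- by move=> i j; rewrite lieZr lie_he !scalerA mulrC.
- by move=> i j; rewrite lieZr lie_hf !scalerA mulrC.
- by move=> i; rewrite lieZr lieZl lie_ef scalerA mulVf ?scale1r.
- by move=> i j ij; rewrite lieZr lieZl lie_ef0 ?scaler0.
- by move=> i j ij; rewrite iter_lie_scale serre_e ?scaler0.
- by move=> i j ij; rewrite iter_lie_scale serre_f ?scaler0.
Qed.

Lemma lie_endo_id (phi : g -> g) : linear phi ->
  (forall x y, phi (lie x y) = lie (phi x) (phi y)) ->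
  (forall i, phi (ke C A i) = ke C A i) -> (forall i, phi (kf C A i) = kf C A i) -> phi =1 id.
Proof.
move=> l1 h1 he hf; elim/km_ind => //.
- by move=> i; rewrite -lie_ef h1 he hf.
- by rewrite (lin0 l1).
- by move=> x y hx hy; rewrite (linD l1) hx hy.
- by move=> c x hx; rewrite (linZ l1) hx.
- by move=> x y hx hy; rewrite h1 hx hy.
Qed.

Lemma scaling_automorphism (chi : 'I_2 -> C) : (forall i, chi i != 0) ->
  exists phi : g -> g, [/\ lie_automorphism phi,
      forall i, phi (ke C A i) = chi i *: ke C A i &
      forall i, phi (kf C A i) = (chi i)^-1 *: kf C A i].
Proof.
move=> chi0; have [phi [l1 h1 e1 f1]] := scaling_exists chi0.
have chi0' i : (chi i)^-1 != 0 by rewrite invr_eq0.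
have [psi [l2 h2 e2 f2]] := scaling_exists chi0'.
have c0 i : chi i * (chi i)^-1 = 1 by rewrite mulfV.
exists phi; split=> //; split=> //; exists psi.
- apply: (@lie_endo_id (psi \o phi)) => /=; first exact: linear_comp.
  + by move=> x y; rewrite h1 h2.
  + by move=> i; rewrite e1 (linZ l2) e2 scalerA c0 scale1r.
  + by move=> i; rewrite f1 (linZ l2) f2 scalerA invrK mulrC c0 scale1r.
- apply: (@lie_endo_id (phi \o psi)) => /=; first exact: linear_comp.
  + by move=> x y; rewrite h2 h1.
  + by move=> i; rewrite e2 (linZ l1) e1 scalerA mulrC c0 scale1r.
  + by move=> i; rewrite f2 (linZ l1) f1 scalerA invrK c0 scale1r.
Qed.

Lemma weight_atD mu nu (c : 'rV[C]_2) :
  weight_at A (mu + nu) c = weight_at A mu c + weight_at A nu c.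
Proof.
rewrite /weight_at -big_split; apply: eq_bigr => i _ /=.
by rewrite pairingD rmorphD mulrDr.
Qed.

Lemma weight_at0 (c : 'rV[C]_2) : weight_at A 0 c = 0.
Proof. by rewrite /weight_at big1 // => i _; rewrite pairing0 mulr0. Qed.

Lemma weight_atN mu (c : 'rV[C]_2) : weight_at A (- mu) c = - weight_at A mu c.
Proof. by apply/eqP; rewrite -addr_eq0 -weight_atD addNr weight_at0. Qed.

Lemma weights_independent (l : seq lattice) (F : lattice -> g) mu : uniq l ->
  (forall nu, root_space nu (F nu)) -> \sum_(nu <- l) F nu = 0 -> mu \in l -> F mu = 0.
Proof.
move=> ul HF F0 ml; have Hl : mu \notin rem mu l by rewrite mem_rem_uniq // inE eqxx.
have [P [lP Pmu Pl _]] := weight_projector R pairing_inj Hl.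
have : P (\sum_(nu <- l) F nu) = 0 by rewrite F0 (lin0 lP).
rewrite (big_rem mu) //= (linD lP) (lin_sum lP) (Pmu _ (HF mu)) big_seq big1 ?addr0 //.
by move=> nu nl; exact: Pl nl _.
Qed.

Definition acts_by_weight (phi : g -> g) (c : 'rV[C]_2) :=
  forall mu x, root_space mu x -> phi x = expC (weight_at A mu c) *: x.

Lemma acts_by_weight_uniq phi psi c : linear phi -> linear psi ->
  acts_by_weight phi c -> acts_by_weight psi c -> phi = psi.
Proof.
move=> l1 l2 w1 w2; apply: funext => x.
elim: (km_graded x) => [|y z _ hy _ hz|mu y Hy _].
- by rewrite (lin0 l1) (lin0 l2).
- by rewrite (linD l1) (linD l2) hy hz.
- by rewrite (w1 _ _ Hy) (w2 _ _ Hy).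
Qed.

Lemma is_exp_acts_by_weight phi c : is_exp (lie (cartan_elt A c)) phi -> acts_by_weight phi c.
Proof.
case=> _ H mu x Hx; rewrite (H (weight_at A mu c) 1%N x) /=.
  by rewrite big_ord1 /= invr1 scale1r.
by rewrite Hx subrr.
Qed.

(** ad h is diagonalizable, so its generalized eigenvectors are eigenvectors and the finite sum in
    [is_exp] reduces to its first term. *)
Lemma acts_by_weight_is_exp phi c : linear phi -> acts_by_weight phi c ->
  is_exp (lie (cartan_elt A c)) phi.
Proof.
move=> lphi w; split=> // d N x; set D := fun y => _.
have lD : linear D by apply: linear_sub_scale; exact: linear_lie.
case: N => [/= ->|N DN]; first by rewrite big_ord0 scaler0 (lin0 lphi).
suff [Dx phix] : D x = 0 /\ phi x = expC d *: x.
  rewrite phix big_ord_recl /= invr1 scale1r big1 ?addr0 // => n _.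
  by rewrite -iterS iterSr Dx (iter_lin0 _ lD) scaler0.
have [//|//|l [F [ul Fl FP xE]]] := gspan_decomp _ _ (km_graded x).
have DF n mu : iter n D (F mu) = (weight_at A mu c - d) ^+ n *: F mu.
  elim: n => [|n IH]; first by rewrite expr0 scale1r.
  have [Hmu _] := FP mu.
  by rewrite iterS IH (linZ lD) /D Hmu -scalerBl scalerA exprSr.
(* D = ad h - d scales the component of weight mu, so a power of D can kill that component only if
   it is 0 or the scalar is. *)
have F0 mu : mu \in l -> F mu = 0 \/ weight_at A mu c = d.
  move=> ml; have : iter N.+1 D (F mu) = 0.
    apply: (@weights_independent l (fun mu => iter N.+1 D (F mu))) => //.
      by move=> nu; rewrite DF; apply: root_spaceZ; case: (FP nu).
    by rewrite -(lin_sum (linear_iter _ lD)) -xE.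
  rewrite DF => /eqP; rewrite scaler_eq0 expf_eq0 /= subr_eq0 => /orP[]/eqP; by [right|left].
have Dx0 : D x = 0.
  rewrite xE (lin_sum lD) big_seq big1 // => mu ml; rewrite -[D _]/(iter 1 D _) DF expr1.
  by case: (F0 _ ml) => ->; rewrite ?scaler0 // subrr scale0r.
split=> //; rewrite xE (lin_sum lphi) scaler_sumr [LHS]big_seq [RHS]big_seq.
apply: eq_bigr => mu ml; have [Hmu _] := FP mu; rewrite (w _ _ Hmu).
by case: (F0 _ ml) => ->; rewrite ?scaler0.
Qed.

(** Rescaling e_i by exp(alpha_i(h)) acts on every weight space by the exponential of the weight, as
    this is multiplicative under brackets. So an exponential of ad h exists, and weight vectors
    determine it. *)
Lemma torusP c : lie_automorphism (Exp_ad (cartan_elt A c : g)) /\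
  acts_by_weight (Exp_ad (cartan_elt A c)) c.
Proof.
pose chi i := expC (weight_at A (simple_root i) c).
have [|phi [aphi phie phif]] := @scaling_automorphism chi; first by move=> i; exact: expC_neq0.
have [lphi _ hphi] := aphi.
have wphi : acts_by_weight phi c.
  move=> mu x; apply: (@gspan_weight _ _ pairing_inj
    (fun mu x => phi x = expC (weight_at A mu c) *: x)).
  - by move=> nu; rewrite (lin0 lphi) scaler0.
  - by move=> nu y z hy hz; rewrite (linD lphi) hy hz scalerDr.
  elim/km_ind: x.
  - by move=> i; apply: (gspanI (root_space_e _ i)); rewrite phie.
  - move=> i; apply: (gspanI (root_space_f _ i)); rewrite phif weight_atN.
    congr (_ *: _); apply: (mulfI (expC_neq0 (weight_at A (simple_root i) c))).
    by rewrite mulfV ?expC_neq0 // -expCD subrr expC0.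
  - move=> i; apply: (gspanI (root_space_h _ i)); rewrite -lie_ef hphi phie phif.
    by rewrite lieZl lieZr scalerA mulfV ?expC_neq0 // scale1r weight_at0 expC0 scale1r.
  - exact: gspan0.
  - by move=> x y; exact: gspanD.
  - move=> d x; apply: gspanZ => nu e y; rewrite (linZ lphi) => ->.
    by rewrite !scalerA mulrC.
  - move=> x y Hx Hy; apply: gspan_lie Hx Hy => nu nu' u v _ _ hu hv.
    by rewrite hphi hu hv lieZl lieZr scalerA weight_atD expCD.
suff -> : Exp_ad (cartan_elt A c) = phi by [].
have H : is_exp (lie (cartan_elt A c)) (Exp_ad (cartan_elt A c)).
  rewrite /Exp_ad /Exp; apply: xgetPex; exists phi; exact: acts_by_weight_is_exp.
by apply: (@acts_by_weight_uniq _ _ c) => //; [case: H|exact: is_exp_acts_by_weight].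
Qed.

Lemma weight_at_surj (z : 'I_2 -> C) : exists c, forall i, weight_at A (simple_root i) c = z i.
Proof.
pose D : C := 4 - (a * b)%:R.
have D0 : D != 0.
  by rewrite /D subr_eq0 eqr_nat; apply: contraTneq hab => <-.
have [m Em] : exists m : 'I_2 -> C, forall i, (A i (ihat i))%:~R = m i by exists (fun i => (A i (ihat i))%:~R).
(* Cramer's rule again, with determinant D = 4 - ab. *)
exists (\row_i ((2 * z i - m i * z (ihat i)) / D)) => i.
have E : m i * m (ihat i) = (a * b)%:R.
  by rewrite -!Em -rmorphM ihatK cartan_prod.
rewrite /weight_at (sum_I2 _ i) !pairing_simple cartan_diag.
rewrite Em !mxE ihatK.
apply: (mulIf D0); rewrite /D -E in D0 *; field; exact: D0.
Qed.

(** The scalars on e_1, e_2 determine an element of T, and the scalar on f_i has to be the inverse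
    of that on e_i. *)
Lemma torus_char (phi : g -> g) : lie_automorphism phi ->
  (forall s i, root_space (sroot s i) (phi (es s i))) -> torus phi.
Proof.
move=> aphi H; have [lphi bphi hphi] := aphi.
have phi0 s i : phi (es s i) != 0.
  apply: contraNneq (es_neq0 s i) => phi0; apply/eqP/(bij_inj bphi).
  by rewrite phi0 (lin0 lphi).
have /all_sig[z Hz] i : {z | phi (ke C A i) = expC z *: ke C A i}.
  apply: cid; have [c E] := root_space_simple (H false i).
  have /expC_surj[z Ez] : c != 0.
    by apply: contraNneq (phi0 false i) => c0; rewrite E c0 scale0r.
  by exists z; rewrite Ez.
have [c Hc] := weight_at_surj z.
exists c => //; have [aT wT] := torusP c.
apply: lie_automorphism_eq => // i; first by rewrite (wT _ _ (root_space_e _ i)) Hc Hz.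
rewrite (wT _ _ (root_space_f _ i)) weight_atN Hc.
have [d E] := root_space_simple (H true i); rewrite /es in E; rewrite E; congr (_ *: _).
have hE : phi (kh C A i) = (expC (z i) * d) *: kh C A i.
  by rewrite -lie_ef hphi Hz E lieZl lieZr scalerA.
(* phi multiplies h_i by exp(z_i) d; applied to [h_i, e_i] = 2 e_i this forces exp(z_i) d = 1. *)
have : phi (lie (kh C A i) (ke C A i)) = lie (phi (kh C A i)) (phi (ke C A i)) by [].
rewrite lie_he (linZ lphi) hE Hz lieZl lieZr lie_he !scalerA => /eqP.
rewrite -subr_eq0 -scalerBl scaler_eq0 (negPf (es_neq0 false i)) orbF cartan_diag.
rewrite [X in X == 0](_ : _ = 2%:~R * expC (z i) * (1 - expC (z i) * d)); last by ring.
rewrite !mulf_eq0 intr_eq0 (negPf (expC_neq0 _)) /= subr_eq0 => /eqP E1.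
apply: (mulfI (expC_neq0 (z i))); rewrite -expCD subrr expC0.
by rewrite E1.
Qed.

(** * Lifts of Weyl group elements *)

Lemma Exp_ad_2 x y : ad_nilp x -> lie x (lie x y) = 0 -> Exp_ad x y = y + lie x y.
Proof.
move=> nx H; rewrite (@Exp_adE _ _ _ 2) // /exp_sum !big_ord_recl big_ord0 /=.
by rewrite !invr1 !scale1r addr0.
Qed.

Lemma Exp_ad_3 x y : ad_nilp x -> lie x (lie x (lie x y)) = 0 ->
  Exp_ad x y = y + lie x y + 2^-1 *: lie x (lie x y).
Proof.
move=> nx H; rewrite (@Exp_adE _ _ _ 3) // /exp_sum !big_ord_recl big_ord0 /=.
by rewrite !invr1 !scale1r addr0 addrA.
Qed.

Lemma hsN s i : hs (~~ s) i = - hs s i.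
Proof. by rewrite /hs signC scaleNr. Qed.

Lemma lie_hs_es s i : lie (hs s i) (es s i) = 2 *: es s i.
Proof.
rewrite /hs lieZl lie_h_es scalerA cartan_diag rmorphM rmorph_sign mulrA sign_sqr mul1r.
by [].
Qed.

Lemma lie_es_es s i : lie (es s i) (hs s i) = - 2 *: es s i.
Proof. by rewrite lieC lie_hs_es scaleNr. Qed.

(** * Computations in sl_2 *)

(** Coordinates on the span of X, e, f, h, in which exponentials of e and f act by explicit
    polynomials; X will be some h_j. *)
Definition comb s i (X : g) (x e f h : C) : g :=
  x *: X + e *: es s i + f *: es (~~ s) i + h *: hs s i.

Lemma combD s i X (x e f h x' e' f' h' : C) :
  comb s i X x e f h + comb s i X x' e' f' h' = comb s i X (x + x') (e + e') (f + f') (h + h').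
Proof. by rewrite /comb !scalerDl !(addrACA _ (_ *: hs _ _)) !(addrACA _ (_ *: es (~~ s) i)) (addrACA _ (_ *: es s i)). Qed.

Lemma combZ s i X (c x e f h : C) :
  c *: comb s i X x e f h = comb s i X (c * x) (c * e) (c * f) (c * h).
Proof. by rewrite /comb !scalerDr !scalerA. Qed.

Lemma combX s i X : comb s i X 1 0 0 0 = X.
Proof. by rewrite /comb !scale0r !addr0 scale1r. Qed.
Lemma combE s i X : comb s i X 0 1 0 0 = es s i.
Proof. by rewrite /comb !scale0r !addr0 add0r scale1r. Qed.
Lemma combF s i X : comb s i X 0 0 1 0 = es (~~ s) i.
Proof. by rewrite /comb !scale0r !addr0 !add0r scale1r. Qed.
Lemma combH s i X : comb s i X 0 0 0 1 = hs s i.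
Proof. by rewrite /comb !scale0r !add0r scale1r. Qed.

Section SL2.
Variables (s : bool) (i : 'I_2) (X : g) (al : C).
Hypotheses (XE : lie X (es s i) = al *: es s i).
Local Notation cb := (comb s i X).

Let nE t : ad_nilp (t *: es s i). Proof. exact/ad_nilpZ/ad_nilp_es. Qed.

Lemma Exp_es_opp (t : C) :
  Exp_ad (t *: es s i) (es (~~ s) i) = es (~~ s) i + t *: hs s i - t ^+ 2 *: es s i.
Proof.
have E2 : lie (t *: es s i) (lie (t *: es s i) (es (~~ s) i)) = (- 2 * t ^+ 2) *: es s i.
  rewrite (lieZl t (es s i) (es (~~ s) i)) lie_es lieZl (lieZr t) lie_es_es !scalerA.
  by congr (_ *: _); ring.
rewrite Exp_ad_3 //; last by rewrite E2 lieZl lieZr liexx !scaler0.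
rewrite E2 lieZl lie_es [2^-1 *: _]scalerA -scaleNr; congr (_ + _); congr (_ *: _).
by field.
Qed.

Lemma Exp_es_comb (t x e f h : C) : Exp_ad (t *: es s i) (cb x e f h) =
  cb x (e - t * al * x - 2 * t * h - t ^+ 2 * f) f (h + t * f).
Proof.
have [lE _ _] := Exp_ad_aut (nE t).
have lieEX : lie (t *: es s i) X = (- (t * al)) *: es s i.
  by rewrite lieC lieZr XE scalerA scaleNr.
have lieEH : lie (t *: es s i) (hs s i) = (- 2 * t) *: es s i.
  by rewrite lieZl lie_es_es scalerA mulrC.
have EX : Exp_ad (t *: es s i) X = cb 1 (- (t * al)) 0 0.
  rewrite Exp_ad_2 // lieEX; last by rewrite lieZl lieZr liexx !scaler0.
  by rewrite -{1}(combX s i X) -(combE s i X) combZ combD; congr (cb _ _ _ _); ring.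
have EE : Exp_ad (t *: es s i) (es s i) = cb 0 1 0 0.
  have lEE : lie (t *: es s i) (es s i) = 0 by rewrite lieZl liexx scaler0.
  by rewrite Exp_ad_2 // lEE ?lie0r // addr0 combE.
have EH : Exp_ad (t *: es s i) (hs s i) = cb 0 (- 2 * t) 0 1.
  rewrite Exp_ad_2 // lieEH; last by rewrite lieZl lieZr liexx !scaler0.
  by rewrite -{1}(combH s i X) -(combE s i X) combZ combD; congr (cb _ _ _ _); ring.
have EF : Exp_ad (t *: es s i) (es (~~ s) i) = cb 0 (- t ^+ 2) 1 t.
  rewrite Exp_es_opp -scaleNr -{1}(combF s i X) -{1}(combH s i X) -(combE s i X).
  by rewrite !combZ !combD; congr (cb _ _ _ _); ring.
rewrite {1}/comb !(linD lE) (linZ lE x) (linZ lE e) (linZ lE f) (linZ lE h) EX EE EF EH !combZ !combD.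
by congr (cb _ _ _ _); ring.
Qed.
End SL2.

Lemma comb_swap s i X (x e f h : C) : comb s i X x e f h = comb (~~ s) i X x f e (- h).
Proof.
by rewrite /comb negbK hsN scalerN scaleNr opprK; congr (_ + _); rewrite addrAC.
Qed.

Lemma Exp_esN_comb s i X (al t x e f h : C) :
  lie X (es (~~ s) i) = - al *: es (~~ s) i -> Exp_ad (t *: es (~~ s) i) (comb s i X x e f h) =
  comb s i X x e (f + t * al * x + 2 * t * h - t ^+ 2 * e) (h - t * e).
Proof.
move=> XF; rewrite comb_swap (@Exp_es_comb _ _ _ (- al)) //.
rewrite (comb_swap s); congr (comb _ _ _ _ _ _ _); ring.
Qed.

(** The classical representative exp(te) exp(-f/t) exp(te) of the reflection in SL_2. *)
Definition nmap s i (t : C) : g -> g :=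
  Exp_ad (t *: es s i) \o Exp_ad (- t^-1 *: es (~~ s) i) \o Exp_ad (t *: es s i).

Lemma nmap_h s i t j : t != 0 ->
  nmap s i t (kh C A j) = kh C A j - (A i j)%:~R *: kh C A i.
Proof.
move=> t0; set al : C := ((-1) ^+ s * A i j)%:~R.
have XE : lie (kh C A j) (es s i) = al *: es s i by rewrite lie_h_es.
have XF : lie (kh C A j) (es (~~ s) i) = - al *: es (~~ s) i.
  by rewrite lie_h_es signC mulNr rmorphN.
rewrite /nmap /= -{1}(combX s i (kh C A j)) (Exp_es_comb XE) (Exp_esN_comb _ _ _ _ _ XF).
rewrite (Exp_es_comb XE).
have -> : kh C A j - (A i j)%:~R *: kh C A i = comb s i (kh C A j) 1 0 0 (- al).
  rewrite -{1}(combX s i (kh C A j)) -[kh C A i](@scale_sign _ _ s).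
  rewrite -/(hs s i) scalerA -scaleNr -(combH s i (kh C A j)) combZ combD.
  by congr (comb _ _ _ _ _ _ _); rewrite ?mulr0 ?addr0 // add0r mulr1 /al rmorphM rmorph_sign mulrC.
by congr (comb _ _ _ _ _ _ _); field.
Qed.

Lemma kac_moody_group_es s i (t : C) : kac_moody_group (Exp_ad (t *: es s i)).
Proof. by apply: gen_in; exists i, t; case: s; [right|left]. Qed.

Lemma kac_moody_group_nmap s i t : kac_moody_group (nmap s i t).
Proof.
apply: gen_comp; last exact: kac_moody_group_es.
by apply: gen_comp; exact: kac_moody_group_es.
Qed.

Lemma kac_moody_group_aut phi : kac_moody_group phi -> lie_automorphism (phi : g -> g).
Proof.
elim=> [psi [i [t [->|->]]]||p q _ ap _ aq|p q _ ap pq qp].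
- by apply: Exp_ad_aut; apply: ad_nilpZ; exact: (ad_nilp_es false).
- by apply: Exp_ad_aut; apply: ad_nilpZ; exact: (ad_nilp_es true).
- exact: lie_automorphism_id.
- exact: lie_automorphism_comp.
- exact: lie_automorphism_inv ap pq qp.
Qed.

Lemma nmapK s i t : cancel (nmap s i t) (nmap s i (- t)).
Proof.
move=> x; rewrite /nmap /= invrN opprK.
have K u : cancel (Exp_ad (u *: es s i)) (Exp_ad (- u *: es s i)).
  by rewrite scaleNr; apply: Exp_adNK; exact/ad_nilpZ/ad_nilp_es.
have K' u : cancel (Exp_ad (- u *: es (~~ s) i)) (Exp_ad (u *: es (~~ s) i)).
  by rewrite scaleNr; apply: Exp_adKN; exact/ad_nilpZ/ad_nilp_es.
by rewrite !K K' K.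
Qed.

Lemma nmapNK s i t : cancel (nmap s i (- t)) (nmap s i t).
Proof. by have := nmapK s i (- t); rewrite opprK. Qed.

(** The action on h determines the action on weights: writing h_j as the image of its reflection
    moves the bracket back to x. *)
Lemma nmap_root_space s i t mu x : t != 0 -> root_space mu x ->
  root_space (simple_refl A i mu) (nmap s i t x).
Proof.
move=> t0 Hx; have [ln _ hn] := kac_moody_group_aut (kac_moody_group_nmap s i t).
apply/root_spaceP => j; have Nt0 : - t != 0 by rewrite oppr_eq0.
rewrite -{1}(nmapNK s i t (kh C A j)) -hn (nmap_h _ _ _ Nt0).
have /root_spaceP H := Hx.
rewrite lieDl lieNl lieZl !H scalerA -scalerBl (linZ ln); congr (_ *: _).
by rewrite /simple_refl pairingB pairingZ pairing_simple rmorphB rmorphM mulrC.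
Qed.

Lemma simple_refl_linear i : linear (simple_refl A i).
Proof.
move=> c mu nu; rewrite /simple_refl pairingD pairingZ scalerDl opprD addrACA.
by rewrite scalerBr scalerA.
Qed.

Lemma simple_reflK i : involutive (simple_refl A i).
Proof.
move=> mu; rewrite /simple_refl pairingB pairingZ pairing_simple cartan_diag.
by rewrite -addrA -opprD -scalerDl; rewrite [X in X *: _](_ : _ = 0) ?scale0r ?subr0 //; ring.
Qed.

Lemma simple_refl_sroot s i : simple_refl A i (sroot s i) = sroot (~~ s) i.
Proof.
rewrite srootN /simple_refl /sroot pairingZ pairing_simple cartan_diag -scalerBl -scaleNr.
by congr (_ *: _); ring.
Qed.

Definition weyl_elt (w : lattice -> lattice) := generated (range (simple_refl A)) w.

Lemma weyl_elt_simple i : weyl_elt (simple_refl A i).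
Proof. by apply: gen_in; exists i. Qed.

Lemma weyl_elt_linear w : weyl_elt w -> linear w.
Proof.
elim=> [p [i _ <-]||p q _ lp _ lq|p q _ lp pq qp].
- exact: simple_refl_linear.
- by [].
- exact: linear_comp.
- exact: linear_inv lp pq qp.
Qed.

Lemma weyl_elt_bij w : weyl_elt w -> bijective w.
Proof.
elim=> [p [i _ <-]||p q _ lp _ lq|p q _ lp pq qp].
- exact: (inv_bij (simple_reflK i)).
- by exists id.
- exact: bij_comp.
- by exists p.
Qed.

Definition permutes_root_spaces (w : lattice -> lattice) (phi : g -> g) :=
  forall mu, phi @` root_space mu = root_space (w mu).

Lemma permutes_in w phi mu x : permutes_root_spaces w phi -> root_space mu x ->
  root_space (w mu) (phi x).
Proof. by move=> H Hx; rewrite -H; exists x. Qed.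

Lemma permutes_comp w w' phi phi' : permutes_root_spaces w phi ->
  permutes_root_spaces w' phi' -> permutes_root_spaces (w \o w') (phi \o phi').
Proof. by move=> H H' mu; rewrite -image_comp H' H. Qed.

Lemma permutes_inv w w' phi phi' : permutes_root_spaces w phi ->
  cancel phi phi' -> cancel phi' phi -> cancel w' w -> permutes_root_spaces w' phi'.
Proof.
move=> H K K' Kw mu; apply/seteqP; split=> [_ [x Hx <-]|x Hx].
  have : root_space (w (w' mu)) x by rewrite Kw.
  by rewrite -H => -[y Hy <-]; rewrite K.
exists (phi x); last exact: K.
by rewrite -[mu]Kw; exact: permutes_in.
Qed.

Lemma torus_aut tau : torus tau -> lie_automorphism (tau : g -> g).
Proof. by case=> c _ <-; case: (torusP c). Qed.

Lemma torus_scalar tau mu : torus tau ->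
  exists2 c : C, c != 0 & forall x : g, root_space mu x -> tau x = c *: x.
Proof.
case=> c _ <-; exists (expC (weight_at A mu c)); first exact: expC_neq0.
by case: (torusP c) => _ w x; exact: w.
Qed.

(** With [torus_permutes] this identifies T with the automorphisms that map each root space onto
    itself. *)
Lemma torus_char_perm phi : lie_automorphism phi -> permutes_root_spaces id phi -> torus phi.
Proof.
move=> aphi H; apply: torus_char => // s i.
exact: (permutes_in H (root_space_es s i)).
Qed.

Lemma torus_permutes tau : torus tau -> permutes_root_spaces id tau.
Proof.
move=> Tt mu; have [c c0 H] := torus_scalar mu Tt.
apply/seteqP; split=> [_ [x Hx <-]|x Hx].
  by rewrite H //; exact: root_spaceZ.
by exists (c^-1 *: x); [exact: root_spaceZ|rewrite H ?scalerA ?mulfV ?scale1r //; exact: root_spaceZ].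
Qed.

Lemma torus_conj w phi tau : weyl_elt w -> lie_automorphism phi ->
  permutes_root_spaces w phi -> torus tau ->
  exists2 tau', torus tau' & phi \o tau = tau' \o phi.
Proof.
move=> Ww aphi H Tt; have [_ [psi K K'] _] := aphi.
have [w' Kw Kw'] := weyl_elt_bij Ww.
exists (phi \o tau \o psi); last by apply: funext => x /=; rewrite K.
apply: torus_char_perm.
  apply: lie_automorphism_comp (lie_automorphism_inv aphi K K').
  by apply: lie_automorphism_comp => //; exact: torus_aut.
have -> : (id : lattice -> lattice) = w \o id \o w' by apply: funext => m /=; rewrite Kw'.
apply: permutes_comp (permutes_inv H K K' Kw').
exact: permutes_comp H (torus_permutes Tt).
Qed.

Lemma weyl_elt_inv w w' : weyl_elt w -> cancel w w' -> cancel w' w -> weyl_elt w'.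
Proof. exact: gen_inv. Qed.

(** Conjugating by a map that permutes the root spaces preserves the property of fixing each of
    them, which characterizes T; so such a map normalizes T. *)
Lemma weyl_cosetI w phi : weyl_elt w -> kac_moody_group phi ->
  permutes_root_spaces w phi -> weyl_coset (R := R) (A := A) w phi.
Proof.
move=> Ww Gphi H; have aphi := kac_moody_group_aut Gphi.
have [_ [psi K K'] _] := aphi; have [w' Kw Kw'] := weyl_elt_bij Ww.
split=> //; split=> //; apply/seteqP; split=> [_ [tau Tt <-]|_ [tau Tt <-]].
  by have [tau' Tt' ->] := torus_conj Ww aphi H Tt; exists tau'.
have Ww' := weyl_elt_inv Ww Kw Kw'.
have apsi := lie_automorphism_inv aphi K K'.
have [tau' Tt' E] := torus_conj Ww' apsi (permutes_inv H K K' Kw') Tt.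
exists tau' => //; apply: funext => x /=.
by have := congr1 (fun f => phi (f (phi x))) E; rewrite /= K' K => ->.
Qed.

Lemma weyl_coset_group w phi : weyl_coset (R := R) (A := A) w phi -> kac_moody_group phi.
Proof. by case=> -[]. Qed.

Lemma weyl_coset_aut w phi : weyl_coset (R := R) (A := A) w phi -> lie_automorphism (phi : g -> g).
Proof. by move=> /weyl_coset_group/kac_moody_group_aut. Qed.

Lemma weyl_coset_perm w phi : weyl_coset (R := R) (A := A) w phi -> permutes_root_spaces w phi.
Proof. by case. Qed.

Lemma weyl_coset_comp w w' phi phi' : weyl_elt w -> weyl_elt w' -> weyl_coset (R := R) (A := A) w phi ->
  weyl_coset (R := R) (A := A) w' phi' -> weyl_coset (R := R) (A := A) (w \o w') (phi \o phi').
Proof.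
move=> W1 W2 [[G1 _] P1] [[G2 _] P2]; apply: weyl_cosetI.
- exact: gen_comp.
- exact: gen_comp.
- exact: permutes_comp.
Qed.

Lemma weyl_coset_inv w w' phi phi' : weyl_elt w -> cancel w w' -> cancel w' w ->
  weyl_coset (R := R) (A := A) w phi -> cancel phi phi' -> cancel phi' phi -> weyl_coset (R := R) (A := A) w' phi'.
Proof.
move=> W K1 K2 [[G _] P] K3 K4; apply: weyl_cosetI.
- exact: weyl_elt_inv W K1 K2.
- exact: gen_inv G K3 K4.
- exact: permutes_inv P K3 K4 K2.
Qed.

Lemma weyl_coset_nmap s i t : t != 0 -> weyl_coset (R := R) (A := A) (simple_refl A i) (nmap s i t).
Proof.
move=> t0; apply: weyl_cosetI; [exact: weyl_elt_simple|exact: kac_moody_group_nmap|].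
move=> mu; apply/seteqP; split=> [_ [x Hx <-]|x Hx]; first exact: nmap_root_space.
exists (nmap s i (- t) x); last exact: nmapNK.
by rewrite -[mu](simple_reflK i); apply: nmap_root_space => //; rewrite oppr_eq0.
Qed.

Lemma weyl_elt_lift w : weyl_elt w -> exists phi, weyl_coset (R := R) (A := A) w phi.
Proof.
elim=> [p [i _ <-]||p q Wp [phi Hphi] Wq [psi Hpsi]|p q Wp [phi Hphi] pq qp].
- by exists (nmap false i 1); apply: weyl_coset_nmap; exact: oner_neq0.
- exists id; apply: weyl_cosetI; [exact: gen_id|exact: gen_id|].
  by move=> mu; rewrite image_id.
- by exists (phi \o psi); exact: weyl_coset_comp.
- have [_ [psi K K'] _] := weyl_coset_aut Hphi; exists psi.
  exact: weyl_coset_inv Wp pq qp Hphi K K'.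
Qed.

Lemma weyl_coset_id phi : weyl_coset (R := R) (A := A) id phi -> torus (phi : g -> g).
Proof.
by move=> H; apply: torus_char_perm; [exact: weyl_coset_aut H|exact: weyl_coset_perm H].
Qed.

(** * Real roots *)

(* The positive real roots, listed in two sequences starting at the simple roots:
   s_i s_(ihat i) s_i ... applied to a simple root. *)
Fixpoint rho (j : nat) (i : 'I_2) : lattice :=
  if j is j'.+1 then simple_refl A i (rho j' (ihat i)) else simple_root i.

(** The coefficient in w_i(alpha_ihat) = alpha_ihat + mm_i alpha_i. *)
Definition mm i : int := - A (ihat i) i.

Lemma mm_gt0 i : 1 <= mm i.
Proof. by have := cartan_lt0 (ihat_neq i); rewrite /mm; lia. Qed.

Lemma mm_prod i : mm i * mm (ihat i) = (a * b)%:Z.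
Proof. by rewrite /mm ihatK mulrNN mulrC cartan_prod. Qed.

Lemma mm_prod_ge i : 5 <= mm i * mm (ihat i).
Proof. by rewrite mm_prod; move: hab; lia. Qed.

Lemma pairingE mu i : pairing A mu i = 2 * mu 0 i - mm i * mu 0 (ihat i).
Proof. by rewrite /pairing (sum_I2 _ i) cartan_diag /mm; ring. Qed.

Lemma simple_refl_coord i mu :
  simple_refl A i mu 0 i = mm i * mu 0 (ihat i) - mu 0 i.
Proof. by rewrite /simple_refl !mxE !eqxx mulr1 pairingE; ring. Qed.

Lemma simple_refl_coordN i mu : simple_refl A i mu 0 (ihat i) = mu 0 (ihat i).
Proof. by rewrite /simple_refl !mxE (negPf (ihat_neq i)) mulr0 subr0. Qed.

Lemma simple_root_coord i : simple_root i 0 i = 1.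
Proof. by rewrite mxE !eqxx. Qed.
Lemma simple_root_coordN i : simple_root i 0 (ihat i) = 0.
Proof. by rewrite mxE (negPf (ihat_neq i)) andbF. Qed.

Lemma rho_succN (j : nat) i : rho j.+1 i 0 (ihat i) = rho j (ihat i) 0 (ihat i).
Proof. by rewrite /= simple_refl_coordN. Qed.

Lemma rho_succ (j : nat) i : rho j.+1 i 0 i = mm i * rho j (ihat i) 0 (ihat i) - rho j (ihat i) 0 i.
Proof. by rewrite /= simple_refl_coord. Qed.

Lemma rho_succ2 (j : nat) i :
  rho j.+2 i 0 i = (mm i * mm (ihat i) - 1) * rho j i 0 i - mm i * rho j i 0 (ihat i) /\
  rho j.+2 i 0 (ihat i) = mm (ihat i) * rho j i 0 i - rho j i 0 (ihat i).
Proof.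
have E : rho j.+1 (ihat i) 0 (ihat i) = mm (ihat i) * rho j i 0 i - rho j i 0 (ihat i).
  by rewrite rho_succ !ihatK.
have E' : rho j.+1 (ihat i) 0 i = rho j i 0 i.
  by have := rho_succN j (ihat i); rewrite ihatK.
by rewrite rho_succN rho_succ E E'; split=> //; ring.
Qed.

(** The value at h_i of the j-th root of the sequence of i. Its positivity drives the growth of the
    roots, and later bounds the quadratic form from below. *)
Let dd (j : nat) i := pairing A (rho j i) i.

Lemma rho_facts (j : nat) i : [/\ 1 <= rho j i 0 i, 0 <= rho j i 0 (ihat i), 0 < dd j i & dd j i < dd j.+2 i].
Proof.
have S0 k : [/\ 1 <= rho 0 k 0 k, 0 <= rho 0 k 0 (ihat k), 0 < dd 0 k & dd 0 k < dd 2 k].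
  have [E1 E2] := rho_succ2 0 k; rewrite /= simple_root_coord simple_root_coordN in E1 E2 *.
  rewrite /dd !pairingE E1 E2 /= simple_root_coord simple_root_coordN.
  by have := mm_prod_ge k; split=> //; lia.
have S1 k : [/\ 1 <= rho 1 k 0 k, 0 <= rho 1 k 0 (ihat k), 0 < dd 1 k & dd 1 k < dd 3 k].
  have [E1 E2] := rho_succ2 1 k.
  have E3 : rho 1 k 0 k = mm k by rewrite rho_succ /= simple_root_coord -{3}(ihatK k) simple_root_coordN; ring.
  have E4 : rho 1 k 0 (ihat k) = 1 by rewrite rho_succN /= simple_root_coord.
  rewrite /dd !pairingE E1 E2 E3 E4.
  have := mm_prod_ge k; have := mm_gt0 k; move: (mm k) (mm (ihat k)) => m n Hm Hmn.
  by split=> //; nia.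
(* The recurrence within one sequence goes in steps of two, so two consecutive indices are carried
   along. *)
suff H : forall k, [/\ 1 <= rho j k 0 k, 0 <= rho j k 0 (ihat k), 0 < dd j k & dd j k < dd j.+2 k] /\
   [/\ 1 <= rho j.+1 k 0 k, 0 <= rho j.+1 k 0 (ihat k), 0 < dd j.+1 k & dd j.+1 k < dd j.+3 k].
  by case: (H i).
elim: j => [k|j IH k]; first by split; [exact: S0|exact: S1].
have [S S'] := IH k; split; first exact: S'.
have [_ [Pi _ _ _]] := IH (ihat k); have [P0 Q0 d0 d2] := S.
have [E1 E2] := rho_succ2 j k; have [E3 E4] := rho_succ2 j.+2 k.
have D2 : dd j.+2 k = (mm k * mm (ihat k) - 2) * rho j k 0 k - mm k * rho j k 0 (ihat k).
  by rewrite /dd pairingE E1 E2; ring.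
have D0 : dd j k = 2 * rho j k 0 k - mm k * rho j k 0 (ihat k) by rewrite /dd pairingE.
(* The characteristic equation of a product of the two reflections, of trace ab - 2 >= 3 and
   determinant 1. *)
have D4 : dd j.+4 k = (mm k * mm (ihat k) - 2) * dd j.+2 k - dd j k.
  by rewrite D2 D0 /dd pairingE E3 E4 E1 E2; ring.
split.
- have -> : rho j.+2 k 0 k = rho j k 0 k + dd j.+2 k by rewrite E1 D2; ring.
  by lia.
- by rewrite rho_succN; lia.
- by lia.
- rewrite D4; have := mm_prod_ge k; move: (mm k * _) (dd j k) (dd j.+2 k) d0 d2 => M d d'.
  by nia.
Qed.

Lemma rho_ge0 (j : nat) i k : 0 <= rho j i 0 k.
Proof. by have [? ? _ _] := rho_facts j i; move: k; apply: (@ihat_ind _ i) => //; lia. Qed.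

Lemma rho_neq0 (j : nat) i : rho j i != 0.
Proof.
have [H _ _ _] := rho_facts j i; apply: contraTneq H => ->.
by rewrite mxE.
Qed.

(** * The invariant quadratic form *)

(** The W-invariant form of the symmetrized matrix, scaled to be integral with value mm_ihat on
    alpha_i. The index only orders the coordinates, see [qform_sym]. *)
Definition qform i mu : int :=
  mm (ihat i) * mu 0 i ^+ 2 + mm i * mu 0 (ihat i) ^+ 2
  - mm i * mm (ihat i) * mu 0 i * mu 0 (ihat i).

Lemma qform_sym i mu : qform (ihat i) mu = qform i mu.
Proof. by rewrite /qform ihatK; ring. Qed.

Lemma qform_refl i k mu : qform i (simple_refl A k mu) = qform i mu.
Proof.
have Q nu : qform i nu = qform k nu.
  case: (eqVneq i k) => [->//|]; rewrite neq_ihat => /eqP ->; exact: qform_sym.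
by rewrite Q (Q mu) /qform simple_refl_coord simple_refl_coordN; ring.
Qed.

Lemma qform_simple i : qform i (simple_root i) = mm (ihat i).
Proof. by rewrite /qform simple_root_coord simple_root_coordN; ring. Qed.

Lemma qform_sign i (s : bool) mu : qform i ((-1) ^+ s *: mu) = qform i mu.
Proof. by rewrite /qform !mxE; case: s; rewrite ?expr1 ?expr0; ring. Qed.

Lemma qform_rho (j : nat) i : qform i (rho j i) = if odd j then mm i else mm (ihat i).
Proof.
elim: j i => [|j IH] i; first exact: qform_simple.
by rewrite [rho _ _]/= qform_refl -qform_sym IH ihatK /=; case: (odd j).
Qed.

Lemma simple_reflZ i c mu : simple_refl A i (c *: mu) = c *: simple_refl A i mu.
Proof. exact: linZ (simple_refl_linear i) c mu. Qed.

Lemma aut_neq0 phi x : lie_automorphism phi -> x != 0 -> phi x != 0.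
Proof.
case=> l1 b1 _; apply: contraNneq => phi0; apply/eqP/(bij_inj b1).
by rewrite phi0 (lin0 l1).
Qed.

(** By [root_cases] the coordinates of a root never have opposite signs, so a positive one decides
    the sign of the other. *)
Lemma root_coord_ge0 s mu x k : root_space ((-1) ^+ s *: mu) x -> x != 0 ->
  1 <= mu 0 (ihat k) -> 0 <= mu 0 k.
Proof.
move=> Hx x0 H1; case: (root_cases Hx x0) => [E|[r [l E]]|[r H]].
- have := congr1 (fun m : lattice => m 0 (ihat k)) E; rewrite !mxE => /eqP.
  by rewrite mulf_eq0 signr_eq0 /= => /eqP E'; rewrite E' in H1.
- have kl : l = ihat k.
    apply/eqP/negPn/negP => lk.
    have := congr1 (fun m : lattice => m 0 (ihat k)) E.
    rewrite sroot_coord mxE eq_sym (negPf lk) mulr0 => /eqP.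
    by rewrite mulf_eq0 signr_eq0 /= => /eqP E'; rewrite E' in H1.
  have := congr1 (fun m : lattice => m 0 k) E; rewrite sroot_coord mxE kl.
  by rewrite eq_sym (negPf (ihat_neq k)) mulr0 => /eqP; rewrite mulf_eq0 signr_eq0 /= => /eqP ->.
- have := H k; have := H (ihat k); rewrite !mxE !mulrA -!signr_addb.
  by case: (r (+) s) => /=; rewrite ?(expr1, expr0, mulN1r, mul1r); lia.
Qed.

(* Reflecting a root downwards until it becomes simple or antidominant. *)
Lemma qform_root s mu x i : root_space ((-1) ^+ s *: mu) x -> x != 0 ->
  (forall k, 0 <= mu 0 k) -> mu != 0 ->
  qform i mu <= 0 \/ exists k, qform i mu = mm k.
Proof.
have [n] := ubnP (absz (mu 0 i1 + mu 0 i2)); elim: n s mu x => // n IH s mu x Hn Hx x0 mu0 munz.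
have smu s' : (-1) ^+ s' *: ((-1) ^+ s' *: mu) = mu := scale_sign s' mu.
case: (root_cases Hx x0) => [E|[s' [k E]]|[s' H]].
- by move: munz; rewrite -(smu s) E scaler0 eqxx.
- right; exists (ihat k); rewrite -(smu s) E !qform_sign.
  case: (eqVneq i k) => [->|]; first exact: qform_simple.
  by rewrite neq_ihat => /eqP ->; rewrite qform_sym qform_simple.
have mu1 k : 1 <= mu 0 k.
  have := H k; have := mu0 k; rewrite mxE mulrA -signr_addb.
  by case: (s' (+) s) => /=; rewrite ?(expr1, expr0, mulN1r, mul1r); lia.
case: (boolP [exists k, 0 < pairing A mu k]) => [/existsP[k pk]|/existsPn pk]; last first.
  left; have p k : mm (ihat k) * mu 0 k * pairing A mu k <= 0.
    apply: mulr_ge0_le0; last by rewrite leNgt.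
    by apply: mulr_ge0 => //; have := mm_gt0 (ihat k); lia.
  have E : 2 * qform i mu = mm (ihat i) * mu 0 i * pairing A mu i +
      mm i * mu 0 (ihat i) * pairing A mu (ihat i).
    by rewrite /qform !pairingE ihatK; ring.
  by have := p i; have := p (ihat i); rewrite ihatK; move: E; lia.
have Hy : root_space ((-1) ^+ s *: simple_refl A k mu) (nmap false k 1 x).
  by rewrite -simple_reflZ; apply: nmap_root_space Hx; exact: oner_neq0.
have y0 := aut_neq0 (kac_moody_group_aut (kac_moody_group_nmap false k 1)) x0.
have ck := simple_refl_coordN k mu.
have ck' : simple_refl A k mu 0 k = mu 0 k - pairing A mu k by rewrite simple_refl_coord pairingE; ring.
have k0 : 0 <= simple_refl A k mu 0 k.
  by apply: (root_coord_ge0 Hy y0); rewrite ck.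
have S (nu : lattice) : nu 0 i1 + nu 0 i2 = nu 0 k + nu 0 (ihat k).
  rewrite -(sum_I2 (fun j => nu 0 j) k) (sum_I2 _ i1).
  by have -> : ihat i1 = i2 by exact: val_inj.
rewrite -(qform_refl i k).
apply: (IH s _ _ _ Hy y0).
- rewrite S ck; rewrite S in Hn; have := mu1 (ihat k); have := mu1 k.
  by move: k0; rewrite ck'; move: Hn pk; lia.
- by apply: (@ihat_ind _ k) => //; rewrite ck; have := mu1 (ihat k); lia.
- apply: contraTneq (mu1 (ihat k)) => E; move: ck; rewrite E mxE => <-.
  by [].
Qed.

(** The form on alpha_i + rho is q(alpha_i) + q(rho) + mm_ihat dd, which is positive and so must be
    the value of q at a simple root. The growth of dd leaves one candidate. *)
Lemma root_add_rho s i (j : nat) x : (0 < j)%N ->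
  root_space ((-1) ^+ s *: (simple_root i + rho j i)) x -> x != 0 ->
  j = 2%N /\ simple_root i + rho j i = rho 1 i.
Proof.
move=> j0 Hx x0; have [P1 Q0 d0 _] := rho_facts j i.
have nn k : 0 <= (simple_root i + rho j i) 0 k.
  by rewrite mxE addr_ge0 ?rho_ge0 // mxE /= ler0n.
have nz : simple_root i + rho j i != 0.
  apply/eqP => E; have := congr1 (fun m : lattice => m 0 i) E.
  by rewrite !mxE !eqxx /=; lia.
have Q := qform_root i Hx x0 nn nz.
have QE : qform i (simple_root i + rho j i) = mm (ihat i) + qform i (rho j i) + mm (ihat i) * dd j i.
  rewrite /qform /dd pairingE ![(simple_root i + _) _ _]mxE simple_root_coord simple_root_coordN; ring.
rewrite QE qform_rho in Q; have m1 := mm_gt0 i; have m1' := mm_gt0 (ihat i).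
have Qk : exists k, mm (ihat i) + (if odd j then mm i else mm (ihat i)) + mm (ihat i) * dd j i = mm k.
  by case: Q => // Q; exfalso; move: Q; case: (odd j); nia.
(* The left side exceeds mm_ihat, so only mm_i can be attained. *)
have {}Qk : mm (ihat i) + (if odd j then mm i else mm (ihat i)) + mm (ihat i) * dd j i = mm i.
  case: Qk => k; case: (eqVneq k i) => [->//|]; rewrite neq_ihat => /eqP ->.
  by case: (odd j); nia.
(* For odd j the term mm_i already occurs on the left beside positive terms. *)
have jev : ~~ odd j by case: (odd j) Qk => //; nia.
rewrite (negPf jev) in Qk.
have [E1 E2] := rho_succ2 0 i; rewrite [rho 0 i]/= simple_root_coord simple_root_coordN in E1 E2.
have D2 : dd 2 i = mm i * mm (ihat i) - 2 by rewrite /dd pairingE E1 E2; ring.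
(* For even j >= 4, dd j > dd 2 = ab - 2 makes the left side larger than mm_ihat ab >= mm_i. *)
have j2 : j = 2%N.
  case: j j0 {Hx P1 Q0 d0 nn nz Q QE} jev Qk => [|[|[|[|j]]]] //= _ jev Qk; exfalso.
  have dmono n : dd 2 i < dd n.*2.+4 i.
    elim: n => [|n IHn]; first by have [_ _ _] := rho_facts 2 i.
    by have [_ _ _] := rho_facts n.*2.+4 i; move: IHn; rewrite doubleS; exact: lt_trans.
  have := dmono j./2; rewrite -[j in dd j.+4 i]odd_double_half in Qk.
  rewrite !negbK in jev; rewrite (negPf jev) add0n in Qk; rewrite D2 => H.
  by move: Qk H m1 m1'; move: (dd _ _) (mm i) (mm (ihat i)) => d m m'; nia.
subst j; rewrite D2 in Qk; split=> //.
(* At j = 2 the equation reads mm_ihat^2 mm_i = mm_i. *)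
have m'1 : mm (ihat i) = 1.
  have /eqP : mm i * ((mm (ihat i) - 1) * (mm (ihat i) + 1)) = 0.
    rewrite [LHS](_ : _ = mm (ihat i) + mm (ihat i) +
      mm (ihat i) * (mm i * mm (ihat i) - 2) - mm i); last by ring.
    by rewrite Qk subrr.
  by rewrite !mulf_eq0 => /or3P[] /eqP; lia.
apply: (@lattice_eq _ _ i).
- rewrite mxE E1 simple_root_coord rho_succ /= simple_root_coord m'1.
  by have := simple_root_coordN (ihat i); rewrite ihatK => ->; ring.
- by rewrite mxE E2 simple_root_coordN rho_succN /= simple_root_coord m'1.
Qed.

(** * Real root groups *)

Definition srho s (j : nat) i : lattice := (-1) ^+ s *: rho j i.

Lemma weyl_eltZ w c mu : weyl_elt w -> w (c *: mu) = c *: w mu.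
Proof. by move=> W; exact: linZ (weyl_elt_linear W) c mu. Qed.

Lemma srho0 s i : srho s 0 i = sroot s i.
Proof. by []. Qed.

Lemma simple_refl_srho s (j : nat) i : simple_refl A i (srho s j.+1 i) = srho s j (ihat i).
Proof. by rewrite /srho simple_reflZ /= simple_reflK. Qed.

Lemma simple_refl_srhoN s (j : nat) i : simple_refl A i (srho s j (ihat i)) = srho s j.+1 i.
Proof. by rewrite /srho simple_reflZ. Qed.

Lemma srhoN s (j : nat) i : srho (~~ s) j i = - srho s j i.
Proof. by rewrite /srho signC scaleNr. Qed.

Lemma real_root_simple i : real_roots A (simple_root i).
Proof. by exists id; [exact: gen_id|exists i]. Qed.

Lemma real_root_weyl w mu : weyl_elt w -> real_roots A mu -> real_roots A (w mu).
Proof.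
move=> W [v V [i _ <-]]; exists (w \o v); first exact: gen_comp.
by exists i.
Qed.

Lemma real_rootN mu : real_roots A mu -> real_roots A (- mu).
Proof.
move=> [v V [i _ <-]]; exists (v \o simple_refl A i); first by apply: gen_comp => //; exact: weyl_elt_simple.
exists i => //=; rewrite -{1}[simple_root i]sroot0 simple_refl_sroot srootN sroot0.
exact: linN (weyl_elt_linear V) _.
Qed.

Lemma real_root_srho s (j : nat) i : real_roots A (srho s j i).
Proof.
have H k : real_roots A (rho j k).
  elim: j k => [|j IH] k /=; first exact: real_root_simple.
  by apply: real_root_weyl (IH _); exact: weyl_elt_simple.
by rewrite /srho; case: s; rewrite ?expr0 ?scale1r ?expr1 ?scaleN1r //; exact: real_rootN.
Qed.

Lemma real_root_sroot s i : real_roots A (sroot s i).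
Proof. exact: (real_root_srho s 0 i). Qed.

(** The set of the roots of both sequences and their negatives is stable under both simple
    reflections: w_i shifts the index, and sends alpha_i to its negative. *)
Lemma real_root_cases mu : real_roots A mu -> exists s (j : nat) i, mu = srho s j i.
Proof.
pose S mu := exists s (j : nat) i, mu = srho s j i.
have Srefl k nu : S nu -> S (simple_refl A k nu).
  case=> s [[|j] [i ->]].
    case: (eqVneq i k) => [->|]; first by exists (~~ s), 0%N, k; rewrite srho0 simple_refl_sroot.
    by rewrite neq_ihat => /eqP ->; exists s, 1%N, k; rewrite simple_refl_srhoN.
  case: (eqVneq i k) => [->|]; first by exists s, j, (ihat k); rewrite simple_refl_srho.
  by rewrite neq_ihat => /eqP ->; exists s, j.+2, k; rewrite simple_refl_srhoN.
(* An equivalence rather than an implication, so that it passes to inverses in [generated]. *)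
have SW w : weyl_elt w -> forall nu, S nu <-> S (w nu).
  elim=> [p [k _ <-]||p q _ Hp _ Hq|p q _ Hp pq qp] nu.
  - by split; [exact: Srefl|move=> /(Srefl k); rewrite simple_reflK].
  - by [].
  - by rewrite (Hq nu) (Hp (q nu)).
  - by rewrite (Hp (q nu)) qp.
case=> w W [i _ <-]; apply: (proj1 (SW _ W _)); exists false, 0%N, i.
by rewrite srho0 sroot0.
Qed.

Lemma signed_srho s (j : nat) i : signed_roots s (srho s j i).
Proof. by move=> k; rewrite mxE mulrA sign_sqr mul1r rho_ge0. Qed.

Lemma signed_srhoN s (j : nat) i : ~ signed_roots s (srho (~~ s) j i).
Proof.
move=> /(_ i); have [H _ _ _] := rho_facts j i.
have -> : (-1) ^+ s * srho (~~ s) j i 0 i = ((-1) ^+ s *: srho (~~ s) j i) 0 i by rewrite [RHS]mxE.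
by rewrite srhoN scalerN scale_sign mxE oppr_ge0 => /(le_trans H).
Qed.

Lemma real_signed_cases s mu : real_roots A mu -> signed_roots s mu ->
  exists (j : nat) i, mu = srho s j i.
Proof.
move=> /real_root_cases[s' [j [i ->]]] H; case: (eqVneq s' s) => [->|ss'].
  by exists j, i.
by case: (@signed_srhoN s j i); have -> : ~~ s = s' by case: (s) (s') ss' => [] [].
Qed.

Local Notation rv mu := (root_vector R A mu).

(** A lift of w carries the line of a simple root space to that of w(alpha_i); hence the choice in
    [root_vector] is not its default 0. *)
Lemma real_root_vector mu : real_roots A mu ->
  [/\ rv mu != 0, root_space mu = range (fun t : C => t *: rv mu) & ad_nilp (rv mu)].
Proof.
move=> [w W [i _ <-]]; set al := w _; have [phi Hphi] := weyl_elt_lift W.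
have aphi := weyl_coset_aut Hphi; have [lphi _ _] := aphi.
have pphi := weyl_coset_perm Hphi.
have E0 : root_space al = range (fun t : C => t *: phi (es false i)).
  rewrite -pphi -sroot0; apply/seteqP; split=> [_ [x Hx <-]|_ [t _ <-]].
    by have [c ->] := root_space_simple Hx; exists c => //; rewrite (linZ lphi).
  by exists (t *: es false i); [apply: root_spaceZ; exact: root_space_es|rewrite (linZ lphi)].
have E : root_space al = range (fun t : C => t *: rv al).
  by rewrite /root_vector; apply: (@xgetPex _ _ [set x : g | root_space al = range (fun t : C => t *: x)]);
  exists (phi (es false i)).
have : root_space al (phi (es false i)) by rewrite E0; exists 1 => //; rewrite scale1r.
have : root_space al (rv al) by rewrite E; exists 1 => //; rewrite scale1r.
rewrite {1}E0 => -[c _ Ec]; rewrite E => -[d _ Ed]; split=> //.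
  have := aut_neq0 aphi (es_neq0 false i); rewrite -Ed.
  by apply: contraNneq => ->; rewrite scaler0.
by rewrite -Ec -(linZ lphi); apply: ad_nilp_aut aphi _; exact/ad_nilpZ/ad_nilp_es.
Qed.

Lemma root_vector_in mu : real_roots A mu -> root_space mu (rv mu).
Proof. by move=> /real_root_vector[_ -> _]; exists 1 => //; rewrite scale1r. Qed.

Lemma root_space_line mu x : real_roots A mu -> root_space mu x -> exists c : C, x = c *: rv mu.
Proof. by move=> /real_root_vector[_ -> _] [c _ <-]; exists c. Qed.

Lemma ad_nilp_rv mu (t : C) : real_roots A mu -> ad_nilp (t *: rv mu).
Proof. by move=> /real_root_vector[_ _ ?]; exact: ad_nilpZ. Qed.

Lemma root_vector_sroot s i : exists2 c : C, c != 0 & es s i = c *: rv (sroot s i).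
Proof.
have [c E] := root_space_line (real_root_sroot s i) (root_space_es s i).
by exists c => //; apply: contraNneq (es_neq0 s i) => c0; rewrite E c0 scale0r.
Qed.

Lemma root_eltD mu (t u : C) : real_roots A mu ->
  root_elt mu (t + u) = root_elt mu t \o root_elt mu u :> (g -> g).
Proof. by move=> /real_root_vector[_ _ n]; exact: Exp_adD. Qed.

Lemma root_elt0 mu : root_elt mu 0 = id :> (g -> g).
Proof. by rewrite /root_elt scale0r Exp_ad0. Qed.

Lemma root_eltK mu (t : C) : real_roots A mu ->
  cancel (root_elt mu t : g -> g) (root_elt mu (- t)).
Proof.
by move=> r x; have := root_eltD (- t) t r; rewrite addNr root_elt0 => /(congr1 (fun f => f x)) /= <-.
Qed.

Lemma root_eltNK mu (t : C) : real_roots A mu ->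
  cancel (root_elt mu (- t) : g -> g) (root_elt mu t).
Proof. by move=> r; have := root_eltK (- t) r; rewrite opprK. Qed.

Lemma root_elt_aut mu (t : C) : real_roots A mu -> lie_automorphism (root_elt mu t : g -> g).
Proof. by move=> r; apply: Exp_ad_aut; exact: ad_nilp_rv. Qed.

Lemma root_group_simple s i u : root_group R A (sroot s i) u <-> exists t : C, u = Exp_ad (t *: es s i).
Proof.
have [c c0 E] := root_vector_sroot s i; rewrite E; split=> [[t _ <-]|[t ->]].
  by exists (t / c); rewrite scalerA divfK.
by exists (t * c) => //; rewrite /root_elt scalerA.
Qed.

Lemma root_elt_conj w phi mu : real_roots A mu -> real_roots A (w mu) ->
  lie_automorphism phi -> permutes_root_spaces w phi ->
  exists2 c : C, c != 0 & forall t, phi \o root_elt mu t = root_elt (w mu) (t * c) \o phi.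
Proof.
move=> r rw aphi pphi; have [lphi _ _] := aphi.
have [c E] := root_space_line rw (permutes_in pphi (root_vector_in r)).
have [v0 _ n] := real_root_vector r.
exists c.
  by apply: contraNneq (aut_neq0 aphi v0) => c0; rewrite E c0 scale0r.
by move=> t; rewrite /root_elt (Exp_ad_conj aphi (ad_nilpZ _ n)) (linZ lphi) E scalerA.
Qed.

Lemma root_group_conj w phi mu u : real_roots A mu -> real_roots A (w mu) ->
  lie_automorphism phi -> permutes_root_spaces w phi -> root_group R A mu u ->
  exists2 u', root_group R A (w mu) u' & phi \o u = u' \o phi.
Proof.
move=> r rw aphi pphi [t _ <-]; have [c _ H] := root_elt_conj r rw aphi pphi.
by exists (root_elt (w mu) (t * c)); [exists (t * c)|exact: H].
Qed.

Lemma root_group_aut mu u : real_roots A mu -> root_group R A mu u -> lie_automorphism u.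
Proof. by move=> r [t _ <-]; exact: root_elt_aut. Qed.

Lemma root_group_inv mu u : real_roots A mu -> root_group R A mu u ->
  exists v, [/\ root_group R A mu v, cancel u v & cancel v u].
Proof.
move=> r [t _ <-]; exists (root_elt mu (- t)).
by split; [exists (- t)|exact: root_eltK|exact: root_eltNK].
Qed.

Lemma root_group_in_group mu u : real_roots A mu -> root_group R A mu u -> kac_moody_group u.
Proof.
move=> r; have [w W [i _ E]] := r; have [phi Hphi] := weyl_elt_lift W.
have [w' K K'] := weyl_elt_bij W; have [_ [psi Kp Kp'] _] := weyl_coset_aut Hphi.
have Hpsi := weyl_coset_inv W K K' Hphi Kp Kp'.
have Ew : w' mu = sroot false i by rewrite -E K sroot0.
move=> /(root_group_conj (w := w') r _ (weyl_coset_aut Hpsi) (weyl_coset_perm Hpsi)).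
rewrite Ew => /(_ (real_root_sroot _ _))[_ /root_group_simple[t ->] Eu].
have -> : u = phi \o Exp_ad (t *: es false i) \o psi.
  rewrite -compA; apply: funext => x /=.
  by have := congr1 (fun f => phi (f x)) Eu; rewrite /= Kp' => ->.
apply: gen_comp (weyl_coset_group Hpsi); apply: gen_comp (weyl_coset_group Hphi) _.
exact: kac_moody_group_es.
Qed.

Definition roots_group (S : set lattice) : set (g -> g) :=
  generated (\bigcup_(mu in S) root_group R A mu).

Lemma roots_group_in (S : set lattice) mu u : S mu -> root_group R A mu u -> roots_group S u.
Proof. by move=> Smu Hu; apply: gen_in; exists mu. Qed.

Lemma roots_group_aut S u : S `<=` real_roots A -> roots_group S u -> lie_automorphism u.
Proof.
move=> SR; elim=> [p [mu Smu Hp]||p q _ ap _ aq|p q _ ap pq qp].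
- exact: root_group_aut (SR _ Smu) Hp.
- exact: lie_automorphism_id.
- exact: lie_automorphism_comp.
- exact: lie_automorphism_inv ap pq qp.
Qed.

Lemma roots_group_sub S T u : S `<=` T -> roots_group S u -> roots_group T u.
Proof.
move=> ST; elim=> [p [mu Smu Hp]||p q _ ap _ aq|p q _ ap pq qp].
- exact: roots_group_in (ST _ Smu) Hp.
- exact: gen_id.
- exact: gen_comp.
- exact: gen_inv ap pq qp.
Qed.

Lemma roots_group_conj S T w phi u : S `<=` real_roots A -> T `<=` real_roots A ->
  (forall mu, S mu -> T (w mu)) -> lie_automorphism phi -> permutes_root_spaces w phi ->
  roots_group S u -> exists2 u', roots_group T u' & phi \o u = u' \o phi.
Proof.
move=> SR TR ST aphi pphi; have [_ [psi K K'] _] := aphi.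
elim=> [p [mu Smu Hp]||p q _ [p' Hp Ep] _ [q' Hq Eq]|p q _ [p' Hp Ep] pq qp].
- have [u' Hu' E] := root_group_conj (SR _ Smu) (TR _ (ST _ Smu)) aphi pphi Hp.
  by exists u' => //; exact: roots_group_in (ST _ Smu) Hu'.
- by exists id => //; exact: gen_id.
- exists (p' \o q'); first exact: gen_comp.
  by rewrite -[LHS]/((phi \o p) \o q) Ep -[LHS]/(p' \o (phi \o q)) Eq.
- exists (phi \o q \o psi); last by apply: funext => x /=; rewrite K.
  have p'E : p' = phi \o p \o psi.
    by apply: funext => x; have := congr1 (fun f => f (psi x)) Ep; rewrite /= K' => <-.
  apply: (gen_inv Hp); rewrite p'E => x /=; first by rewrite K pq.
  by rewrite K qp.
Qed.

(* U_(alpha_i) conjugates the root groups on its side of the tree into each other: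
   brackets of the root vectors vanish or are again real root vectors. *)
Lemma commutator_rho s i (j : nat) u (x : g -> g) : root_group R A (sroot s i) u ->
  root_group R A (srho s j.+1 i) x ->
  exists2 y, roots_group [set mu | exists k : nat, mu = srho s k.+1 i] y & u \o x = y \o u.
Proof.
move=> /root_group_simple[t ->] [r _ <-]; set ga := srho s j.+1 i.
have rga : real_roots A ga := real_root_srho _ _ _.
have ne : ad_nilp (t *: es s i) by exact/ad_nilpZ/ad_nilp_es.
have ae := Exp_ad_aut ne; have [le _ _] := ae.
rewrite /root_elt (Exp_ad_conj ae (ad_nilp_rv r rga)) (linZ le).
(* alpha_k + rho 1 k is never a root, because [root_add_rho] allows only the index 2. *)
have zero k nu (v : g) : root_space nu v -> nu = (-1) ^+ s *: (simple_root k + rho 1 k) -> v = 0.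
  move=> Hv E; apply/eqP/negPn/negP => v0; rewrite E in Hv.
  by have [] := @root_add_rho s k 1 v isT Hv v0.
set z := lie (es s i) (rv ga).
have Hz : root_space ((-1) ^+ s *: (simple_root i + rho j.+1 i)) z.
  by rewrite scalerDr; exact: root_space_lie (root_space_es s i) (root_vector_in rga).
have [z0|z0] := eqVneq z 0.
  have E0 : lie (t *: es s i) (rv ga) = 0 by rewrite lieZl -/z z0 scaler0.
  exists (Exp_ad (r *: rv ga)); last by rewrite (ad_nilp_eq0 E0 ne).
  by apply: (roots_group_in (mu := ga)); [exists j|exists r].
have [/eqP j1 E] := root_add_rho (ltn0Sn j) Hz z0; rewrite eqSS in j1.
pose de := srho s 1 i; have rde : real_roots A de := real_root_srho _ _ _.
rewrite E -/(srho s 1 i) -/de in Hz.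
have [c Ez] := root_space_line rde Hz.
have Ez2 : lie (es s i) z = 0.
  apply: (zero i _ _ (root_space_lie (root_space_es s i) Hz)).
  by rewrite scalerDr.
have Eu : Exp_ad (t *: es s i) (rv ga) = rv ga + t *: z.
  by rewrite Exp_ad_2 // lieZl -/z // lieZl lieZr Ez2 !scaler0.
rewrite Eu scalerDr Ez !scalerA.
(* Here ga is rho 2 i and de is rho 1 i, up to sign; w_i maps their sum to alpha_ihat + rho 1 (ihat
   i), which [zero] excludes. *)
have Egd : lie (rv ga) (rv de) = 0.
  have H := root_space_lie (root_vector_in rga) (root_vector_in rde).
  have H' := nmap_root_space false i (oner_neq0 _) H.
  have H0 := zero (ihat i) _ _ H' _.
  apply/eqP/negPn/negP => n0.
  have /negP[] := aut_neq0 (kac_moody_group_aut (kac_moody_group_nmap false i 1)) n0.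
  apply/eqP/H0; rewrite (linD (simple_refl_linear i)) /ga /de (eqP j1) !simple_refl_srho.
  by rewrite srho0 /sroot /srho -scalerDr addrC.
rewrite Exp_ad_comm; [|exact: ad_nilp_rv|exact: ad_nilp_rv|by rewrite lieZl lieZr Egd !scaler0].
exists (Exp_ad (r *: rv ga) \o Exp_ad ((r * t * c) *: rv de)); last by rewrite mulrA.
apply: gen_comp.
  by apply: (roots_group_in (mu := ga)); [exists j|exists r].
by apply: (roots_group_in (mu := de)); [exists 0%N|exists (r * t * c)].
Qed.

(** * Borel subgroups and minimal parabolic subgroups *)

Definition posroots s : set lattice := real_roots A `&` signed_roots s.

Lemma posroots_srho s (j : nat) i : posroots s (srho s j i).
Proof. by split; [exact: real_root_srho|exact: signed_srho]. Qed.

Lemma posroots_real s : posroots s `<=` real_roots A.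
Proof. by move=> mu []. Qed.

Lemma borelP s (x : g -> g) : borel s x <->
  exists t u, [/\ torus t, roots_group (posroots s) u & x = t \o u].
Proof.
split=> [[t Tt [u Uu <-]]|[t [u [Tt Uu ->]]]]; first by exists t, u.
by exists t => //; exists u.
Qed.

Lemma torus_id : torus (id : g -> g).
Proof. by apply: torus_char_perm; [exact: lie_automorphism_id|move=> mu; rewrite image_id]. Qed.

Lemma torus_comp (t u : g -> g) : torus t -> torus u -> torus (t \o u).
Proof.
move=> Tt Tu; apply: torus_char_perm.
  by apply: lie_automorphism_comp; exact: torus_aut.
exact: permutes_comp (torus_permutes Tt) (torus_permutes Tu).
Qed.

Lemma torus_inv (t u : g -> g) : torus t -> cancel t u -> cancel u t -> torus u.
Proof.
move=> Tt K K'; apply: torus_char_perm.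
  exact: lie_automorphism_inv (torus_aut Tt) K K'.
exact: permutes_inv (torus_permutes Tt) K K' _.
Qed.

Lemma borel_torus s t : torus t -> borel s (t : g -> g).
Proof. by move=> Tt; apply/borelP; exists t, id; split=> //; exact: gen_id. Qed.

Lemma borel_roots s S u : S `<=` posroots s -> roots_group S u -> borel s u.
Proof.
move=> SP Uu; apply/borelP; exists id, u; split=> //; first exact: torus_id.
exact: roots_group_sub SP Uu.
Qed.

Lemma borel_root s mu u : posroots s mu -> root_group R A mu u -> borel s u.
Proof.
move=> Pmu Hu; apply: (@borel_roots s [set mu]); first by move=> _ ->.
exact: (@roots_group_in [set mu] mu).
Qed.

Lemma borel_id s : borel s (id : g -> g).
Proof. exact: borel_torus torus_id. Qed.

Lemma borel_aut s (x : g -> g) : borel s x -> lie_automorphism x.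
Proof.
case/borelP=> t [u [Tt Uu ->]]; apply: lie_automorphism_comp; first exact: torus_aut.
exact: roots_group_aut (@posroots_real s) Uu.
Qed.

Lemma borel_comp s (x y : g -> g) : borel s x -> borel s y -> borel s (x \o y).
Proof.
case/borelP=> t [u [Tt Uu ->]] /borelP[t' [u' [Tt' Uu' ->]]].
have [_ [t'' K K'] _] := torus_aut Tt'; have Tt'' := torus_inv Tt' K K'.
have [v Vv E] := roots_group_conj (w := id) (@posroots_real s) (@posroots_real s)
  (fun mu H => H) (torus_aut Tt'') (torus_permutes Tt'') Uu.
apply/borelP; exists (t \o t'), (v \o u'); split; [exact: torus_comp|exact: gen_comp|].
by apply: funext => z /=; have := comp_eq E (t' (u' z)); rewrite K => <-; rewrite K'.
Qed.

Lemma borel_inv s (x y : g -> g) : borel s x -> cancel x y -> cancel y x -> borel s y.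
Proof.
case/borelP=> t [u [Tt Uu ->]] K K'.
have [_ [t' L L'] _] := torus_aut Tt.
have [_ [u' M M'] _] := roots_group_aut (@posroots_real s) Uu.
have -> : y = u' \o t'.
  by apply: funext => z; rewrite -[in RHS](K' z) /= L M.
apply: borel_comp; last by apply: borel_torus; exact: torus_inv Tt L L'.
by apply: (@borel_roots _ (posroots s)) => //; exact: gen_inv Uu M M'.
Qed.

(** The stability that makes [wspan Q] invariant under B; only sums that are weights of g count. *)
Definition root_closed s (Q : set lattice) := forall mu be (x : g), Q mu -> posroots s be ->
  root_space (mu + be) x -> x != 0 -> Q (mu + be).

Lemma borel_wspan s Q (x : g -> g) v : root_closed s Q -> borel s x ->
  wspan Q v -> wspan Q (x v).
Proof.
move=> cQ.
have QL be y : posroots s be -> wspan Q y -> forall t : C, wspan Q (lie (t *: root_vector R A be) y).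
  move=> Pbe; elim=> [|y1 y2 _ H1 _ H2|mu y0 Hy Qmu] t.
  - by rewrite lie0r; exact: gspan0.
  - by rewrite lieDr; apply: gspanD; [exact: H1|exact: H2].
  - have Hl : root_space (mu + be) (lie (t *: root_vector R A be) y0).
      rewrite addrC; apply: root_space_lie Hy; apply: root_spaceZ.
      exact: root_vector_in (posroots_real Pbe).
    have [->|l0] := eqVneq (lie (t *: root_vector R A be) y0) 0; first exact: gspan0.
    apply: (gspanI Hl); exact: cQ Hl l0.
(* Stated as an equivalence in order to handle inverses of generators. *)
have QU u : roots_group (posroots s) u -> forall y, wspan Q y <-> wspan Q (u y).
  have QR be : posroots s be -> forall t y, wspan Q y -> wspan Q (root_elt be t y).
    move=> Pbe t y Hy; have n := ad_nilp_rv t (posroots_real Pbe).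
    have [N HN] := n y; rewrite /root_elt (Exp_adE n HN) /exp_sum.
    have Hit k : wspan Q (iter k (lie (t *: root_vector R A be)) y).
      by elim: k => //= k IH; exact: QL.
    elim/big_ind: _ => [|y1 y2|k _]; [exact: gspan0|exact: gspanD|].
    exact/wspanZ/Hit.
  elim=> [p [be Pbe [t _ <-]]||p q _ Hp _ Hq|p q _ Hp pq qp] y.
  - split; first exact: QR.
    by move=> /(QR _ Pbe (- t)); rewrite root_eltK //; exact: posroots_real Pbe.
  - by [].
  - by rewrite (Hq y) (Hp (q y)).
  - by rewrite (Hp (q y)) qp.
case/borelP=> t [u [Tt Uu ->]] /(QU _ Uu v).
rewrite /=; move: (u v) => y; elim=> {y} [|y1 y2 _ H1 _ H2|mu y Hy Qmu].
- by have [l _ _] := torus_aut Tt; rewrite (lin0 l); exact: gspan0.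
- by have [l _ _] := torus_aut Tt; rewrite (linD l); exact: gspanD.
- by have [c _ E] := torus_scalar mu Tt; rewrite E //; apply: wspanZ; exact: gspanI Hy Qmu.
Qed.

Lemma signed_rootsD s mu nu : signed_roots s mu -> signed_roots s nu -> signed_roots s (mu + nu).
Proof. by move=> H H' k; rewrite mxE mulrDr addr_ge0. Qed.

Lemma root_closed_signed s : root_closed s (signed_roots s).
Proof. by move=> mu be x H [_ H'] _ _; exact: signed_rootsD. Qed.

Definition parabolic_weights s i : set lattice :=
  signed_roots s `|` [set sroot (~~ s) i].

(** A positive real root other than alpha_i has a positive coordinate along the other simple root.
    Subtracting alpha_i leaves that coordinate unchanged, and the signs of a root agree. *)
Lemma root_closed_parabolic s i : root_closed s (parabolic_weights s i).
Proof.
move=> mu be x [H|->] [rbe Hbe] Hx x0; left; first exact: signed_rootsD.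
have [j [k E]] := real_signed_cases rbe Hbe.
have Ew : sroot (~~ s) i + be = (-1) ^+ s *: (rho j k - simple_root i).
  by rewrite E /srho srootN /sroot scalerBr addrC.
have c l : (-1) ^+ s * (sroot (~~ s) i + be) 0 l = (rho j k - simple_root i) 0 l.
  by rewrite Ew mxE mulrA sign_sqr mul1r.
move=> l; rewrite c; case: (eqVneq be (sroot s i)) => [Ebe|nbe].
  have -> : rho j k = simple_root i.
    by rewrite -[rho j k](scale_sign s) -/(srho s j k) -E Ebe /sroot scale_sign.
  by rewrite subrr mxE.
have d1 : 1 <= (rho j k - simple_root i) 0 (ihat i).
  have sub (m n : lattice) r : (m - n) 0 r = m 0 r - n 0 r by rewrite !mxE.
  rewrite sub simple_root_coordN subr0.
  case: (eqVneq k i) => [ki|]; last by rewrite neq_ihat => /eqP ->; case: (rho_facts j (ihat i)).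
  rewrite ki; case: j {c Ew} E => [|j] E; first by rewrite E ki srho0 eqxx in nbe.
  by rewrite rho_succN; case: (rho_facts j (ihat i)).
move: l; apply: (@ihat_ind _ i); last by lia.
by rewrite Ew in Hx; exact: root_coord_ge0 Hx x0 d1.
Qed.

Lemma weyl_coset_wspan w phi Q v : weyl_coset w phi ->
  wspan Q v -> wspan [set w mu | mu in Q] ((phi : g -> g) v).
Proof.
move=> Hphi; have [lphi _ _] := weyl_coset_aut Hphi.
elim=> [|y z _ H1 _ H2|mu y Hy Qmu].
- by rewrite (lin0 lphi); exact: gspan0.
- by rewrite (linD lphi); exact: gspanD.
- by apply: (gspanI (permutes_in (weyl_coset_perm Hphi) Hy)); exists mu.
Qed.

(** w_i preserves the coordinate along the other simple root, so only a weight proportional to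
    alpha_i can change sign, and such a weight is 0 or alpha_i itself. *)
Lemma simple_refl_wspan s i phi v : weyl_coset (simple_refl A i) phi ->
  wspan (signed_roots s) v -> wspan (parabolic_weights s i) ((phi : g -> g) v).
Proof.
move=> Hphi; have aphi := weyl_coset_aut Hphi; have [lphi _ _] := aphi.
elim=> [|y z _ H1 _ H2|mu y Hy Qmu].
- by rewrite (lin0 lphi); exact: gspan0.
- by rewrite (linD lphi); exact: gspanD.
have Hp := permutes_in (weyl_coset_perm Hphi) Hy.
have [->|y0] := eqVneq y 0; first by rewrite (lin0 lphi); exact: gspan0.
apply: (gspanI Hp); have p0 := aut_neq0 aphi y0.
case: (boolP ((-1) ^+ s * mu 0 (ihat i) == 0)) => [/eqP mu0|mu0]; last first.
  left; have E : simple_refl A i mu = (-1) ^+ s *: ((-1) ^+ s *: simple_refl A i mu) by rewrite scale_sign.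
  rewrite E in Hp; have d1 : 1 <= ((-1) ^+ s *: simple_refl A i mu) 0 (ihat i).
    by rewrite mxE simple_refl_coordN; have := Qmu (ihat i); move: mu0; lia.
  have d0 := root_coord_ge0 Hp p0 d1.
  by apply: (@ihat_ind _ i); move: d0 d1; rewrite !mxE //; lia.
have muE : (-1) ^+ s *: mu = ((-1) ^+ s * mu 0 i) *: simple_root i.
  by apply: (@lattice_eq _ _ i); rewrite !mxE !eqxx ?mulr1 // mu0 (negPf (ihat_neq i)) mulr0.
case: (root_cases Hy y0) => [E|[s' [k E]]|[s' H]].
- by left; rewrite E /simple_refl pairing0 scale0r subr0 => k; rewrite mxE mulr0.
- have ki : k = i.
    apply/eqP; apply: contraTT isT; rewrite neq_ihat => /eqP ki.
    have := congr1 (fun m : lattice => m 0 (ihat i)) E; rewrite sroot_coord ki eqxx mulr1.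
    by move=> Ei; rewrite Ei in mu0; move: mu0; case: (s) (s') => [] [].
  right; rewrite /= E ki simple_refl_sroot; congr (sroot (~~ _) _).
  have := Qmu i; rewrite E ki sroot_coord eqxx mulr1.
  by case: (s) (s') => [] [].
- have := H (ihat i); have -> : mu 0 (ihat i) = 0; last by rewrite mulr0.
  by move/eqP: mu0; rewrite mulf_eq0 signr_eq0 => /eqP.
Qed.

Lemma parabolicP s i p : parabolic s i p <-> borel s p \/
  exists (x n y : g -> g), [/\ borel s x, weyl_coset (simple_refl A i) n, borel s y & p = x \o n \o y].
Proof.
split=> [[H|[x Hx [_ [n Hn [y Hy <-]] <-]]]|[H|[x [n [y [Hx Hn Hy ->]]]]]].
- by left.
- by right; exists x, n, y.
- by left.
- by right; exists x => //; exists (n \o y) => //; exists n => //; exists y.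
Qed.

Lemma parabolic_wspan s i p v : parabolic s i p ->
  wspan (signed_roots s) v -> wspan (parabolic_weights s i) ((p : g -> g) v).
Proof.
move=> /parabolicP[Bp|[x [n [y [Bx Hn By ->]]]]] Hv /=.
  apply: gspan_sub (borel_wspan (@root_closed_signed s) Bp Hv) => mu z _ H.
  by left.
apply: borel_wspan (@root_closed_parabolic s i) Bx _.
apply: simple_refl_wspan Hn _.
exact: borel_wspan (@root_closed_signed s) By Hv.
Qed.

(** The positive real roots other than alpha_i, split by sequence: w_i exchanges the two sets, and
    U_(alpha_i) normalizes the group of the side roots. *)
Definition side_roots s i : set lattice := [set mu | exists k : nat, mu = srho s k.+1 i].
Definition far_roots s i : set lattice := [set mu | exists k : nat, mu = srho s k (ihat i)].

Lemma side_roots_pos s i : side_roots s i `<=` posroots s.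
Proof. by move=> mu [k ->]; exact: posroots_srho. Qed.
Lemma far_roots_pos s i : far_roots s i `<=` posroots s.
Proof. by move=> mu [k ->]; exact: posroots_srho. Qed.
Lemma side_roots_real s i : side_roots s i `<=` real_roots A.
Proof. by move=> mu [k ->]; exact: real_root_srho. Qed.
Lemma far_roots_real s i : far_roots s i `<=` real_roots A.
Proof. by move=> mu [k ->]; exact: real_root_srho. Qed.

Lemma side_far s i mu : side_roots s i mu -> far_roots s i (simple_refl A i mu).
Proof. by case=> k ->; exists k; rewrite simple_refl_srho. Qed.
Lemma far_side s i mu : far_roots s i mu -> side_roots s i (simple_refl A i mu).
Proof. by case=> k ->; exists k; rewrite simple_refl_srhoN. Qed.

Lemma posroots_cases s i mu : posroots s mu ->
  [\/ mu = sroot s i, side_roots s i mu | far_roots s i mu].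
Proof.
case=> r H; have [j [k ->]] := real_signed_cases r H.
case: (eqVneq k i) => [->|].
  by case: j => [|j]; [constructor 1|constructor 2; exists j].
by rewrite neq_ihat => /eqP ->; constructor 3; exists j.
Qed.

Lemma side_roots_conj s i u (x : g -> g) : root_group R A (sroot s i) u ->
  roots_group (side_roots s i) x ->
  exists2 y : g -> g, roots_group (side_roots s i) y & u \o x = y \o u.
Proof.
move=> Hu; have [v [_ K K']] := root_group_inv (real_root_sroot s i) Hu.
apply: (generated_conj K K') => p [mu [k ->]] Hp.
exact: commutator_rho Hu Hp.
Qed.

(** The Bruhat decomposition in SL_2: exp(tf) = exp(e/t) n exp(e/t), with n the representative of
    parameter -1/t. *)
Lemma root_group_opp_factor s i v : root_group R A (sroot (~~ s) i) v -> v = id \/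
  exists e e' n, [/\ root_group R A (sroot s i) e, root_group R A (sroot s i) e',
    weyl_coset (simple_refl A i) n & v = e \o n \o e'].
Proof.
move=> /root_group_simple[t ->]; have [->|t0] := eqVneq t 0.
  by left; rewrite scale0r Exp_ad0.
have K (q : C) : cancel (Exp_ad (q *: es s i)) (Exp_ad (- q *: es s i)).
  by rewrite scaleNr; apply: Exp_adNK; exact/ad_nilpZ/ad_nilp_es.
have Ge : root_group R A (sroot s i) (Exp_ad (t^-1 *: es s i)).
  by apply/root_group_simple; exists t^-1.
right; exists (Exp_ad (t^-1 *: es s i)), (Exp_ad (t^-1 *: es s i)), (nmap s i (- t^-1)); split=> //.
  by apply: weyl_coset_nmap; rewrite oppr_eq0 invr_eq0.
apply: funext => z; rewrite /nmap /= invrN opprK invrK K.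
by have := K (- t^-1) (Exp_ad (t *: es (~~ s) i) z); rewrite opprK => ->.
Qed.

Lemma nmap1 s i : [/\ weyl_coset (simple_refl A i) (nmap s i (1 : C)),
  weyl_coset (simple_refl A i) (nmap s i (-1 : C)),
  cancel (nmap s i (1 : C)) (nmap s i (-1)) & cancel (nmap s i (-1 : C)) (nmap s i 1)].
Proof.
split; [apply: weyl_coset_nmap; exact: oner_neq0|
        by apply: weyl_coset_nmap; rewrite oppr_eq0 oner_neq0|exact: nmapK|exact: nmapNK].
Qed.

(** On side roots v is factored as e n e': e' keeps the side group, n turns it into the far group,
    and e lies in B. Far roots are first moved to the side by n, which also turns v into an element
    of U_(alpha_i). *)
Lemma opp_conj_borel s i v (x : g -> g) mu : root_group R A (sroot (~~ s) i) v ->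
  posroots s mu -> mu != sroot s i -> root_group R A mu x ->
  exists2 y : g -> g, borel s y & v \o x = y \o v.
Proof.
move=> Hv Pmu nmu Hx; case: (posroots_cases i Pmu) => [E|Smu|Fmu].
- by rewrite E eqxx in nmu.
- have Gx : roots_group (side_roots s i) x by exact: roots_group_in Smu Hx.
  case: (root_group_opp_factor Hv) => [->|[e [e' [n [He He' Hn ->]]]]].
    by exists x => //; exact: borel_root Pmu Hx.
  have [x1 Gx1 E1] := side_roots_conj He' Gx.
  have [x2 Gx2 E2] := roots_group_conj (@side_roots_real s i) (@far_roots_real s i)
     (@side_far s i) (weyl_coset_aut Hn) (weyl_coset_perm Hn) Gx1.
  have [f [Hf K K']] := root_group_inv (real_root_sroot s i) He.
  have Ps : posroots s (sroot s i) := posroots_srho s 0 i.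
  exists (e \o x2 \o f).
    apply: borel_comp; last exact: borel_root Ps Hf.
    apply: borel_comp; first exact: borel_root Ps He.
    exact: borel_roots (@far_roots_pos s i) Gx2.
  apply: funext => z /=; rewrite K; congr e.
  by rewrite (comp_eq E1) (comp_eq E2).
- have [Hn Hn' K K'] := nmap1 s i; set n := nmap s i 1 in Hn K K'; set n' := nmap s i (-1) in Hn' K K'.
  have rs := real_root_sroot s i.
  have [u] := root_group_conj (w := simple_refl A i) (real_root_sroot (~~ s) i)
    (real_root_weyl (weyl_elt_simple i) (real_root_sroot (~~ s) i)) (weyl_coset_aut Hn) (weyl_coset_perm Hn) Hv.
  rewrite simple_refl_sroot negbK => Hu Eu.
  have rmu : real_roots A mu := posroots_real Pmu.
  have [x1 Hx1 E1] := root_group_conj (w := simple_refl A i) rmu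
    (real_root_weyl (weyl_elt_simple i) rmu) (weyl_coset_aut Hn) (weyl_coset_perm Hn) Hx.
  have [y1 Gy1 E2] := side_roots_conj Hu (roots_group_in (far_side Fmu) Hx1).
  have [y Gy E3] := roots_group_conj (@side_roots_real s i) (@far_roots_real s i)
     (@side_far s i) (weyl_coset_aut Hn') (weyl_coset_perm Hn') Gy1.
  exists y; first exact: borel_roots (@far_roots_pos s i) Gy.
  apply: funext => z /=; apply: (can_inj K).
  rewrite (comp_eq Eu) (comp_eq E1) (comp_eq E2).
  by apply: (can_inj K'); rewrite (comp_eq E3) -(comp_eq Eu) !K.
Qed.

(** The products u y of the required shape contain the identity and are stable under left
    multiplication by T and by each positive root group. *)
Lemma borel_decomposition s i n n' (x : g -> g) : weyl_coset (simple_refl A i) n ->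
  cancel n n' -> cancel n' n -> borel s x ->
  exists u (y : g -> g), [/\ root_group R A (sroot s i) u, borel s y, borel s (n' \o y \o n) &
    x = u \o y].
Proof.
move=> Hn K K'.
have Hn' := weyl_coset_inv (weyl_elt_simple i) (simple_reflK i) (simple_reflK i) Hn K K'.
have an' := weyl_coset_aut Hn'; have pn' := weyl_coset_perm Hn'.
have rs := real_root_sroot s i; have Ps : posroots s (sroot s i) := posroots_srho s 0 i.
pose X (x : g -> g) := exists u (y : g -> g), [/\ root_group R A (sroot s i) u, borel s y, borel s (n' \o y \o n) &
    x = u \o y].
have X1 : X id.
  exists id, id; split=> //; last 1 first.
  - have -> : n' \o id \o n = id by apply: funext => z /=; rewrite K.
    exact: borel_id.
  - by exists 0 => //; rewrite root_elt0.
  - exact: borel_id.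
have refl_real mu : real_roots A mu -> real_roots A (simple_refl A i mu).
  exact: real_root_weyl (weyl_elt_simple i).
have XR mu p (z : g -> g) : posroots s mu -> root_group R A mu p -> X z -> X (p \o z).
  move=> Pmu Hp [u [y [Hu By Bny ->]]].
  have [Emu|nmu] := eqVneq mu (sroot s i).
    exists (p \o u), y; split=> //; move: Hp Hu; rewrite Emu => -[t _ <-] [t' _ <-].
    by exists (t + t') => //; rewrite root_eltD.
  have [v [Hv L L']] := root_group_inv rs Hu.
  have rmu := posroots_real Pmu.
  have [v'] := root_group_conj (w := simple_refl A i) rs (refl_real _ rs) an' pn' Hv.
  rewrite simple_refl_sroot => Hv' Ev.
  have [p' Hp' Ep] := root_group_conj (w := simple_refl A i) rmu (refl_real _ rmu) an' pn' Hp.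
  have Pmu' : posroots s (simple_refl A i mu).
    case: (posroots_cases i Pmu) nmu => [->|/side_far/far_roots_pos //|/far_side/side_roots_pos //].
    by rewrite eqxx.
  have nmu' : simple_refl A i mu != sroot s i.
    apply/eqP => E; have := signed_srhoN (s := s) (j := 0%N) (i := i).
    have [_] := Pmu; rewrite -(simple_reflK i mu) E simple_refl_sroot.
    by rewrite srho0 => H /(_ H).
  have [q Bq Eq] := opp_conj_borel Hv' Pmu' nmu' Hp'.
  (* p u y = u (u^-1 p u) y. Conjugating u^-1 p u by n^-1 gives an element of U_(w_i mu) conjugated
     by one of U_(-alpha_i), which lies in B since w_i mu is positive and differs from alpha_i. *)
  exists u, (v \o p \o u \o y); split=> //.
  - do 2!apply: borel_comp => //; [|exact: borel_root Ps Hu].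
    by apply: borel_comp; [exact: borel_root Ps Hv|exact: borel_root Pmu Hp].
  - have -> : n' \o (v \o p \o u \o y) \o n = q \o (n' \o y \o n); last exact: borel_comp.
    apply: funext => z' /=; rewrite (comp_eq Ev) (comp_eq Ep) (comp_eq Eq).
    by rewrite -(comp_eq Ev) L.
  - by apply: funext => z' /=; rewrite L'.
have XT t (z : g -> g) : torus t -> X z -> X (t \o z).
  move=> Tt [u [y [Hu By Bny ->]]].
  have [u' Hu' E] := root_group_conj (w := id) rs rs (torus_aut Tt) (torus_permutes Tt) Hu.
  exists u', (t \o y); split=> //; first by apply: borel_comp => //; exact: borel_torus.
    have [t' Tt' E'] := torus_conj (weyl_elt_simple i) an' pn' Tt.
    have -> : n' \o (t \o y) \o n = t' \o (n' \o y \o n).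
      by apply: funext => z' /=; rewrite (comp_eq E').
    by apply: borel_comp => //; exact: borel_torus.
  by apply: funext => z' /=; rewrite (comp_eq E).
have XU u : roots_group (posroots s) u -> forall z : g -> g, X z <-> X (u \o z).
  elim=> [p [mu Pmu Hp]||p q _ Hp _ Hq|p q _ Hp pq qp] z.
  - split; first exact: XR Pmu Hp.
    have [v [Hv L L']] := root_group_inv (posroots_real Pmu) Hp.
    move=> /(XR _ _ _ Pmu Hv); have -> // : v \o (p \o z) = z.
    by apply: funext => z' /=; rewrite L.
  - by [].
  - by rewrite (Hq z) (Hp (q \o z)).
  - rewrite (Hp (q \o z)); have -> // : p \o (q \o z) = z.
    by apply: funext => z' /=; rewrite qp.
move=> /borelP[t [u [Tt Uu ->]]]; apply: (XT t u Tt).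
by apply/(XU u Uu id); exact: X1.
Qed.

Lemma parabolic_borel s i (x p : g -> g) : borel s x -> parabolic s i p -> parabolic s i (x \o p).
Proof.
move=> Bx /parabolicP H; apply/parabolicP; case: H => [Bp|[y [n [z [By Hn Bz ->]]]]].
  by left; exact: borel_comp.
by right; exists (x \o y), n, z; split=> //; exact: borel_comp.
Qed.

(** For n x m z with x = u y, the product n u n^-1 lies in U_(-alpha_i) and the remaining factors in
    B; the SL_2 factorization puts the result back into B or B w_i B. *)
Lemma parabolic_simple s i n p : weyl_coset (simple_refl A i) n ->
  parabolic s i p -> parabolic s i (n \o p : g -> g).
Proof.
move=> Hn /parabolicP[Bp|[x [m [z [Bx Hm Bz ->]]]]].
  by apply/parabolicP; right; exists id, n, p; split=> //; exact: borel_id.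
have [_ [m' K K'] _] := weyl_coset_aut Hm.
have [u [y [Hu By Bmy ->]]] := borel_decomposition Hm K K' Bx.
have Tnm : torus (n \o m).
  apply: weyl_coset_id; have := weyl_coset_comp (weyl_elt_simple i) (weyl_elt_simple i) Hn Hm.
  have -> // : simple_refl A i \o simple_refl A i = id.
  by apply: funext => mu /=; rewrite simple_reflK.
have rs := real_root_sroot s i.
have [v] := root_group_conj (w := simple_refl A i) rs
  (real_root_weyl (weyl_elt_simple i) rs) (weyl_coset_aut Hn) (weyl_coset_perm Hn) Hu.
rewrite simple_refl_sroot => Hv Ev.
pose q := (n \o m) \o (m' \o y \o m) \o z.
have Bq : borel s q.
  by do 2!apply: borel_comp => //; exact: borel_torus.
have -> : n \o (u \o y \o m \o z) = v \o q.
  by apply: funext => w; rewrite /q /= K' (comp_eq Ev).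
case: (root_group_opp_factor Hv) => [->|[e [e' [n1 [He He' Hn1 ->]]]]].
  by apply/parabolicP; left.
have Ps : posroots s (sroot s i) := posroots_srho s 0 i.
apply/parabolicP; right; exists e, n1, (e' \o q); split=> //; first exact: borel_root Ps He.
by apply: borel_comp => //; exact: borel_root Ps He'.
Qed.

(** * The fundamental apartment *)

(** The type of the vertex between the chambers n and n + 1, so that w(n + 1) = w(n) w_i with this
    i. *)
Definition wall_index (n : int) : 'I_2 := if (n %% 2)%Z == 0 then i2 else i1.

Lemma ihat1 : ihat i1 = i2. Proof. exact: val_inj. Qed.
Lemma ihat2 : ihat i2 = i1. Proof. exact: val_inj. Qed.

Lemma wall_index_succ n : wall_index (n + 1) = ihat (wall_index n).
Proof.
rewrite /wall_index; case: eqP => h; case: eqP => h'; rewrite ?ihat1 ?ihat2 //; lia.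
Qed.

Lemma wall_index_pred n : wall_index (n - 1) = ihat (wall_index n).
Proof. by have := wall_index_succ (n - 1); rewrite subrK => ->; rewrite ihatK. Qed.

Lemma weyl_pow_succ m : weyl_pow A (m + 1) =1 weyl_pow A m \o (simple_refl A i2 \o simple_refl A i1).
Proof.
move=> mu; case: m => [p|[|p]].
- by rewrite -PoszD addn1; exact: iterSr.
- by rewrite /= !simple_reflK.
- have -> : Negz p.+1 + 1 = Negz p by lia.
  rewrite [RHS](iterSr p.+1 (simple_refl A i1 \o simple_refl A i2)).
  by rewrite [X in _ = iter _ _ X]/= !simple_reflK.
Qed.

Lemma weyl_succ n : weyl A (n + 1) =1 weyl A n \o simple_refl A (wall_index n).
Proof.
move=> mu; rewrite /weyl /wall_index; case: (eqVneq (n %% 2)%Z 0) => h.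
  rewrite ifF; last by apply/negbTE; lia.
  by have -> : ((n + 1) %/ 2)%Z = (n %/ 2)%Z by lia.
rewrite ifT; last by lia.
have -> : ((n + 1) %/ 2)%Z = (n %/ 2)%Z + 1 by lia.
by rewrite weyl_pow_succ.
Qed.

Lemma weyl_pred n : weyl A (n - 1) =1 weyl A n \o simple_refl A (ihat (wall_index n)).
Proof.
move=> mu; have /= := weyl_succ (n - 1) (simple_refl A (wall_index (n - 1)) mu).
by rewrite subrK simple_reflK wall_index_pred.
Qed.

Lemma weyl_elt_weyl n : weyl_elt (weyl A n).
Proof.
have W i := weyl_elt_simple i.
have Wi p w : weyl_elt w -> weyl_elt (iter p w).
  move=> Ww; elim: p => [|p IH]; first exact: gen_id.
  by rewrite (_ : iter p.+1 w = w \o iter p w) //; exact: gen_comp.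
have Wp m : weyl_elt (weyl_pow A m).
  by case: m => p; apply: Wi; apply: gen_comp; exact: W.
rewrite /weyl; case: eqP => _; first exact: Wp.
by apply: gen_comp; [exact: Wp|exact: W].
Qed.

Lemma Phi2E n : Phi A i2 n = weyl A n (simple_root (wall_index n)).
Proof. by rewrite /Phi /wall_index; case: eqP => _ //; rewrite ihat2. Qed.

Lemma Phi1E n : Phi A i1 n = weyl A n (simple_root (ihat (wall_index n))).
Proof. by rewrite /Phi /wall_index; case: eqP => _; rewrite ?ihat1 ?ihat2. Qed.

(** Seen from the chamber n, the roots Phi_2 to its right form one sequence of positive real roots;
    by [Phi2_left] those to its left are the negatives of the other sequence. *)
Lemma Phi2_right n d : Phi A i2 (n + d%:Z) = weyl A n (rho d (wall_index n)).
Proof.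
elim: d n => [|d IH] n; first by rewrite addr0 Phi2E.
have -> : n + d.+1%:Z = n + 1 + d%:Z by lia.
by rewrite IH weyl_succ wall_index_succ.
Qed.

Lemma Phi2_left n d : Phi A i2 (n - d.+1%:Z) = - weyl A n (rho d (ihat (wall_index n))).
Proof.
elim: d n => [|d IH] n.
  rewrite Phi2E weyl_pred wall_index_pred /=.
  rewrite -(sroot0 (ihat _)) simple_refl_sroot srootN sroot0.
  by rewrite (linN (weyl_elt_linear (weyl_elt_weyl n))).
have -> : n - d.+2%:Z = n - 1 - d.+1%:Z by lia.
by rewrite IH weyl_pred wall_index_pred ihatK /= ihatK.
Qed.

(** Both roots belong to the wall between the chambers n - 1 and n. This reduces statements on Phi_1
    to statements on Phi_2 with the opposite sign. *)
Lemma Phi1_Phi2 n : Phi A i1 n = - Phi A i2 (n - 1).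
Proof. by rewrite (Phi2_left n 0) opprK Phi1E. Qed.

Lemma signed_Phi2_in s (n k : int) : n <= k -> exists2 be, posroots s be &
  (-1) ^+ s *: Phi A i2 k = weyl A n be.
Proof.
move=> nk; exists (srho s (absz (k - n)%R) (wall_index n)); first exact: posroots_srho.
rewrite /srho (weyl_eltZ _ _ (weyl_elt_weyl n)) -Phi2_right.
by congr (_ *: Phi A i2 _); lia.
Qed.

Lemma signed_Phi2_out s (n k : int) : k < n -> exists2 be, posroots (~~ s) be &
  (-1) ^+ s *: Phi A i2 k = weyl A n be.
Proof.
move=> nk; exists (srho (~~ s) (absz (n - k - 1)%R) (ihat (wall_index n))); first exact: posroots_srho.
rewrite /srho (weyl_eltZ _ _ (weyl_elt_weyl n)) signC scaleNr -scalerN -Phi2_left.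
by congr (_ *: Phi A i2 _); lia.
Qed.

Lemma posroots_disjoint s mu : posroots s mu -> ~ posroots (~~ s) mu.
Proof.
move=> [r H] [_ H']; have [j [i E]] := real_signed_cases r H.
by rewrite -(negbK s) in E; case: (@signed_srhoN (~~ s) j i); rewrite -E.
Qed.

Lemma real_root_signed_Phi2 s k : real_roots A ((-1) ^+ s *: Phi A i2 k).
Proof.
have [be Pbe ->] := signed_Phi2_in s (lexx k).
exact: real_root_weyl (weyl_elt_weyl k) (posroots_real Pbe).
Qed.

(** A fixed representative; the coset in [apt_chamber] uses all of them, which differ by T. *)
Definition lift n : g -> g := projT1 (cid (weyl_elt_lift (weyl_elt_weyl n))).

Lemma weyl_coset_lift n : weyl_coset (weyl A n) (lift n).
Proof. exact: (projT2 (cid (weyl_elt_lift (weyl_elt_weyl n)))). Qed.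

Lemma lift_group n : kac_moody_group (lift n).
Proof. exact: weyl_coset_group (weyl_coset_lift n). Qed.

(** * Chambers and vertices as cosets *)

Section Tree.
Variable s : bool.
Local Notation B := (borel (R := R) (A := A) s).
Local Notation P i := (parabolic (R := R) (A := A) s i).
Local Notation "phi · X" := (lcoset phi X) (at level 40).
Implicit Types (phi psi : g -> g).

Lemma lcoset_comp phi psi (X : set (g -> g)) : phi · (psi · X) = (phi \o psi) · X.
Proof.
apply/seteqP; split=> [_ [_ [x Hx <-] <-]|_ [x Hx <-]]; first by exists x.
by exists (psi \o x) => //; exists x.
Qed.

Lemma borel_coset_eq phi psi bb : B bb -> psi = phi \o bb -> psi · B = phi · B.
Proof.
move=> Bb ->; have [_ [b' K K'] _] := borel_aut Bb; have Bb' := borel_inv Bb K K'.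
apply/seteqP; split=> [_ [x Hx <-]|_ [x Hx <-]].
  by exists (bb \o x) => //; exact: borel_comp.
by exists (b' \o x); [exact: borel_comp|apply: funext => z /=; rewrite K'].
Qed.

Lemma parabolic_coset_eq i phi psi bb : B bb -> psi = phi \o bb -> psi · P i = phi · P i.
Proof.
move=> Bb ->; have [_ [b' K K'] _] := borel_aut Bb; have Bb' := borel_inv Bb K K'.
apply/seteqP; split=> [_ [x Hx <-]|_ [x Hx <-]].
  by exists (bb \o x) => //; exact: parabolic_borel.
by exists (b' \o x); [exact: parabolic_borel|apply: funext => z /=; rewrite K'].
Qed.

Lemma parabolic_refl_coset i phi n : weyl_coset (simple_refl A i) n ->
  (phi \o n) · P i = phi · P i.
Proof.
move=> Hn; have [_ [n' K K'] _] := weyl_coset_aut Hn.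
have Hn' := weyl_coset_inv (weyl_elt_simple i) (simple_reflK i) (simple_reflK i) Hn K K'.
apply/seteqP; split=> [_ [x Hx <-]|_ [x Hx <-]].
  by exists (n \o x) => //; exact: parabolic_simple.
by exists (n' \o x); [exact: parabolic_simple|apply: funext => z /=; rewrite K'].
Qed.

Lemma coset_eq_in phi psi (X : set (g -> g)) : X id -> phi · X = psi · X ->
  exists2 x, X x & phi = psi \o x.
Proof.
move=> X1 E; have : (phi · X) phi by exists id.
by rewrite E => -[x Xx <-]; exists x.
Qed.

Lemma parabolic_id i : P i id.
Proof. by left; exact: borel_id. Qed.

Lemma boundary_chamber phi : kac_moody_group phi ->
  boundary s (Chamber (phi · B)) = [set v | exists i, v = Vertex i (phi · P i)].
Proof.
move=> Gphi; apply/seteqP; split=> [v [psi Gpsi [[E] [i ->]]]|v [i ->]].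
  exists i; congr Vertex; have [bb Bb ->] := coset_eq_in (borel_id s) E.
  by rewrite (parabolic_coset_eq i Bb (erefl _)).
by exists phi => //; split=> //; exists i.
Qed.

Definition chamber (n : int) : simplex R A := Chamber (lift n · B).
(** This is the vertex v_(n + 1/2). *)
Definition vertex (n : int) : simplex R A := Vertex (wall_index n) (lift n · P (wall_index n)).

Lemma apt_chamberE n : apt_chamber R A s n = chamber n.
Proof.
congr Chamber; apply/seteqP; split=> [_ [phi Hphi [bb Bb <-]]|_ [bb Bb <-]]; last first.
  by exists (lift n); [exact: weyl_coset_lift|exists bb].
have Hl := weyl_coset_lift n; have [_ [l' K K'] _] := weyl_coset_aut Hl.
have W := weyl_elt_weyl n; have [w' L L'] := weyl_elt_bij W.
have T : torus (l' \o phi).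
  apply: weyl_coset_id; have := weyl_coset_comp (weyl_elt_inv W L L') W
    (weyl_coset_inv W L L' Hl K K') Hphi.
  by have -> // : w' \o weyl A n = id by apply: funext => mu /=.
exists ((l' \o phi) \o bb); first by apply: borel_comp => //; exact: borel_torus.
by apply: funext => z /=; rewrite K'.
Qed.

Lemma vertex_succ n :
  vertex n = Vertex (wall_index n) (lift (n + 1) · P (wall_index n)).
Proof.
congr Vertex; have Hl := weyl_coset_lift n; have [_ [l' K K'] _] := weyl_coset_aut Hl.
have W := weyl_elt_weyl n; have [w' L L'] := weyl_elt_bij W.
have H : weyl_coset (simple_refl A (wall_index n)) (l' \o lift (n + 1)).
  have := weyl_coset_comp (weyl_elt_inv W L L') (weyl_elt_weyl (n + 1))
    (weyl_coset_inv W L L' Hl K K') (weyl_coset_lift (n + 1)).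
  have -> // : w' \o weyl A (n + 1) = simple_refl A (wall_index n).
  by apply: funext => mu /=; rewrite weyl_succ /= L.
rewrite -(parabolic_refl_coset (lift n) H); congr lcoset.
by apply: funext => z /=; rewrite K'.
Qed.

Lemma boundary_apt n : boundary s (chamber n) = [set vertex (n - 1); vertex n].
Proof.
rewrite boundary_chamber; last exact: lift_group.
rewrite vertex_succ subrK wall_index_pred; apply/seteqP; split=> [v [i ->]|v [->|->]].
- case: (eqVneq i (wall_index n)) => [->|]; first by right.
  by rewrite neq_ihat => /eqP ->; left.
- by exists (ihat (wall_index n)).
- by exists (wall_index n).
Qed.

(** The extra index k - 1 is the left vertex v_(k - 1/2) of the chamber k. *)
Lemma RrayE k : Rray R A s k =
  [set chamber m | m in [set m | k <= m]] `|` [set vertex m | m in [set m | k - 1 <= m]].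
Proof.
apply/seteqP; split=> [x [m /= km]|x [[m /= km <-]|[m /= km <-]]].
- rewrite apt_chamberE => -[->|]; first by left; exists m.
  rewrite boundary_apt => -[->|->]; right; [exists (m - 1)|exists m] => //=; lia.
- by exists m => //; rewrite apt_chamberE; left.
- exists (m + 1) => /=; first by lia.
  by rewrite apt_chamberE; right; rewrite boundary_apt addrK; left.
Qed.

Lemma LrayE k : Lray R A s k =
  [set chamber m | m in [set m | m <= k]] `|` [set vertex m | m in [set m | m <= k]].
Proof.
apply/seteqP; split=> [x [m /= km]|x [[m /= km <-]|[m /= km <-]]].
- rewrite apt_chamberE => -[->|]; first by left; exists m.
  rewrite boundary_apt => -[->|->]; right; [exists (m - 1)|exists m] => //=; lia.
- by exists m => //; rewrite apt_chamberE; left.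
- exists m => //.
  by rewrite apt_chamberE; right; rewrite boundary_apt; right.
Qed.

(** * Distinct chambers and distinct vertices *)

(** A nonzero vector of weight be is sent by p = phi^-1 psi to weight v^-1 w be; as p maps the
    positive part into [wspan Q], that weight lies in Q. *)
Lemma coset_roots v w phi psi (Q : set lattice) p be : weyl_elt v -> weyl_elt w ->
  weyl_coset v phi -> weyl_coset w psi -> psi = phi \o p ->
  (forall x, wspan (signed_roots s) x -> wspan Q (p x)) -> posroots s be ->
  exists2 mu, Q mu & v mu = w be.
Proof.
move=> V W Hphi Hpsi E Hp Pbe; have [lphi [phi' K K'] _] := weyl_coset_aut Hphi.
have [v' L L'] := weyl_elt_bij V.
have rbe := posroots_real Pbe; have [e0 _ _] := real_root_vector rbe.
have He := root_vector_in rbe; set e := root_vector R A be in e0 He.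
have Hpe : wspan Q (p e) by apply: Hp; apply: (gspanI He); case: Pbe.
have pe : p e = phi' (psi e) by rewrite E /= K.
exists (v' (w be)); last exact: L'.
apply: (wspan_weight pairing_inj Hpe).
  rewrite pe; apply: (permutes_in (permutes_inv (weyl_coset_perm Hphi) K K' L')).
  exact: (permutes_in (weyl_coset_perm Hpsi) He).
rewrite pe; apply: contraNneq (aut_neq0 (weyl_coset_aut Hpsi) e0) => E0.
by apply/eqP; rewrite -(K' (psi e)) E0 (lin0 lphi).
Qed.

(** The root Phi_2(n), with sign s, is positive seen from the chamber n and negative seen from m >
    n. *)
Lemma chamber_neq (n m : int) : n < m -> chamber n <> chamber m.
Proof.
move=> nm [E]; have [bb Bb Eb] := coset_eq_in (borel_id s) (esym E).
have [be Pbe Ebe] := signed_Phi2_out s nm; have [be' Pbe' Ebe'] := signed_Phi2_in s (lexx n).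
have [_ [b' K K'] _] := borel_aut Bb.
have Eb' : lift n = lift m \o b' by rewrite Eb; apply: funext => z /=; rewrite K'.
have [mu Qmu Emu] := coset_roots (weyl_elt_weyl m) (weyl_elt_weyl n) (weyl_coset_lift m)
  (weyl_coset_lift n) Eb' (fun x => borel_wspan (@root_closed_signed s) (borel_inv Bb K K')) Pbe'.
move: Emu; rewrite -Ebe' Ebe => /(bij_inj (weyl_elt_bij (weyl_elt_weyl m))) E'.
apply: (posroots_disjoint (s := s) _ Pbe); rewrite -E'; split=> //.
by rewrite E'; exact: posroots_real Pbe.
Qed.

Lemma chamber_inj n m : chamber n = chamber m -> n = m.
Proof. by case: (ltgtP n m) => // [/chamber_neq|/chamber_neq nm /esym]. Qed.

Lemma vertex_neq (n m : int) : n < m -> vertex n <> vertex m.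
Proof.
move=> nm E; have Ei : wall_index n = wall_index m by case: E.
have := E; rewrite /vertex -Ei => -[E1].
have [p Pp Ep] := coset_eq_in (parabolic_id _) E1.
have [be Pbe Ebe] := signed_Phi2_out s nm; have [be' Pbe' Ebe'] := signed_Phi2_in s (lexx n).
have [mu Qmu Emu] := coset_roots (weyl_elt_weyl m) (weyl_elt_weyl n) (weyl_coset_lift m)
  (weyl_coset_lift n) Ep (fun x => parabolic_wspan Pp) Pbe'.
move: Emu; rewrite -Ebe' {1}Ebe => /(bij_inj (weyl_elt_bij (weyl_elt_weyl m))) E'.
case: Qmu => [Qmu|Emu].
  apply: (posroots_disjoint (s := s) _ Pbe); rewrite -E'; split=> //.
  by rewrite E'; exact: posroots_real Pbe.
(* In the extra case - alpha_i of the parabolic, Phi_2(n) would be - Phi_2(m), although both are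
   positive seen from n. *)
have [ga Pga Ega] := signed_Phi2_in s (ltW nm).
have lm := weyl_elt_linear (weyl_elt_weyl m); have ln := weyl_elt_linear (weyl_elt_weyl n).
have Eopp : weyl A n ga = - weyl A n be'.
  rewrite -Ega -Ebe' Ebe -E' Emu srootN (linN lm) opprK.
  by rewrite /sroot (weyl_eltZ _ _ (weyl_elt_weyl m)) Ei -Phi2E.
have Eg : ga = - be'.
  by apply: (bij_inj (weyl_elt_bij (weyl_elt_weyl n))); rewrite Eopp (linN ln).
apply: (posroots_disjoint Pga); split; first exact: posroots_real Pga.
by rewrite Eg => k; case: Pbe' => _ /(_ k); rewrite mxE signC mulrNN.
Qed.

Lemma vertex_inj : injective vertex.
Proof. by move=> n m; case: (ltgtP n m) => // [/vertex_neq|/vertex_neq nm /esym]. Qed.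

(** * Root groups acting on the apartment *)

Lemma coset_fixed al n u :
  (exists2 be, posroots s be & al = weyl A n be) -> root_group R A al u ->
  exists2 bb, B bb & u \o lift n = lift n \o bb.
Proof.
move=> [be Pbe ->] Hu; have rbe := posroots_real Pbe; have Hl := weyl_coset_lift n.
have [_ [l' K K'] _] := weyl_coset_aut Hl.
have W := weyl_elt_weyl n; have [w' L L'] := weyl_elt_bij W.
have Hl' := weyl_coset_inv W L L' Hl K K'.
have rw : real_roots A (w' (weyl A n be)) by rewrite L.
have [bb] := root_group_conj (real_root_weyl W rbe) rw (weyl_coset_aut Hl') (weyl_coset_perm Hl') Hu.
rewrite L => Hb E; exists bb; first exact: borel_root Pbe Hb.
by apply: funext => z /=; apply: (can_inj K'); rewrite (comp_eq E) !K.
Qed.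

Lemma chamber_fixed al n u : (exists2 be, posroots s be & al = weyl A n be) ->
  root_group R A al u -> act u (chamber n) = chamber n.
Proof.
move=> H Hu; have [bb Bb E] := coset_fixed H Hu.
by rewrite /= lcoset_comp (borel_coset_eq Bb E).
Qed.

Lemma vertex_fixed al n u : (exists2 be, posroots s be & al = weyl A n be) \/
    (exists2 be, posroots s be & al = weyl A (n + 1) be) ->
  root_group R A al u -> act u (vertex n) = vertex n.
Proof.
case=> H Hu.
  have [bb Bb E] := coset_fixed H Hu.
  by rewrite /= lcoset_comp (parabolic_coset_eq _ Bb E).
have [bb Bb E] := coset_fixed H Hu.
by rewrite vertex_succ /= lcoset_comp (parabolic_coset_eq _ Bb E).
Qed.

(** The formula exp(qe) f = f + q h - q^2 e, transported by a lift; q corrects t for the scalars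
    between the chosen root vectors. *)
Lemma root_elt_opp al (t : C) : real_roots A al -> t != 0 -> exists f h e : g,
  [/\ root_space (- al) f, root_space 0 h, root_space al e, f != 0 /\ e != 0 &
    root_elt al t f = f + h + e].
Proof.
move=> r t0; have [w W [i _ Ew]] := r; have [phi Hphi] := weyl_elt_lift W.
have aphi := weyl_coset_aut Hphi; have [lphi _ _] := aphi; have pphi := weyl_coset_perm Hphi.
rewrite -sroot0 in Ew; have lw := weyl_elt_linear W.
have rw : real_roots A (w (sroot false i)) by rewrite Ew.
have [c c0 Ec] := root_elt_conj (real_root_sroot false i) rw aphi pphi.
have [d d0 Ed] := root_vector_sroot false i.
set q : C := t / c / d.
have q0 : q != 0 by rewrite !mulf_neq0 ?invr_eq0.
have Eu : root_elt al t \o phi = phi \o Exp_ad (q *: es false i).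
  rewrite -Ew -[t](divfK c0) -Ec; congr (_ \o _).
  by rewrite /root_elt Ed scalerA /q divfK.
exists (phi (es true i)), (phi (q *: hs false i)), (phi (- q ^+ 2 *: es false i)); split.
- by rewrite -Ew -(linN lw) -srootN; exact: permutes_in pphi (root_space_es true i).
- rewrite -(lin0 lw); apply: permutes_in pphi _.
  by apply: root_spaceZ; exact: root_space_hs.
- by rewrite -Ew; apply: permutes_in pphi _; apply: root_spaceZ; exact: root_space_es.
- split; apply: aut_neq0 aphi _; first exact: es_neq0.
  by rewrite scaler_eq0 oppr_eq0 expf_eq0 (negPf q0) andbF (negPf (es_neq0 false i)).
- rewrite (comp_eq Eu) (Exp_es_opp false) -!(linD lphi); congr phi.
  by rewrite scaleNr.
Qed.

Lemma real_root_neq0 al : real_roots A al -> al != 0.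
Proof.
move=> /real_root_cases[r [j [i ->]]]; apply: contraNneq (rho_neq0 j i) => E.
by rewrite -[rho j i](scale_sign r) -/(srho r j i) E scaler0.
Qed.

(** A vector f of weight -al is positive seen from m, so its image under u would have only weights
    positive seen from n. But the image has a nonzero component of weight al, which is negative
    there. *)
Lemma chamber_moved al (t : C) m n : real_roots A al -> t != 0 ->
  (exists2 be, posroots (~~ s) be & al = weyl A m be) ->
  (exists2 be, posroots (~~ s) be & al = weyl A n be) ->
  act (root_elt al t) (chamber m) <> chamber n.
Proof.
move=> r t0 [be Pbe Em] [be' Pbe' En] /=; rewrite lcoset_comp => -[E].
have [bb Bb Eb] := coset_eq_in (borel_id s) E.
have [f [h [e [Hf Hh He [f0 e0] Eu]]]] := root_elt_opp r t0.
have Hm := weyl_coset_lift m; have [_ [m' K K'] _] := weyl_coset_aut Hm.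
have W := weyl_elt_weyl m; have [w' L L'] := weyl_elt_bij W; have W' := weyl_elt_inv W L L'.
have Hm' := weyl_coset_inv W L L' Hm K K'.
have Hx : wspan (signed_roots s) (m' f).
  apply: (gspanI (permutes_in (weyl_coset_perm Hm') Hf)).
  rewrite (linN (weyl_elt_linear W')) Em L => k.
  by case: Pbe => _ /(_ k); rewrite mxE signC mulrN mulNr.
have := weyl_coset_wspan (weyl_coset_lift n) (borel_wspan (@root_closed_signed s) Bb Hx).
rewrite -(comp_eq Eb) /= K' Eu.
pose F mu := if mu == - al then f else if mu == 0 then h else if mu == al then e else 0.
have al0 := real_root_neq0 r.
have nal : al != - al.
  apply: contraNneq al0 => /eqP; rewrite -addr_eq0 => /eqP E0.
  apply/eqP/rowP => k; have := congr1 (fun x : lattice => x 0 k) E0.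
  by rewrite !mxE -mulr2n => /eqP; rewrite mulrn_eq0 => /eqP.
have Na : (- al == 0) = false by rewrite oppr_eq0 (negPf al0).
have FE : \sum_(mu <- [:: - al; 0; al]) F mu = f + h + e.
  rewrite !big_cons big_nil addr0 /F eqxx [0 == - al]eq_sym Na eqxx (negPf nal).
  by rewrite (negPf al0) eqxx addrA.
rewrite -FE => HF.
have [||||mu Qmu] := wspan_components pairing_inj _ _ HF (mu := al).
- by rewrite /= !inE Na eq_sym (negPf nal) eq_sym (negPf al0).
- move=> nu; rewrite /F; case: eqP => [->//|_]; case: eqP => [->//|_]; case: eqP => [->//|_].
  exact: root_space0.
- by rewrite !inE eqxx !orbT.
- by rewrite /F (negPf nal) (negPf al0) eqxx.
rewrite {1}En => /(bij_inj (weyl_elt_bij (weyl_elt_weyl n))) Emu; subst mu.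
by apply: (posroots_disjoint (s := s) _ Pbe'); split=> //; exact: posroots_real Pbe'.
Qed.

Lemma act_comp phi psi (x : simplex R A) : act phi (act psi x) = act (phi \o psi) x.
Proof. by case: x => [X|i X] /=; rewrite lcoset_comp. Qed.

Lemma act_id (x : simplex R A) : act (id : g -> g) x = x.
Proof.
have E (X : set (g -> g)) : id · X = X.
  by apply/seteqP; split=> [_ [y Hy <-]|y Hy] //; exists y.
by case: x => [X|i X] /=; rewrite E.
Qed.

Lemma act_inj phi phi' : cancel phi phi' -> injective (act phi : simplex R A -> simplex R A).
Proof.
move=> K; apply: (@can_inj _ _ _ (act phi')) => x; rewrite act_comp.
by have -> : phi' \o phi = id by [apply: funext => z /=; rewrite K]; rewrite act_id.
Qed.

Lemma boundary_act u n : kac_moody_group u ->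
  boundary s (act u (chamber n)) = [set act u (vertex (n - 1)); act u (vertex n)].
Proof.
move=> Gu; rewrite /= lcoset_comp boundary_chamber; last first.
  by apply: gen_comp => //; exact: lift_group.
have <- : act u @` boundary s (chamber n) =
    [set act u (vertex (n - 1)); act u (vertex n)].
  by rewrite boundary_apt image_setU !image_set1.
rewrite boundary_chamber; last exact: lift_group.
apply/seteqP; split=> [v [i ->]|_ [v [i ->] <-]].
  by exists (Vertex i (lift n · P i)); [exists i|rewrite /= lcoset_comp].
by exists i; rewrite /= lcoset_comp.
Qed.

(** Common to both halves of the theorem: [ci] and [vi] list the chambers and vertices of the moved
    ray from its end outwards, while D and D' index the chambers and vertices of the fixed ray. The
    hypothesis on the boundaries allows either direction. *)
Lemma half_apartment_family al (S S' : set (simplex R A)) (ci vi : nat -> int) (D D' : int -> Prop) :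
  real_roots A al ->
  S = range (fun m => vertex (vi m)) `|` range (fun m => chamber (ci m)) ->
  S' = [set chamber n | n in [set n | D n]] `|` [set vertex n | n in [set n | D' n]] ->
  injective vi ->
  (forall m, (vi m = ci m - 1 /\ vi m.+1 = ci m) \/ (vi m = ci m /\ vi m.+1 = ci m - 1)) ->
  (forall m, exists2 be, posroots (~~ s) be & al = weyl A (ci m) be) ->
  (forall n, D n -> exists2 be, posroots s be & al = weyl A n be) ->
  (forall n, D' n -> D n \/ D (n + 1)) -> D' (vi 0) -> (forall m, D' (vi m) -> m = 0%N) ->
  ray_family_meeting_at_vertex s al S S'.
Proof.
move=> r SE S'E vinj bd out inn D'D D'0 D'eq0; split.
  move=> t t' /= E; apply/eqP; rewrite -subr_eq0; apply/negPn/negP => tt'.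
  (* If two rays agree, u(t - t') maps the first chamber of S to a chamber of S, against
     [chamber_moved]. *)
  have : (act (root_elt al t') @` S) (act (root_elt al t) (chamber (ci 0%N))).
    by rewrite -E; exists (chamber (ci 0%N)) => //; rewrite SE; right; exists 0%N.
  rewrite SE => -[_ [[m _ <-]|[m _ <-]] // Em].
  apply: (chamber_moved r tt' (out 0%N) (out m)).
  rewrite addrC root_eltD // -act_comp -Em act_comp.
  have -> : root_elt al (- t') \o root_elt al t' = id :> (g -> g).
    by apply: funext => z /=; rewrite root_eltK.
  exact: act_id.
move=> u Hu; have Gu := root_group_in_group r Hu.
have [u' [_ K K']] := root_group_inv r Hu; have ainj := act_inj K.
have fixc n : D n -> act u (chamber n) = chamber n.
  by move=> Dn; exact: chamber_fixed (inn _ Dn) Hu.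
have fixv n : D' n -> act u (vertex n) = vertex n.
  move=> /D'D D'n; apply: vertex_fixed Hu.
  by case: D'n => [/inn|/inn]; [left|right].
split.
  exists (fun m => act u (vertex (vi m))), (fun m => act u (chamber (ci m))); split.
  - move=> m; exists (wall_index (vi m)), (u \o lift (vi m)).
      by apply: gen_comp => //; exact: lift_group.
    by rewrite /= lcoset_comp.
  - by move=> m m' /ainj/vertex_inj/vinj.
  - move=> m; exists (u \o lift (ci m)); first by apply: gen_comp => //; exact: lift_group.
    by rewrite /= lcoset_comp.
  - move=> m; rewrite boundary_act //.
    by case: (bd m) => -[-> ->] //; rewrite setUC.
  - by rewrite SE image_setU; congr (_ `|` _); exact: image_comp.
exists (vertex (vi 0%N)).
  exists (wall_index (vi 0%N)), (lift (vi 0%N)) => //; exact: lift_group.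
apply/seteqP; split=> [x [[y Sy <-]]|_ ->]; last first.
  split; last by rewrite S'E; right; exists (vi 0%N).
  by exists (vertex (vi 0%N)); [rewrite SE; left; exists 0%N|exact: fixv].
rewrite S'E; move: Sy; rewrite SE => -[[m _ <-]|[m _ <-]] [[n Dn E]|[n D'n E]] //.
  have nm : n = vi m by apply/vertex_inj/ainj; rewrite (fixv _ D'n).
  by rewrite nm in D'n; rewrite (D'eq0 _ D'n); exact: fixv.
(* u fixes the chamber n, so a common chamber would belong to both half-apartments, and al would be
   of both signs there. *)
have E' : chamber n = chamber (ci m) by apply: ainj; rewrite (fixc _ Dn).
have [be Pbe Ebe] := inn _ Dn; have [be' Pbe' Ebe'] := out m.
case: (posroots_disjoint Pbe); move: Ebe; rewrite (chamber_inj E') Ebe'.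
by move=> /(bij_inj (weyl_elt_bij (weyl_elt_weyl (ci m)))) <-.
Qed.

Lemma signed_Phi1 k : (-1) ^+ s *: Phi A i1 k = (-1) ^+ (~~ s) *: Phi A i2 (k - 1).
Proof. by rewrite Phi1_Phi2 signC scalerN scaleNr. Qed.
End Tree.
End Rank2.

Theorem proposition7p1 (R : realType) (a b : nat)
    (ha : (0 < a)%N) (hb : (0 < b)%N) (hab : (4 < a * b)%N)
    (k : int) (s : bool) :
  let A := cartan a b in
  let alpha1 := (-1) ^+ s *: Phi A i1 k in
  let alpha2 := (-1) ^+ s *: Phi A i2 k in
  ((forall (n : int) phi, n <= k -> root_group R A alpha2 phi ->
      act phi (apt_chamber R A s n) = apt_chamber R A s n) /\
   ray_family_meeting_at_vertex s alpha2 (Rray R A s (k + 1)) (Lray R A s k)) /\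
  ((forall (n : int) phi, k <= n -> root_group R A alpha1 phi ->
      act phi (apt_chamber R A s n) = apt_chamber R A s n) /\
   ray_family_meeting_at_vertex s alpha1 (Lray R A s (k - 1)) (Rray R A s k)).
Proof.
have in1 n : k <= n -> exists2 be, posroots a b s be &
    (-1) ^+ s *: Phi (cartan a b) i1 k = weyl (cartan a b) n be.
  (* Phi_1(k) with sign s is Phi_2(k - 1) with sign [~~ s], hence positive of sign s from k
     onwards. *)
  move=> kn; rewrite (signed_Phi1 ha hb hab) -{1}(negbK s).
  by apply: (signed_Phi2_out ha hb hab (~~ s)); lia.
split; split.
- move=> n phi nk Hphi; rewrite (apt_chamberE R ha hb hab).
  exact: chamber_fixed (signed_Phi2_in ha hb hab s nk) Hphi.
(* The ray R(k + 1) starts at v_(k + 1/2), which is [vertex k], the last vertex of L(k). *)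
- apply: (@half_apartment_family R a b ha hb hab s _ _ _ (fun m => k + 1 + m%:Z) (fun m => k + m%:Z)
    (fun n => n <= k) (fun n => n <= k)).
  + exact: real_root_signed_Phi2.
  + rewrite (RrayE R ha hb hab) setUC; congr (_ `|` _); apply/seteqP; split.
    * by move=> _ [m /= km <-]; exists (absz (m - k)%R) => //; congr vertex; lia.
    * by move=> _ [m _ <-]; exists (k + m%:Z) => //=; lia.
    * by move=> _ [m /= km <-]; exists (absz (m - k - 1)%R) => //; congr chamber; lia.
    * by move=> _ [m _ <-]; exists (k + 1 + m%:Z) => //=; lia.
  + exact: LrayE.
  + by move=> m m'; lia.
  + by move=> m; left; lia.
  + by move=> m; apply: signed_Phi2_out => //; lia.
  + by move=> n; exact: signed_Phi2_in.
  + by left.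
  + by rewrite addr0.
  + by move=> m; lia.
- move=> n phi kn Hphi; rewrite (apt_chamberE R ha hb hab).
  exact: chamber_fixed (in1 n kn) Hphi.
(* Going left, the chamber k - 1 has first vertex v_(k - 1/2), which is [vertex (k - 1)]; so
   chambers and vertices carry the same indices, and the vertices of R(k) start at k - 1. *)
- apply: (@half_apartment_family R a b ha hb hab s _ _ _ (fun m => k - 1 - m%:Z) (fun m => k - 1 - m%:Z)
    (fun n => k <= n) (fun n => k - 1 <= n)).
  + by rewrite (signed_Phi1 ha hb hab); exact: real_root_signed_Phi2.
  + rewrite (LrayE R ha hb hab) setUC; congr (_ `|` _); apply/seteqP; split.
    * by move=> _ [m /= km <-]; exists (absz (k - 1 - m)%R) => //; congr vertex; lia.
    * by move=> _ [m _ <-]; exists (k - 1 - m%:Z) => //=; lia.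
    * by move=> _ [m /= km <-]; exists (absz (k - 1 - m)%R) => //; congr chamber; lia.
    * by move=> _ [m _ <-]; exists (k - 1 - m%:Z) => //=; lia.
  + exact: RrayE.
  + by move=> m m'; lia.
  + by move=> m; right; split=> //; lia.
  + move=> m; rewrite (signed_Phi1 ha hb hab); apply: signed_Phi2_in => //; lia.
  + by move=> n; exact: in1.
  + by move=> n h; right; lia.
  + by rewrite subr0.
  + by move=> m; lia.
Qed.
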